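(* Consider the episodic finite-horizon time-inhomogeneous MDP and the tabular RLSVI agent described in the context, under the independent Dirichlet prior with common pseudocount $\beta \geq 2$. Suppose RLSVI is applied with planning horizon $H$ and parameters $v = H^2$, $\bar{\theta} = H\mathbf{1}$ (every entry equal to $H$) and $v/\lambda = \beta$. Then for all $L \in \mathbb{N}$, \[ {\rm BayesRegret}({\rm RLSVI}_{\bar{\theta}, v, \lambda}, L) \leq 4H^2 \sqrt{\beta |\mathcal{X}||\mathcal{A}| L \log_{+}(1+|\mathcal{X}||\mathcal{A}|HL)}\,\log_{+}\!\left(1+ \frac{L}{|\mathcal{X}||\mathcal{A}|}\right), \] and \[ {\rm BayesRegret}({\rm RLSVI}_{\bar{\theta}, v, \lambda}, L) \leq 4\beta H^3 |\mathcal{X}||\mathcal{A}| \sqrt{\log_{+}(1+|\mathcal{X}| |\mathcal{A}| HL) }\,\log_+\!\left(1+ \frac{L}{|\mathcal{X}||\mathcal{A}|}\right) + 2 H^2 \sqrt{2|\mathcal{X}| |\mathcal{A}|L \log(|\mathcal{X}||\mathcal{A}|) }, \] where $\log_{+}(x) = \max\{1,\log(x)\}$.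
   Context: Setting. $\mathcal{X}$ is a finite set of states, $\mathcal{A}$ a finite set of actions, $H \in \mathbb{N}$ the horizon. An MDP $\mathcal{M}$ specifies an initial-state distribution $\rho$ on $\mathcal{X}$ and, for each $(t,x,a) \in \{0,\dots,H-1\}\times\mathcal{X}\times\mathcal{A}$, an outcome distribution $\mathcal{P}^O_{t,x,a}$ on the outcome space $\{0,1\}\times\mathcal{X}$ (of cardinality $2|\mathcal{X}|$). In each episode $\ell = 1,2,\dots$: $x_0^\ell \sim \rho$; for $t = 0,\dots,H-1$ the agent observes $x_t^\ell$, chooses $a_t^\ell$ and observes an outcome $(r_{t+1}^\ell, x_{t+1}^\ell) \sim \mathcal{P}^O_{t,x_t^\ell,a_t^\ell}$; the episode ends after period $H-1$. A policy is $\pi = (\pi_0,\dots,\pi_{H-1})$ with $\pi_t : \mathcal{X}\to\mathcal{A}$; $V^\pi_{\mathcal{M},t}(x) = \mathbb{E}_{\mathcal{M},\pi}[\sum_{s=t}^{H-1} r_{s+1} \mid x_t = x]$ and $V^*_{\mathcal{M},t}(x) = \max_\pi V^\pi_{\mathcal{M},t}(x)$. Prior. For each $(t,x,a)$, $\mathcal{P}^O_{t,x,a} \sim \mathrm{Dirichlet}(\alpha_{0,t,x,a})$ with $\alpha_{0,t,x,a} \in \mathbb{R}_+^{2|\mathcal{X}|}$ and $\mathbf{1}^T\alpha_{0,t,x,a} = \beta$, independently across $(t,x,a)$. RLSVI (tabular, infinite buffer, greedy actions, Gaussian noise) with parameters $\bar{\theta} \in \mathbb{R}^{\{0,\dots,H-1\}\times\mathcal{X}\times\mathcal{A}}$,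 $v>0$, $\lambda>0$. Let $D_{\ell-1}(t,x,a)$ be the multiset of outcomes $(r^k_{t+1}, x^k_{t+1})$ over episodes $k<\ell$ with $x^k_t = x$, $a^k_t = a$, and $n_\ell(t,x,a) = |D_{\ell-1}(t,x,a)|$. Let $\sigma^2_\ell(t,x,a) = (1/\lambda + n_\ell(t,x,a)/v)^{-1}$ and $w_\ell(t,x,a) = \sigma_\ell(t,x,a)\xi_{\ell,t,x,a}$ where the $\xi$'s are i.i.d. standard normal, independent of everything else. For $Q \in \mathbb{R}^{\mathcal{X}\times\mathcal{A}}$ define \[F_{\ell,t}Q(x,a) = \sigma^2_\ell(t,x,a)\Big(\frac{\bar\theta_{t,x,a}}{\lambda} + \frac{1}{v}\sum_{(r,x')\in D_{\ell-1}(t,x,a)} \big(r + \max_{a'\in\mathcal{A}} Q(x',a')\big)\Big) + w_\ell(t,x,a).\] In episode $\ell$, RLSVI sets $Q_{\ell,H} = 0$, $Q_{\ell,t} = F_{\ell,t}Q_{\ell,t+1}$ for $t<H$, and plays $\pi_\ell$ with $\pi_{\ell,t}(x) \in \arg\max_a Q_{\ell,t}(x,a)$. ${\rm BayesRegret}({\rm RLSVI}_{\bar\theta,v,\lambda}, L) = \mathbb{E}\big[\sum_{\ell=1}^L \big(V^*_{\mathcal{M},0}(x_0^\ell) - V^{\pi_\ell}_{\mathcal{M},0}(x_0^\ell)\big)\big]$, the expectation being over the prior on $\mathcal{M}$, the episode randomness and the RLSVI noise. *)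

(* Defs.v *)
From HB Require Import structures.
From mathcomp Require Import all_boot all_order all_algebra.
From mathcomp Require Import all_classical all_reals all_analysis.

Set Implicit Arguments.
Unset Strict Implicit.
Unset Printing Implicit Defensive.

Import Order.TTheory GRing.Theory Num.Theory.
Local Open Scope ring_scope.

Definition upd (I : eqType) (T : Type) (g : I -> T) (i : I) (z : T) : I -> T :=
  fun j => if j == i then z else g j.

Fixpoint leb_iter (R : realType) (I : eqType) (s : seq I)
    (f : (I -> R) -> \bar R) (y : I -> R) : \bar R :=
  match s with
  | [::] => f y
  | i :: s' =>
      (\int[(@lebesgue_measure R)]_z leb_iter s' f (upd y i z))%E
  end.

(** Expectation of [g] under the Dirichlet(alpha) distribution on the
    probability simplex of the finite set [O], defined through its
    density w.r.t. Lebesgue measure on the coordinates other than a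
    distinguished one [o1] (the first element of [enum O]); the density
    is prod_o p_o^(alpha_o - 1) on the open simplex, normalised by its
    total mass. *)
Definition dir_int (R : realType) (O : finType) (alpha : O -> R)
    (g : (O -> R) -> \bar R) : \bar R :=
  match ohead (enum O) with
  | None => 0%E
  | Some o1 =>
    let S := [seq o <- enum O | o != o1] in
    let p (y : O -> R) : O -> R :=
      fun o => if o == o1 then 1 - \sum_(o' | o' != o1) y o' else y o in
    let dens (y : O -> R) : R :=
      if [forall o, 0 < p y o] then \prod_o (p y o) `^ (alpha o - 1) else 0 in
    let Z := leb_iter S (fun y => (dens y)%:E) (fun _ => 0) in
    let N := leb_iter S (fun y => ((dens y)%:E * g (p y))%E) (fun _ => 0) in
    ((fine Z)^-1%:E * N)%E
  end.

Definition gauss_int (R : realType) (I : finType)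
    (f : (I -> R) -> \bar R) : \bar R :=
  leb_iter (enum I)
    (fun xi => ((\prod_i normal_pdf 0 1 (xi i))%:E * f xi)%E) (fun _ => 0).

Definition logp (R : realType) (x : R) : R := Num.max 1 (ln x).

Section MDP.
Context {R : realType} (X A : finType) (a0 : A) (H : nat).

(** outcome (r, x') with r in {0,1} (encoded as a bool) *)
Definition outcome := (bool * X)%type.
Definition sa_index := ('I_H * X * A)%type.
Definition policy := {ffun 'I_H * X -> A}.
Definition model := sa_index -> outcome -> R.
Definition data := seq (sa_index * outcome).

Definition rew (o : outcome) : R := (nat_of_bool o.1)%:R.

(** V^pi_t(x), computed with fuel d = H - t *)
Fixpoint Vpi_aux (P : model) (pi : policy) (d t : nat) (x : X) : R :=
  match d with
  | 0 => 0
  | d'.+1 =>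
    match (insub t : option 'I_H) with
    | Some i => \sum_(o : outcome)
                  P (i, x, pi (i, x)) o * (rew o + Vpi_aux P pi d' t.+1 o.2)
    | None => 0
    end
  end.

Definition Vpi (P : model) (pi : policy) (x : X) : R := Vpi_aux P pi H 0 x.

Definition pi_default : policy := [ffun=> a0].

Definition Vstar (P : model) (x : X) : R :=
  \big[Num.max/Vpi P pi_default x]_(pi : policy) Vpi P pi x.

Definition nvisits (D : data) (k : sa_index) : nat :=
  count (fun d => d.1 == k) D.

Definition sigma2 (v lambda : R) (D : data) (k : sa_index) : R :=
  (lambda^-1 + (nvisits D k)%:R / v)^-1.

Definition maxQ (Q : X -> A -> R) (x : X) : R :=
  \big[Num.max/Q x a0]_(a : A) Q x a.

(** Q_{ell,t} computed by RLSVI from data D and noise xi, with fuel d = H - t *)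
Fixpoint Qaux (theta : sa_index -> R) (v lambda : R) (D : data)
    (xi : sa_index -> R) (d t : nat) : X -> A -> R :=
  match d with
  | 0 => fun _ _ => 0
  | d'.+1 =>
    let Qn := Qaux theta v lambda D xi d' t.+1 in
    fun x a =>
      match (insub t : option 'I_H) with
      | Some i =>
        let k := (i, x, a) in
        sigma2 v lambda D k *
          (theta k / lambda
           + v^-1 * \sum_(dd <- D | dd.1 == k) (rew dd.2 + maxQ Qn dd.2.2))
        + Num.sqrt (sigma2 v lambda D k) * xi k
      | None => 0
      end
  end.

Definition Qrlsvi theta v lambda D xi (t : nat) : X -> A -> R :=
  Qaux theta v lambda D xi (H - t) t.

Definition rlsvi_policy theta v lambda (D : data) (xi : sa_index -> R) : policy :=
  [ffun tx : 'I_H * X =>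
     [arg max_(a > a0) Qrlsvi theta v lambda D xi tx.1 tx.2 a]%O].

(** within an episode: x_0 and outcomes os_t = (r_{t+1}, x_{t+1}) *)
Definition epstate (x0 : X) (os : {ffun 'I_H -> outcome}) (i : 'I_H) : X :=
  match (insub i.-1 : option 'I_H) with
  | Some j => if i == 0 :> nat then x0 else (os j).2
  | None => x0
  end.

Definition traj_prob (rho : X -> R) (P : model) (pi : policy)
    (x0 : X) (os : {ffun 'I_H -> outcome}) : R :=
  rho x0 * \prod_(i : 'I_H)
             P (i, epstate x0 os i, pi (i, epstate x0 os i)) (os i).

Definition traj_data (pi : policy) (x0 : X) (os : {ffun 'I_H -> outcome}) : data :=
  [seq ((i, epstate x0 os i, pi (i, epstate x0 os i)), os i) | i <- enum 'I_H].

Fixpoint Wreg (rho : X -> R) (theta : sa_index -> R) (v lambda : R)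
    (P : model) (m : nat) (D : data) : \bar R :=
  match m with
  | 0 => 0%E
  | m'.+1 =>
    gauss_int (fun xi : sa_index -> R =>
      let pi := rlsvi_policy theta v lambda D xi in
      ((\sum_(x : X) rho x * (Vstar P x - Vpi P pi x))%:E
       + \sum_(x0 : X) \sum_(os : {ffun 'I_H -> outcome})
           (traj_prob rho P pi x0 os)%:E
           * Wreg rho theta v lambda P m' (D ++ traj_data pi x0 os))%E)
  end.

Fixpoint prior_int (alpha : sa_index -> outcome -> R) (s : seq sa_index)
    (f : model -> \bar R) (P : model) : \bar R :=
  match s with
  | [::] => f P
  | k :: s' => dir_int (alpha k) (fun q => prior_int alpha s' f (upd P k q))
  end.

Definition BayesRegret (rho : X -> R) (alpha : sa_index -> outcome -> R)
    (theta : sa_index -> R) (v lambda : R) (L : nat) : \bar R :=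
  prior_int alpha (enum {: 'I_H * X * A})
    (fun P => Wreg rho theta v lambda P L [::]) (fun _ _ => 0).

End MDP.

(* Main.v *)
(** Given the data, the posterior is again a product of Dirichlet laws, with
    mean transition model [hatP], so the regret is bounded episode by episode
    in conditional expectation.

    Optimism: for [g] convex, nondecreasing and Lipschitz and [v] valued in
    [[0, c]], the Dirichlet expectation of [g (p . v)] is at most that of [g] at
    a normal variable with the same mean and standard deviation [c / sqrt b],
    [b] being the total pseudocount.  Replacing the Dirichlet vectors by the
    RLSVI targets one index at a time, in order of increasing [t], shows that
    the posterior mean of [Vstar] is at most the expected value computed by
    RLSVI.

    One episode: what remains is the gap between the RLSVI value and the value
    of its policy in [hatP], which telescopes into Bellman gaps along the path:
    a bias of order [1 / (beta + n)] and the Gaussian noise of standard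
    deviation [H / sqrt (beta + n)] at an index visited [n] times.

    Summation: the noise at an index is cut at a deterministic level [u n],
    chosen so that the expected excesses over the levels add up to little; bias
    and levels then depend on the counts only and are summed by a pigeonhole
    argument, in the form of the potential [Pot].  Choosing levels that decrease
    with [n], instead of a union bound over all episodes, is what leaves
    only [log (|X| |A|)] under the last square root of the second bound.  The
    first bound follows from the same estimate and the trivial bound [H L]. *)

Require Import Defs.
From HB Require Import structures.
From mathcomp Require Import all_boot all_order all_algebra.
From mathcomp Require Import all_classical all_reals all_analysis.
From mathcomp Require Import measurable_realfun.
From mathcomp Require Import ring lra.
Import numFieldNormedType.Exports.
Import Order.TTheory GRing.Theory Num.Theory.
Local Open Scope ring_scope.

(** The regret is defined by nested Lebesgue integrals in the extended reals. They are rewritten as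
    integrals against probability measures on function spaces, each Lebesgue coordinate being a
    normal one weighted by the inverse density, and models are retracted to stochastic ones, so that
    a bound on the simplex holds at every point.

    The period is part of an index, so an episode visits no index twice. Hence the mean model can be
    frozen during an episode, and the gains of an episode are exactly the increment of the
    potential.

    The order of replacement in the optimism argument is forced: comparing one row needs a
    continuation value in [[0, H]], which posterior rows guarantee and RLSVI targets do not.

    The path depends on the noise of its own episode, so excesses over the levels are summed over
    all indices, visited or not. With [N = |X| |A|], the level is [U = sqrt (2 ln N)], lowered by
    [2 / theta] and raised by a logarithm decreasing in the count; the excesses and the logarithm
    each cost [1 / theta], so the total is again [U]. *)

(** * Function spaces with the product sigma-algebra *)

Definition cylinders {d} (I : eqType) (T : measurableType d) : set (set (I -> T)) :=
  [set C | exists i (B : set T), measurable B /\ C = (fun y : I -> T => y i) @^-1` B]%classic.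

Definition funSpace {d} (I : eqType) (T : measurableType d) :=
  g_sigma_algebraType (cylinders I T).

Lemma probability_image {d d'} {T : measurableType d} {T' : measurableType d'}
    {R : realType} (P : probability T R) (phi : T -> T')
    (mphi : measurable_fun [set: T]%classic phi) :
  exists Q : probability T' R, forall f : T' -> \bar R,
    (forall y, (0 <= f y)%E) -> measurable_fun setT f ->
    (\int[Q]_y f y = \int[P]_x f (phi x))%E.
Proof.
pose X : {mfun T >-> T'} := HB.pack phi (isMeasurableFun.Build _ _ _ _ phi mphi).
exists (distribution P X) => f f0 mf.
by rewrite (@ge0_integral_distribution _ _ _ _ _ P X f mf f0).
Qed.

(** * Iterated integrals and Gaussian products *)

Section IteratedIntegral.
Context {d : measure_display} {T : measurableType d} {R : realType} {I : eqType}.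
Local Open Scope classical_set_scope.
Local Open Scope ereal_scope.
Local Notation prodType := (funSpace I T).

Lemma measurable_coord (i : I) :
  measurable_fun [set: prodType] (fun y : prodType => y i).
Proof.
move=> _ B mB; rewrite setTI; apply: sub_sigma_algebra.
by exists i, B.
Qed.

Lemma measurable_into_funSpace {d'} {T' : measurableType d'} (f : T' -> prodType) :
  (forall i, measurable_fun [set: T'] (fun x => f x i)) ->
  measurable_fun [set: T'] f.
Proof.
move=> mf; apply: (@measurability _ _ T' prodType setT f (cylinders I T)) => //.
move=> _ [_ [i [B [mB ->]]] <-].
have := mf i measurableT B mB; by rewrite !setTI.
Qed.

Lemma measurable_upd (i : I) :
  measurable_fun [set: prodType * T] (fun p : prodType * T => upd p.1 i p.2 : prodType).
Proof.
apply: measurable_into_funSpace => j; rewrite /upd.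
case: eqP => _ /=; first exact: measurable_snd.
exact: (measurableT_comp (measurable_coord j) measurable_fst).
Qed.

Lemma measurable_updr (i : I) (y : prodType) :
  measurable_fun [set: T] (fun z : T => upd y i z : prodType).
Proof. exact: (measurableT_comp (measurable_upd i) (pair1_measurable y)). Qed.

Lemma upd_upd (y : I -> T) i z z' : upd (upd y i z) i z' = upd y i z'.
Proof. by apply/funext => j; rewrite /upd; case: eqP. Qed.

Lemma updC (y : I -> T) i j z z' : i != j ->
  upd (upd y i z) j z' = upd (upd y j z') i z.
Proof.
move=> ij; apply/funext => k; rewrite /upd.
by case: (eqVneq k j) => // ->; case: eqP => // ji; move: ij; rewrite ji eqxx.
Qed.

Lemma upd_same (y : I -> T) i z : upd y i z i = z.
Proof. by rewrite /upd eqxx. Qed.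

(** Same recursion as [leb_iter] and [prior_int], with probability measures instead of Lebesgue or
    Dirichlet integrals; [y] supplies the coordinates outside [s]. *)
Fixpoint iter_int (mu : I -> probability T R) (s : seq I)
    (f : prodType -> \bar R) (y : prodType) : \bar R :=
  if s is i :: s' then \int[mu i]_z iter_int mu s' f (upd y i z) else f y.

Lemma iter_int_ge0 mu s (f : prodType -> \bar R) y :
  (forall y, 0 <= f y) -> 0 <= iter_int mu s f y.
Proof.
by move=> f0; elim: s y => //= i s IH y; apply: integral_ge0 => z _.
Qed.

Lemma measurable_iter_int mu s (f : prodType -> \bar R) :
  (forall y, 0 <= f y) -> measurable_fun setT f ->
  measurable_fun setT (iter_int mu s f).
Proof.
move=> f0 mf; elim: s => //= i s IH.
apply: (@measurable_fun_fubini_tonelli_F _ _ prodType T R (mu i)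
  (fun p => iter_int mu s f (upd p.1 i p.2))).
  exact: (measurableT_comp IH (measurable_upd i)).
by move=> p; exact: iter_int_ge0.
Qed.

Lemma eq_iter_int mu s (f g : prodType -> \bar R) y :
  (forall y', (forall i, i \notin s -> y' i = y i) -> f y' = g y') ->
  iter_int mu s f y = iter_int mu s g y.
Proof.
elim: s y => /= [|i s IH] y fg; first exact: fg.
apply: eq_integral => z _; apply: IH => y' y'E; apply: fg => j.
rewrite inE negb_or => /andP[ji js]; rewrite y'E// /upd.
by rewrite (negbTE ji).
Qed.

Lemma ge0_iter_intZ mu s (k : R) (f : prodType -> \bar R) y :
  (0 <= k)%R -> (forall y, 0 <= f y) -> measurable_fun setT f ->
  iter_int mu s (fun y => k%:E * f y) y = k%:E * iter_int mu s f y.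
Proof.
move=> k0 f0 mf; elim: s y => //= i s IH y.
under eq_integral do rewrite IH.
rewrite ge0_integralZl//.
- exact: (measurableT_comp (measurable_iter_int mu s f f0 mf) (measurable_updr i y)).
- by move=> z _; exact: iter_int_ge0.
Qed.

Lemma le_iter_int mu s (f g : prodType -> \bar R) y :
  (forall y, 0 <= f y) -> measurable_fun setT f ->
  (forall y, 0 <= g y) -> measurable_fun setT g ->
  (forall y, f y <= g y) -> iter_int mu s f y <= iter_int mu s g y.
Proof.
move=> f0 mf g0 mg fg; elim: s y => //= i s IH y.
apply: ge0_le_integral => //.
- by move=> z _; exact: iter_int_ge0.
- exact: (measurableT_comp (measurable_iter_int mu s f f0 mf) (measurable_updr i y)).
- exact: (measurableT_comp (measurable_iter_int mu s g g0 mg) (measurable_updr i y)).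
Qed.

Lemma eq_iter_int_measure mu mu' s (f : prodType -> \bar R) y :
  (forall i, i \in s -> mu i = mu' i) -> iter_int mu s f y = iter_int mu' s f y.
Proof.
elim: s y => //= i s IH y mumu.
rewrite mumu ?inE ?eqxx//; apply: eq_integral => z _; apply: IH => j js.
by rewrite mumu// inE js orbT.
Qed.

Lemma iter_int_swap {d'} {T' : measurableType d'} (nu : probability T' R) mu s
    (G : T' * prodType -> \bar R) y :
  (forall p, 0 <= G p) -> measurable_fun setT G ->
  \int[nu]_q iter_int mu s (fun y => G (q, y)) y =
  iter_int mu s (fun y => \int[nu]_q G (q, y)) y.
Proof.
elim: s G y => //= i s IH G y G0 mG.
pose F (p : T' * T) := iter_int mu s (fun y => G (p.1, y)) (upd y i p.2).
have mGq q : measurable_fun setT (fun y => G (q, y)).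
  exact: (measurableT_comp mG (pair1_measurable q)).
rewrite (fubini_tonelli F).
- apply: eq_integral => z _; rewrite /F/=.
  by rewrite -IH.
- rewrite /F.
  suff : measurable_fun setT (fun p : T' * prodType => iter_int mu s (fun y => G (p.1, y)) p.2).
    have m2 : measurable_fun setT (fun p : T' * T => (p.1, upd y i p.2 : prodType)).
      apply: measurable_fun_pair; first exact: measurable_fst.
      exact: (measurableT_comp (measurable_updr i y) measurable_snd).
    by move=> m1; exact: (measurableT_comp m1 m2).
  elim: s {IH F} => //= [|j s IHs].
    by move: mG; congr measurable_fun; apply/funext => -[].
  apply: (@measurable_fun_fubini_tonelli_F _ _ (T' * prodType)%type T R (mu j)
    (fun p => iter_int mu s (fun y => G (p.1.1, y)) (upd p.1.2 j p.2))).
    have m1 : measurable_fun setT (fun p : T' * prodType * T => (p.1.2, p.2)).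
      apply: measurable_fun_pair; last exact: measurable_snd.
      exact: (measurableT_comp measurable_snd measurable_fst).
    have m2 : measurable_fun setT
        (fun p : T' * prodType * T => (p.1.1, upd p.1.2 j p.2 : prodType)).
      apply: measurable_fun_pair.
        exact: (measurableT_comp measurable_fst measurable_fst).
      exact: (measurableT_comp (measurable_upd j) m1).
    exact: (measurableT_comp IHs m2).
  by move=> p; exact: iter_int_ge0.
- by move=> p; exact: iter_int_ge0.
Qed.

Lemma iter_int_upd_notin mu s (f : prodType -> \bar R) y k q : k \notin s ->
  iter_int mu s f (upd y k q) = iter_int mu s (fun y' => f (upd y' k q)) y.
Proof.
elim: s y => //= i s IH y; rewrite inE negb_or => /andP[ki ks].
by apply: eq_integral => z _; rewrite -IH// updC.
Qed.

(** Coordinate [k] is integrated anyway, so averaging over it beforehand changes nothing: at the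
    turn of [k] the outer integral is that of a constant. A comparison for one coordinate with the
    others frozen thereby extends to the iterated integral. *)
Lemma iter_int_resample mu s (f : prodType -> \bar R) y k :
  (forall y, 0 <= f y) -> measurable_fun setT f -> uniq s -> k \in s ->
  iter_int mu s f y = iter_int mu s (fun y' => \int[mu k]_q f (upd y' k q)) y.
Proof.
move=> f0 mf; elim: s y => //= i s IH y /andP[is_ us].
rewrite inE; have [-> _|ki /= ks] := eqVneq k i; last first.
  by apply: eq_integral => z _; rewrite -IH.
under [RHS]eq_integral => z _.
  rewrite iter_int_upd_notin//.
  under eq_fun do under eq_integral do rewrite upd_upd.
  over.
rewrite integral_cst//= probability_setT mule1.
rewrite -(@iter_int_swap _ _ (mu i) mu s (fun p => f (upd p.2 i p.1)))//.
  by apply: eq_integral => z _; rewrite iter_int_upd_notin.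
apply: (measurableT_comp mf).
exact: (measurableT_comp (measurable_upd i) (@measurable_swap _ _ T prodType)).
Qed.

(** The product measure is built one factor at a time, as an image under [upd]. It makes integrals
    of signed functions available. *)
Lemma iter_int_measure mu s (y0 : prodType) : uniq s ->
  exists Pi : probability prodType R, forall f : prodType -> \bar R,
    (forall y, 0 <= f y) -> measurable_fun setT f ->
    \int[Pi]_y f y = iter_int mu s f y0.
Proof.
elim: s y0 => /= [|i s IH] y0.
  exists (\d_ y0) => f f0 mf.
  by rewrite integral_dirac//= diracT mul1e.
move=> /andP[si us]; have [Pi PiE] := IH y0 us.
pose phi (p : T * prodType) : prodType := upd p.2 i p.1.
have mphi : measurable_fun setT phi.
  exact: (measurableT_comp (measurable_upd i) (@measurable_swap _ _ T prodType)).
have [Q QE] := probability_image (mu i \x Pi) phi mphi.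
exists Q => f f0 mf.
have mfphi : measurable_fun setT (fun p => f (phi p)) by exact: (measurableT_comp mf mphi).
rewrite QE// (fubini_tonelli1 _ mfphi); last by move=> ?; exact: f0.
apply: eq_integral => z _.
rewrite iter_int_upd_notin// /fubini_F PiE//.
exact: (measurableT_comp mfphi (pair1_measurable z)).
Qed.

End IteratedIntegral.

(** * Measures given by a density *)

Section Density.
Context {d : measure_display} {T : measurableType d} {R : realType}.
Local Open Scope classical_set_scope.
Local Open Scope ereal_scope.
Variables (mu : {measure set T -> \bar R}) (h : T -> R).
Hypotheses (mh : measurable_fun [set: T] h) (h0 : forall x, (0 <= h x)%R).

Import HBNNSimple.

(** For indicator functions this is the hypothesis on [nu]; simple functions and monotone limits
    extend it. *)
Lemma ge0_integral_density (nu : {measure set T -> \bar R}) (f : T -> \bar R) :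
  (forall A, measurable A -> nu A = \int[mu]_(x in A) (h x)%:E) ->
  (forall x, 0 <= f x) -> measurable_fun [set: T] f ->
  \int[nu]_x f x = \int[mu]_x ((h x)%:E * f x).
Proof.
move=> nuE f0 mf; pose g x := (h x)%:E.
have mg : measurable_fun setT g by exact/measurable_EFinP.
have g0 x : 0 <= g x by rewrite lee_fin.
pose E := [set: T]; have mE : measurable E by exact: measurableT.
pose k := nnsfun_approx mE mf.
have -> : \int[nu]_(x in E) f x =
    lim (\int[nu]_(x in E) (EFin \o k n) x @[n --> \oo]).
  have fE x : E x -> f x = lim ((EFin \o k n) x @[n --> \oo]).
    by move=> Ex; apply/esym/cvg_lim => //; apply: (cvg_nnsfun_approx mE mf) => // *.
  under eq_integral => x /[!inE] /fE -> //.
  apply: monotone_convergence => //.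
  - by move=> n; apply/measurable_EFinP; exact/measurable_funP.
  - by move=> n x Ex //=; rewrite lee_fin.
  - by move=> x Ex a b ab; rewrite lee_fin; exact/lefP/nd_nnsfun_approx.
under [RHS]eq_integral do rewrite muleC.
have -> : \int[mu]_(x in E) (f \* g) x =
    lim (\int[mu]_(x in E) ((EFin \o k n) \* g) x @[n --> \oo]).
  have fg x : E x -> f x * g x = lim (((EFin \o k n) \* g) x @[n --> \oo]).
    by move=> Ex; apply/esym/cvg_lim => //; apply: cvgeZr => //;
      apply: (cvg_nnsfun_approx mE mf) => // *.
  under eq_integral => x /[!inE] /fg -> //.
  apply: monotone_convergence => [//| | |].
  - by move=> n; apply: emeasurable_funM; [apply/measurable_EFinP; exact/measurable_funP|exact: mg].
  - by move=> n x Ex /=; rewrite mule_ge0 ?lee_fin.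
  - by move=> x Ex a b ab/=; rewrite lee_wpmul2r ?lee_fin//; exact/lefP/nd_nnsfun_approx.
suff suf n : \int[mu]_(x in E) ((EFin \o k n) x * g x) =
    \int[nu]_(x in E) (EFin \o k n) x.
  by congr (lim (_ @ \oo)); apply/funext => n; rewrite suf.
transitivity (\int[nu]_(x in E)
   (\sum_(y \in range (k n)) (y * \1_(k n @^-1` [set y]) x)%:E)); last first.
  by apply: eq_integral => t tE; rewrite /= fimfunE -fsumEFin.
have indich m r : measurable_fun E (fun x => (r * \1_(k m @^-1` [set r]) x)%:E).
  by apply: (measurable_comp measurableT) => //; exact: measurable_funM.
rewrite ge0_integral_fsum//; last by move=> m y Ey; exact: nnfun_muleindic_ge0.
transitivity (\int[mu]_(x in E) (\sum_(y \in range (k n))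
    (y * \1_(k n @^-1` [set y]) x)%:E * g x)).
  under [RHS]eq_integral => x xE.
    rewrite -ge0_mule_fsuml => [|y]; last exact: nnfun_muleindic_ge0.
    rewrite fsumEFin // -(fimfunE _ x); over.
  by [].
rewrite ge0_integral_fsum//; last 2 first.
  - move=> y; apply: emeasurable_funM; first exact: indich.
    exact: mg.
  - by move=> m y Ey; rewrite mule_ge0 ?nnfun_muleindic_ge0.
apply: eq_fsbigr => r rhn.
under [RHS]eq_integral do rewrite EFinM.
rewrite integralZl_indic_nnsfun => //.
under eq_integral do rewrite EFinM -muleA.
rewrite ge0_integralZl//.
- under eq_integral do rewrite muleC.
  rewrite (eq_integral (g \_ (k n @^-1` [set r]))); last first.
    by move=> x xE; rewrite epatch_indic.
  by rewrite -integral_mkcondr -nuE// integral_indic// setIC.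
- by apply: emeasurable_funM; [exact/measurable_EFinP|exact: mg].
- by move=> t Et; rewrite mule_ge0 ?lee_fin.
- by move: rhn; rewrite inE => -[t _ <-]; rewrite lee_fin.
Qed.

Hypothesis h1 : \int[mu]_x (h x)%:E = 1.

Definition density_set (A : set T) := \int[mu]_(x in A) (h x)%:E.

Let ds0 : density_set set0 = 0. Proof. by rewrite /density_set integral_set0. Qed.

Let ds_ge0 A : 0 <= density_set A.
Proof. by apply: integral_ge0 => x _; rewrite lee_fin. Qed.

Let ds_sigma : semi_sigma_additive density_set.
Proof.
move=> /= A mA tA mUA.
rewrite /density_set/= ge0_integral_bigcup//=; last 2 first.
- by apply/measurable_EFinP; exact: measurable_funTS.
- by move=> x _; rewrite lee_fin.
apply: is_cvg_ereal_nneg_natsum_cond => n _ _; exact: ds_ge0.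
Qed.

HB.instance Definition _ := isMeasure.Build _ _ _ density_set ds0 ds_ge0 ds_sigma.

Let ds1 : density_set setT = 1. Proof. by []. Qed.

HB.instance Definition _ := @Measure_isProbability.Build _ _ R density_set ds1.

Lemma density_probability : exists nu : probability T R,
  forall f : T -> \bar R, (forall x, 0 <= f x) -> measurable_fun [set: T] f ->
  \int[nu]_x f x = \int[mu]_x ((h x)%:E * f x).
Proof. by exists density_set => f f0 mf; exact: ge0_integral_density. Qed.

End Density.

Section GaussianProduct.
Context {R : realType} {I : eqType}.
Local Open Scope classical_set_scope.
Local Open Scope ereal_scope.

Lemma ge0_integral_normal_prob (m s : R) (f : R -> \bar R) :
  (forall x, 0 <= f x) -> measurable_fun [set: R] f ->
  \int[normal_prob m s]_x f x = \int[lebesgue_measure]_x ((normal_pdf m s x)%:E * f x).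
Proof.
move=> f0 mf; apply: (ge0_integral_density lebesgue_measure (normal_pdf m s)) => //.
- exact: measurable_normal_pdf.
- exact: normal_pdf_ge0.
Qed.

Lemma normal_pdf01_gt0 (x : R) : (0 < normal_pdf 0 1 x)%R.
Proof.
by rewrite normal_pdfE ?oner_neq0// mulr_gt0 ?expR_gt0// normal_peak_gt0// oner_neq0.
Qed.

Definition gauss_measures := fun _ : I => (@normal_prob R 0 1 : probability (measurableTypeR R) R).

Lemma measurable_inv_pdf (i : I) :
  measurable_fun setT (fun y : funSpace I (measurableTypeR R) => (normal_pdf 0 1 (y i))^-1%R).
Proof.
have m1 : measurable_fun [set: R] (fun x : R => (normal_pdf 0 1 x)^-1%R).
  apply: continuous_measurable_fun => x; apply: cvgV.
    by rewrite gt_eqF// normal_pdf01_gt0.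
  by apply: continuous_normal_pdf; rewrite oner_neq0.
exact: (measurableT_comp m1 (measurable_coord i)).
Qed.

Lemma measurable_inv_pdfs (s : seq I) :
  measurable_fun setT (fun y : funSpace I (measurableTypeR R) => \prod_(i <- s) (normal_pdf 0 1 (y i))^-1)%R.
Proof. by apply: measurable_prod => i _; exact: measurable_inv_pdf. Qed.

Lemma inv_pdfs_ge0 (s : seq I) (y : I -> R) :
  (0 <= \prod_(i <- s) (normal_pdf 0 1 (y i))^-1)%R.
Proof. by apply: prodr_ge0 => i _; rewrite invr_ge0 normal_pdf_ge0. Qed.

(** Lebesgue measure is not a probability, hence outside the scope of [iter_int]; writing it as the
    normal law weighted by the inverse density brings it there. Dirichlet and Gaussian integrals
    then share one theory. *)
Lemma leb_iterE (s : seq I) (f : funSpace I (measurableTypeR R) -> \bar R) (y : funSpace I (measurableTypeR R)) :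
  uniq s -> (forall y, 0 <= f y) -> measurable_fun setT f ->
  leb_iter s f y = iter_int gauss_measures s
    (fun y' => (\prod_(i <- s) (normal_pdf 0 1 (y' i))^-1)%:E * f y') y.
Proof.
move=> + f0 mf; elim: s y => [|i s IH] y /=; first by rewrite big_nil mul1e.
move=> /andP[si us].
pose F (y' : funSpace I (measurableTypeR R)) := (\prod_(j <- s) (normal_pdf 0 1 (y' j))^-1)%:E * f y'.
have F0 y' : 0 <= F y' by rewrite mule_ge0// lee_fin inv_pdfs_ge0.
have mF : measurable_fun setT F.
  by apply: emeasurable_funM => //; apply/measurable_EFinP; exact: measurable_inv_pdfs.
transitivity (\int[lebesgue_measure]_z iter_int gauss_measures s F (upd y i z)).
  by apply: eq_integral => z _; rewrite IH.
transitivity (\int[normal_prob 0 1]_z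
    (((normal_pdf 0 1 z)^-1)%:E * iter_int gauss_measures s F (upd y i z))).
  rewrite ge0_integral_normal_prob.
  - apply: eq_integral => z _; rewrite muleA -EFinM mulfV ?mul1e//.
    by rewrite gt_eqF// normal_pdf01_gt0.
  - move=> z; rewrite mule_ge0//; last exact: iter_int_ge0.
    by rewrite lee_fin invr_ge0 normal_pdf_ge0.
  - apply: emeasurable_funM.
      apply/measurable_EFinP.
      apply: continuous_measurable_fun => x; apply: cvgV.
        by rewrite gt_eqF// normal_pdf01_gt0.
      by apply: continuous_normal_pdf; rewrite oner_neq0.
    exact: (measurableT_comp (measurable_iter_int _ s F F0 mF) (measurable_updr i y)).
apply: eq_integral => z _.
rewrite -ge0_iter_intZ// ?invr_ge0 ?normal_pdf_ge0//.
apply: eq_iter_int => y' y'E; rewrite /F big_cons EFinM muleA.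
by rewrite y'E// upd_same.
Qed.

End GaussianProduct.

Lemma gauss_intE {R : realType} {I : finType} (f : funSpace I (measurableTypeR R) -> \bar R) :
  (forall y, 0 <= f y)%E -> measurable_fun setT f ->
  gauss_int f = iter_int gauss_measures (enum I) f (fun _ => 0).
Proof.
move=> f0 mf; rewrite /gauss_int leb_iterE ?enum_uniq//.
- apply: eq_iter_int => y _; rewrite muleA -EFinM big_enum/= -big_split/=.
  rewrite big1 ?mul1e// => i _; rewrite mulVf// gt_eqF// normal_pdf01_gt0//.
- move=> y; rewrite mule_ge0// lee_fin; apply: prodr_ge0 => i _.
  exact: normal_pdf_ge0.
- apply: emeasurable_funM => //; apply/measurable_EFinP.
  apply: measurable_prod => i _.
  exact: (measurableT_comp (measurable_normal_pdf 0 1) (measurable_coord i)).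
Qed.

(** * The beta integral *)

Section LebesgueAffine.
Context {R : realType}.
Local Open Scope classical_set_scope.
Local Open Scope ereal_scope.
Variables (r m : R).
Hypothesis r0 : (0 < r)%R.

Let phi : measurableTypeR R -> measurableTypeR R := fun x => (r * x + m)%R.

Let mphi : measurable_fun [set: measurableTypeR R] phi.
Proof. by apply: measurable_funD => //; exact: measurable_funM. Qed.

Let image_lebesgue : {measure set (measurableTypeR R) -> \bar R} :=
  measure_function_pushforward__canonical__measure_function_Measure lebesgue_measure mphi.

Let scaled_image : {measure set (measurableTypeR R) -> \bar R} :=
  mscale (NngNum (ltW r0)) image_lebesgue.

Let lebesgueE A : measurable A -> lebesgue_measure A = scaled_image A.
Proof.
move=> mA; apply: lebesgue_measure_unique => // _ [[a b] _ <-].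
rewrite /scaled_image/= /mscale/= /pushforward.
have -> : phi @^-1` `]a, b] = `]((a - m) / r)%R, ((b - m) / r)%R].
  apply/seteqP; split => x /=; rewrite /phi !in_itv/= ltr_pdivrMr// ler_pdivlMr//;
  by rewrite ltrBlDr lerBrDr (mulrC x).
rewrite !lebesgue_measure_itv/= !lte_fin ltr_pM2r ?invr_gt0// ltrD2r.
case: ifPn => _; last by rewrite mule0.
by rewrite -EFinM -!EFinB -mulrBl mulrCA mulfV ?gt_eqF// mulr1 opprB addrA subrK.
Qed.

(** Lebesgue measure is determined by the length of intervals, and its image under the affine map,
    scaled by [r], gives intervals the same length. *)
Lemma ge0_integral_lebesgue_affine (f : R -> \bar R) :
  (forall x, 0 <= f x) -> measurable_fun [set: R] f ->
  \int[lebesgue_measure]_x f (r * x + m)%R = (r^-1)%:E * \int[lebesgue_measure]_x f x.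
Proof.
move=> f0 mf.
have -> : \int[lebesgue_measure]_x f x = \int[scaled_image]_x f x.
  by apply: eq_measure_integral => A mA _; exact: lebesgueE.
rewrite /scaled_image ge0_integral_mscale//=.
rewrite muleA -EFinM mulVf ?gt_eqF// mul1e.
by rewrite (ge0_integral_pushforward mphi).
Qed.

End LebesgueAffine.

Section PowerIntegral.
Context {R : realType}.
Local Open Scope classical_set_scope.
Local Open Scope ereal_scope.

Lemma integral_powR (b x : R) : (0 < b)%R -> (0 < x)%R ->
  \int[lebesgue_measure]_(z in `]0%R, x]) (z `^ (b - 1))%:E = (x `^ b / b)%:E.
Proof.
move=> b0 x0.
(* For [b < 1] the integrand is singular at 0, so the interval is exhausted by closed intervals away
   from 0, on which the fundamental theorem of calculus applies. The shift to [n.+2] keeps them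
   nondegenerate. *)
pose F (n : nat) : set R := `[(x / n.+2%:R)%R, x].
have -> : `]0%R, x] = \bigcup_n F n.
  apply/seteqP; split => z; rewrite /F /= in_itv/=.
    move=> /andP[z0 zx].
    exists (Num.truncn (x / z)) => //=; rewrite in_itv/= zx andbT.
    rewrite ler_pdivrMr// mulrC -ler_pdivrMr//.
    by apply: ltW; apply: lt_le_trans (truncnS_gt _) _; rewrite ler_nat.
  move=> [n _] /=; rewrite !in_itv/= => /andP[+ ->]; rewrite andbT.
  by apply: lt_le_trans; rewrite divr_gt0.
have mpow : measurable_fun [set: R] (fun z : R => (z `^ (b - 1))%:E).
  by apply/measurable_EFinP; exact: measurable_powR.
have cvg1 : \int[lebesgue_measure]_(z in F n) (z `^ (b - 1))%:E @[n --> \oo] -->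
    \int[lebesgue_measure]_(z in \bigcup_n F n) (z `^ (b - 1))%:E.
  apply: ge0_nondecreasing_set_cvg_integral.
  - move=> n m nm; rewrite subsetEset => z; rewrite /F/= !in_itv/= => /andP[xz ->].
    rewrite andbT; apply: le_trans xz; rewrite ler_pM2l// lef_pV2 ?posrE//.
    by rewrite ler_nat.
  - by move=> n; exact: measurable_itv.
  - by move=> n; exact: measurable_funTS.
  - by move=> n z _; rewrite lee_fin powR_ge0.
have cvg2 : \int[lebesgue_measure]_(z in F n) (z `^ (b - 1))%:E @[n --> \oo] -->
    (x `^ b / b)%:E.
  have -> : (fun n => \int[lebesgue_measure]_(z in F n) (z `^ (b - 1))%:E) =
      (fun n => ((x `^ b - (x / n.+2%:R) `^ b) / b)%:E).
    apply/funext => n; rewrite /F.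
    have xn0 : (0 < x / n.+2%:R)%R by rewrite divr_gt0.
    have dF (z : R) : (0 < z)%R ->
        is_derive z (1%R : R) (fun z => z `^ b / b)%R (z `^ (b - 1))%R.
      move=> z0; have h := is_derive1_powR b z0.
      have -> : (fun z => z `^ b / b)%R = (b^-1 \*: (fun y : R => y `^ b : R^o))%R.
        by apply/funext => y; rewrite /= mulrC.
      apply: is_derive_eq.
      by rewrite /GRing.scale/= mulrA mulVf ?mul1r// gt_eqF.
    have cF (z : R) : (0 < z)%R -> {for z, continuous ((fun y : R => y `^ b / b)%R : R -> R)}.
      move=> z0; apply: differentiable_continuous; apply/derivable1_diffP.
      exact: (@ex_derive _ _ _ _ _ _ _ (dF z z0)).
    rewrite (@continuous_FTC2 _ _ (fun z => z `^ b / b)%R).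
    - by rewrite -EFinB mulrBl.
    - by rewrite ltr_pdivrMr// ltr_pMr// ltr1n.
    - apply: derivable_within_continuous => z; rewrite in_itv/= => /andP[z1 _].
      apply: derivable_powR; rewrite in_itv/= andbT.
      exact: lt_le_trans z1.
    - split.
      + move=> z; rewrite in_itv/= => /andP[z1 _]; apply: ex_derive.
        by apply: dF; apply: lt_trans z1.
      + by apply: cvg_at_right_filter; exact: cF.
      + by apply: cvg_at_left_filter; exact: cF.
    - move=> z; rewrite in_itv/= => /andP[z1 _]; rewrite derive1E.
      by apply: derive_val; apply: dF; apply: lt_trans z1.
  apply: cvg_EFin; first exact: nearW.
  apply: cvgMr_tmp.
  rewrite -[X in _ --> X]subr0; apply: cvgB; first exact: cvg_cst.
  have /cvg_at_rightP := @powR_cvg0 R b b0; apply; split => [n|].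
    by rewrite divr_gt0.
  rewrite -(mulr0 x); apply: cvgMl_tmp.
  by have := @cvg_harmonic R; rewrite -(cvg_shiftS).
by rewrite -(cvg_lim _ cvg1)// (cvg_lim _ cvg2).
Qed.

End PowerIntegral.

Lemma ge0_integral_lebesgue_opp {R : realType} (f : R -> \bar R) :
  (forall x, 0 <= f x)%E -> measurable_fun setT f ->
  (\int[lebesgue_measure]_x f (- x)%R = \int[lebesgue_measure]_x f x)%E.
Proof.
move=> f0 mf.
have mN : measurable_fun [set: measurableTypeR R]%classic
  (-%R : measurableTypeR R -> measurableTypeR R) by exact: oppr_measurable.
transitivity (\int[measure_function_pushforward__canonical__measure_function_Measure
    lebesgue_measure mN]_x f x)%E.
  by rewrite (ge0_integral_pushforward mN).
by apply: eq_measure_integral => A mA _; exact: lebesgue_measureN.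
Qed.

Section BetaFunction.
Context {R : realType}.
Local Open Scope classical_set_scope.
Local Open Scope ereal_scope.
Local Notation leb := (@lebesgue_measure R).

(** The upper end [r] is kept as a parameter: in the Dirichlet integral it is the mass left by the
    other coordinates. *)
Definition beta_kernel (a b r z : R) : R :=
  if (0 < z)%R && (z < r)%R then (z `^ (a - 1) * (r - z) `^ (b - 1))%R else 0%R.

Lemma beta_kernel_ge0 a b r z : (0 <= beta_kernel a b r z)%R.
Proof. by rewrite /beta_kernel; case: ifP => // _; rewrite mulr_ge0 ?powR_ge0. Qed.

Lemma measurable_itvoo_bool (c : R) :
  measurable_fun [set: R] (fun x : R => (0 < x)%R && (x < c)%R).
Proof.
by apply: measurable_and;
  [exact: (measurable_fun_ltr (f := cst 0%R) (g := id))
  |exact: (measurable_fun_ltr (f := id) (g := cst c))].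
Qed.

Lemma measurable_powR_itv (p c : R) : measurable_fun [set: R]
  (fun x : R => if (0 < x)%R && (x < c)%R then (x `^ p)%R else 0%R).
Proof.
have m1 := measurable_powR p.
by apply: measurable_fun_ifT => //; exact: measurable_itvoo_bool.
Qed.

Lemma measurable_beta_kernel2 a b :
  measurable_fun [set: R * R] (fun p => beta_kernel a b p.1 p.2).
Proof.
rewrite /beta_kernel; apply: measurable_fun_ifT => //.
- apply: measurable_and.
    by apply: measurable_fun_ltr => //; exact: measurable_snd.
  by apply: measurable_fun_ltr; [exact: measurable_snd|exact: measurable_fst].
- apply: measurable_funM.
    exact: (measurableT_comp (measurable_powR (a - 1)) measurable_snd).
  apply: (measurableT_comp (measurable_powR (b - 1))).
  by apply: measurable_funB; [exact: measurable_fst|exact: measurable_snd].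
Qed.

Lemma measurable_beta_kernel a b r : measurable_fun [set: R] (beta_kernel a b r).
Proof.
exact: (measurableT_comp (measurable_beta_kernel2 a b) (pair1_measurable r)).
Qed.

Definition ebeta (a b : R) : \bar R := \int[leb]_z (beta_kernel a b 1 z)%:E.

Lemma integral_powR_if (b x : R) : (0 < b)%R -> (0 < x)%R ->
  \int[leb]_z (if (0 < z)%R && (z < x)%R then z `^ (b - 1) else 0%R)%:E =
  (x `^ b / b)%:E.
Proof.
move=> b0 x0; rewrite -integral_powR//.
rewrite -(@integral_itv_bndo_bndc _ (BRight 0%R)); last first.
  by apply: measurable_funTS; apply/measurable_EFinP; exact: measurable_powR.
rewrite [RHS]integral_mkcond; apply: eq_integral => z _; rewrite patchE.
by rewrite mem_setE in_itv/=; case: ifP.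
Qed.

Lemma integral_beta_kernel (a b r : R) : (0 < r)%R ->
  \int[leb]_z (beta_kernel a b r z)%:E = (r `^ (a + b - 1))%:E * ebeta a b.
Proof.
move=> r0; have rn0 : r != 0%R by rewrite gt_eqF.
have -> : \int[leb]_z (beta_kernel a b r z)%:E =
    r%:E * \int[leb]_z (beta_kernel a b r (r * z + 0)%R)%:E.
  rewrite (@ge0_integral_lebesgue_affine _ r 0 r0 (fun z => (beta_kernel a b r z)%:E)).
  - by rewrite muleA -EFinM mulfV// mul1e.
  - by move=> z; rewrite lee_fin beta_kernel_ge0.
  - by apply/measurable_EFinP; exact: measurable_beta_kernel.
have -> : \int[leb]_z (beta_kernel a b r (r * z + 0)%R)%:E =
    (r `^ (a - 1) * r `^ (b - 1))%:E * ebeta a b.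
  rewrite -ge0_integralZl//.
  - apply: eq_integral => z _; rewrite -EFinM; congr EFin.
    rewrite /beta_kernel addr0 pmulr_rgt0// gtr_pMr//.
    case: ifPn => [/andP[z0 z1]|_]; last by rewrite mulr0.
    have -> : (r - r * z = r * (1 - z))%R by rewrite mulrBr mulr1.
    by rewrite !powRM ?(ltW r0) ?(ltW z0) ?subr_ge0 ?(ltW z1)//; ring.
  - by apply/measurable_EFinP; exact: measurable_beta_kernel.
  - by move=> z _; rewrite lee_fin beta_kernel_ge0.
  - by rewrite lee_fin mulr_ge0 ?powR_ge0.
rewrite muleA -EFinM; congr (_%:E * _).
have -> : (a + b - 1 = 1 + ((a - 1) + (b - 1)))%R by ring.
rewrite (@powRD _ r 1) ?rn0 ?implybT// powRr1 ?(ltW r0)//.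
by rewrite (@powRD _ r (a - 1) (b - 1)) ?rn0 ?implybT.
Qed.

Lemma ebeta_ge0 a b : 0 <= ebeta a b.
Proof. by apply: integral_ge0 => z _; rewrite lee_fin beta_kernel_ge0. Qed.

(** On each half of the unit interval one factor has its base in [[1/2, 1]], where it is bounded by
    [C] whatever the sign of the exponent; the other factor is an integrable power. *)
Lemma ebeta_fin a b : (0 < a)%R -> (0 < b)%R -> ebeta a b < +oo.
Proof.
move=> a0 b0.
have h2 : (0 < (2^-1 : R))%R by rewrite invr_gt0.
have p1 (p : R) : (1 `^ p = 1 :> R)%R by rewrite powR1.
pose C (p : R) := (1 + 2^-1 `^ p : R)%R.
have C0 p : (0 <= C p)%R by rewrite addr_ge0// powR_ge0.
have CP (p w : R) : (2^-1 <= w)%R -> (w <= 1)%R -> (w `^ p <= C p)%R.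
  move=> w1 w2; have w0 := lt_le_trans h2 w1.
  have [p0|p0] := leP 0%R p.
    rewrite (le_trans (y := 1%R))// ?lerDl ?powR_ge0//.
    by rewrite -[leRHS](p1 p) ge0_ler_powR// nnegrE ltW.
  rewrite (le_trans (y := (2^-1 `^ p)%R))// ?lerDr//.
  have [q q0 ->] : exists2 q : R, (0 <= q)%R & p = (- q)%R.
    by exists (- p)%R; rewrite ?opprK ?oppr_ge0 ?ltW.
  rewrite !powRN lef_pV2 ?posrE ?powR_gt0//.
  by rewrite ge0_ler_powR ?nnegrE ?(ltW w0) ?(ltW h2).
pose f (b x : R) := (if (0 < x)%R && (x < 1)%R then x `^ (b - 1) else 0)%R.
have mf b' : measurable_fun [set: R] (f b').
  exact: measurable_powR_itv.
have f0 b' x : (0 <= f b' x)%R by rewrite /f; case: ifP => // _; exact: powR_ge0.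
have If b' : (0 < b')%R -> \int[leb]_x (f b' x)%:E = (1 / b')%:E.
  by move=> b'0; rewrite integral_powR_if// powR1.
have If' b' : (0 < b')%R -> \int[leb]_x (f b' (1 - x)%R)%:E = (1 / b')%:E.
  move=> b'0; rewrite -(If b' b'0).
  have mf1 : measurable_fun [set: R] (fun y : R => (f b' (1 * y + 1)%R)%:E).
    apply/measurable_EFinP; apply: (measurableT_comp (mf b')).
    by apply: measurable_funD => //; exact: measurable_funM.
  have h1 := @ge0_integral_lebesgue_affine _ 1 1 ltr01 (fun x => (f b' x)%:E)
    (fun x => f0 b' x) ((measurable_EFinP _ _).2 (mf b')).
  have h3 := @ge0_integral_lebesgue_opp _ (fun y => (f b' (1 * y + 1)%R)%:E)
    (fun x => f0 b' _) mf1.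
  rewrite -[RHS]mul1e -[X in X%:E * _]invr1.
  apply: etrans (etrans _ h3) h1.
  by apply: eq_integral => x _; rewrite mul1r addrC.
have mf1 b' : measurable_fun [set: R] (fun y : R => f b' (1 - y)%R).
  by apply: (measurableT_comp (mf b')); exact: measurable_funB.
have mC (p q : R) b' : measurable_fun [set: R] (fun y : R => (p * f b' y)%:E).
  by apply/measurable_EFinP; exact: measurable_funM.
have mC1 (p q : R) b' : measurable_fun [set: R] (fun y : R => (p * f b' (1 - y))%:E).
  by apply/measurable_EFinP; exact: measurable_funM.
apply: (@le_lt_trans _ _ (\int[leb]_z ((C (b - 1) * f a z)%:E + (C (a - 1) * f b (1 - z)%R)%:E))).
  apply: ge0_le_integral => //.
  - by move=> z _; rewrite lee_fin beta_kernel_ge0.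
  - by apply/measurable_EFinP; exact: measurable_beta_kernel.
  - by apply: emeasurable_funD; [exact: mC|exact: mC1].
  - move=> z _; rewrite -EFinD lee_fin /beta_kernel.
    case: ifPn => [z01|_]; last by rewrite addr_ge0// mulr_ge0.
    have /andP[z0 z1] := z01.
    rewrite /f z01 subr_gt0 z1/= gtrBl z0/=.
    have [zh|zh] := leP z (2^-1)%R.
      rewrite ler_wpDr ?mulr_ge0 ?powR_ge0// mulrC ler_wpM2r ?powR_ge0//.
      by apply: CP; [lra|rewrite gerBl ltW].
    rewrite ler_wpDl ?mulr_ge0 ?powR_ge0// ler_wpM2r ?powR_ge0//.
    by apply: CP; exact: ltW.
rewrite ge0_integralD//; last 4 first.
- by move=> z _; rewrite lee_fin mulr_ge0.
- exact: mC.
- by move=> z _; rewrite lee_fin mulr_ge0.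
- exact: mC1.
have Z (g : R -> R) (k : R) : measurable_fun [set: R] g -> (forall x, (0 <= g x)%R) ->
    (0 <= k)%R -> \int[leb]_x (k * g x)%:E = k%:E * \int[leb]_x (g x)%:E.
  move=> mg g0 k0; under eq_integral do rewrite EFinM.
  rewrite ge0_integralZl//.
  - exact/measurable_EFinP.
  - by move=> x _; rewrite lee_fin.
rewrite (Z _ _ (mf a) (f0 a) (C0 _)) (Z _ _ (mf1 b) (fun x => f0 b _) (C0 _)).
by rewrite If// If'// -!EFinM -EFinD ltry.
Qed.

(** On [[1/4, 1/2]] both [z] and [1 - z] are at least 1/4, which bounds the kernel below. *)
Lemma ebeta_gt0 a b : 0 < ebeta a b.
Proof.
have h2 : (0 < (4^-1 : R))%R by rewrite invr_gt0.
have p1 (p : R) : (1 `^ p = 1 :> R)%R by rewrite powR1.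
pose C (p : R) := (Num.min 1 (4^-1 `^ p) : R)%R.
have C0 p : (0 < C p)%R by rewrite /C lt_min ltr01 powR_gt0.
have CP (p w : R) : (4^-1 <= w)%R -> (w <= 1)%R -> (C p <= w `^ p)%R.
  move=> w1 w2; have w0 := lt_le_trans h2 w1; rewrite /C ge_min; apply/orP.
  have [p0|p0] := leP 0%R p.
    by right; rewrite ge0_ler_powR// nnegrE ltW.
  have [q q0 ->] : exists2 q : R, (0 <= q)%R & p = (- q)%R.
    by exists (- p)%R; rewrite ?opprK ?oppr_ge0 ?ltW.
  left; rewrite powRN -[leLHS]invr1 lef_pV2 ?posrE ?powR_gt0//.
  by rewrite -[leRHS](p1 q) ge0_ler_powR ?nnegrE ?(ltW w0).
have : 0 < (C (a - 1) * C (b - 1) * (2^-1 - 4^-1))%:E.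
  by rewrite lte_fin !mulr_gt0//; lra.
move=> /lt_le_trans; apply.
have -> : (C (a - 1) * C (b - 1) * (2^-1 - 4^-1))%:E =
    \int[leb]_(z in `[(4^-1)%R, (2^-1)%R]) (C (a - 1) * C (b - 1))%:E.
  rewrite integral_cst//= lebesgue_measure_itv/= lte_fin.
  by rewrite ifT ?EFinM ?EFinB//; lra.
rewrite /ebeta.
apply: (@le_trans _ _ (\int[leb]_(z in `[(4^-1)%R, (2^-1)%R]) (beta_kernel a b 1 z)%:E)).
  apply: ge0_le_integral => //.
  - by move=> z _; rewrite lee_fin mulr_ge0// ltW.
  - by apply/measurable_EFinP/measurable_funTS; exact: measurable_beta_kernel.
  - move=> z; rewrite /= in_itv/= => /andP[z1 z2]; rewrite lee_fin /beta_kernel.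
    have -> : (0 < z)%R by exact: lt_le_trans z1.
    have -> /= : (z < 1)%R by lra.
    by apply: ler_pM; rewrite ?(ltW (C0 _))//; apply: CP; lra.
apply: ge0_subset_integral => //.
- by apply/measurable_EFinP; exact: measurable_beta_kernel.
- by move=> z _; rewrite lee_fin beta_kernel_ge0.
Qed.

(** Integrate z^(a-1) (r-z)^(b-1) over 0 < z < r < 1 in both orders. By scaling, the inner integral
    over [z] is r^(a+b-1) times the beta integral; the inner integral over [r] is z^(a-1) (1-z)^b /
    b. *)
Lemma ebetaSr a b : (0 < a)%R -> (0 < b)%R ->
  ebeta a (b + 1) = (b / (a + b))%:E * ebeta a b.
Proof.
move=> a0 b0.
have ab0 : (0 < a + b)%R by rewrite addr_gt0.
have h2 : ebeta a (b + 1) = b%:E * (b^-1%:E * ebeta a (b + 1)).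
  by rewrite muleA -EFinM mulfV ?mul1e// gt_eqF.
have h3 : b%:E * ((a + b)^-1%:E * ebeta a b) = (b / (a + b))%:E * ebeta a b.
  by rewrite muleA -EFinM.
pose F (p : R * R) : R := (if (p.1 < 1)%R then beta_kernel a b p.1 p.2 else 0)%R.
have F0 p : 0 <= (F p)%:E.
  by rewrite lee_fin /F; case: ifP => // _; exact: beta_kernel_ge0.
have mF : measurable_fun setT (fun p => (F p)%:E).
  apply/measurable_EFinP; apply: measurable_fun_ifT => //.
    by apply: measurable_fun_ltr => //; exact: measurable_fst.
  exact: measurable_beta_kernel2.
have E1 : \int[leb]_r \int[leb]_z (F (r, z))%:E = (a + b)^-1%:E * ebeta a b.
  transitivity (\int[leb]_r ((if (0 < r)%R && (r < 1)%R then r `^ (a + b - 1) else 0%R)%:E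
      * ebeta a b)).
    apply: eq_integral => r _; rewrite /F/=.
    have [r1|r1] := ltP r 1%R; last by rewrite andbF mul0e integral0.
    rewrite andbT; have [r0|r0] := ltP 0%R r; first by rewrite integral_beta_kernel.
    rewrite mul0e; apply: integral0_eq => z _; rewrite /beta_kernel.
    by case: ifP => // /andP[z0 zr]; have := lt_trans z0 zr; rewrite ltNge r0.
  rewrite ge0_integralZr//; last 3 first.
  - apply/measurable_EFinP; exact: measurable_powR_itv.
  - by move=> r _; rewrite lee_fin; case: ifP => // _; exact: powR_ge0.
  - exact: ebeta_ge0.
  by rewrite integral_powR_if// powR1 div1r.
have E2 : \int[leb]_z \int[leb]_r (F (r, z))%:E = b^-1%:E * ebeta a (b + 1).
  rewrite -ge0_integralZl//; last 3 first.
  - by apply/measurable_EFinP; exact: measurable_beta_kernel.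
  - by move=> z _; rewrite lee_fin beta_kernel_ge0.
  - by rewrite lee_fin invr_ge0 ltW.
  apply: eq_integral => z _.
  pose g (w : R) := (if (0 < w)%R && (w < 1 - z)%R then w `^ (b - 1) else 0)%R.
  have [/andP[z0 z1]|z01] := boolP ((0 < z)%R && (z < 1)%R); last first.
    rewrite /beta_kernel (negbTE z01) mule0 integral0_eq// => r _.
    rewrite /F/beta_kernel/=; case: ifP => // r1; case: ifP => // /andP[z0 zr].
    by move: z01; rewrite z0 (lt_trans zr r1).
  have -> : \int[leb]_r (F (r, z))%:E = (z `^ (a - 1))%:E * \int[leb]_w (g w)%:E.
    have -> : \int[leb]_w (g w)%:E = \int[leb]_w (g (1 * w + (- z))%R)%:E.
      rewrite (@ge0_integral_lebesgue_affine _ 1 (- z) ltr01 (fun w => (g w)%:E)).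
      - by rewrite invr1 mul1e.
      - by move=> w; rewrite lee_fin /g; case: ifP => // _; exact: powR_ge0.
      - apply/measurable_EFinP; exact: measurable_powR_itv.
    rewrite -ge0_integralZl//.
    - apply: eq_integral => r _; rewrite -EFinM; congr EFin.
      rewrite /F/g/beta_kernel/= mul1r subr_gt0 ltrD2r z0/=.
      by have [r1|r1] := ltP r 1%R; case: ltP => //=; rewrite mulr0.
    - apply/measurable_EFinP.
      have mg : measurable_fun [set: R] g.
        exact: measurable_powR_itv.
      apply: (measurableT_comp mg).
      by apply: measurable_funD; [exact: measurable_funM|exact: measurable_cst].
    - by move=> w _; rewrite lee_fin /g; case: ifP => // _; exact: powR_ge0.
    - by rewrite lee_fin powR_ge0.
  rewrite integral_powR_if ?subr_gt0// -!EFinM; congr EFin.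
  rewrite /beta_kernel z0 z1 addrK/=; ring.
have E0 := @fubini_tonelli _ _ _ _ R leb leb (fun p => (F p)%:E) mF F0.
have h := etrans (esym E1) (etrans E0 E2).
exact: etrans h2 (etrans (congr1 (fun x => b%:E * x) (esym h)) h3).
Qed.

(** From z + (1 - z) = 1, the values at [(a + 1, b)] and [(a, b + 1)] add up to the value at
    [(a, b)]; [ebetaSr] gives the second one. *)
Lemma ebetaSl a b : (0 < a)%R -> (0 < b)%R ->
  ebeta (a + 1) b = (a / (a + b))%:E * ebeta a b.
Proof.
move=> a0 b0.
have ab0 : (0 < a + b)%R by rewrite addr_gt0.
have fb : ebeta a b \is a fin_num.
  by rewrite ge0_fin_numE ?ebeta_ge0// ebeta_fin.
have h : ebeta (a + 1) b + ebeta a (b + 1) = ebeta a b.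
  rewrite -ge0_integralD//.
  - apply: eq_integral => z _; rewrite -EFinD; congr EFin.
    rewrite /beta_kernel; case: ifP => [/andP[z0 z1]|_]; last by rewrite addr0.
    rewrite !addrK -[in RHS](mul1r (_ * _)%R).
    have w0 : (0 < 1 - z)%R by rewrite subr_gt0.
    by rewrite -(mulr_powRB1 (ltW z0) a0) -(mulr_powRB1 (ltW w0) b0); ring.
  - by move=> z _; rewrite lee_fin beta_kernel_ge0.
  - by apply/measurable_EFinP; exact: measurable_beta_kernel.
  - by move=> z _; rewrite lee_fin beta_kernel_ge0.
  - by apply/measurable_EFinP; exact: measurable_beta_kernel.
move: h; rewrite ebetaSr// -(fineK fb) -EFinM.
set X := ebeta (a + 1) b => h.
have Xf : X \is a fin_num by rewrite ge0_fin_numE ?ebeta_ge0// ebeta_fin// addr_gt0.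
move: h; rewrite -(fineK Xf) -EFinD => -[h].
congr EFin; apply: (addIr (b / (a + b) * fine (ebeta a b))%R).
rewrite h; field; rewrite gt_eqF//.
Qed.

End BetaFunction.

Section MeasurableBigop.
Context {d : measure_display} {T : measurableType d} {R : realType} {I : Type}.
Local Open Scope classical_set_scope.

Lemma measurable_sum_cond (s : seq I) (P : pred I) (h : I -> T -> R) :
  (forall i, measurable_fun [set: T] (h i)) ->
  measurable_fun [set: T] (fun x => \sum_(i <- s | P i) h i x).
Proof.
move=> mh; under eq_fun do rewrite -big_filter.
exact: measurable_sum.
Qed.

Lemma measurable_big_andb (s : seq I) (h : I -> T -> bool) :
  (forall i, measurable_fun [set: T] (h i)) ->
  measurable_fun [set: T] (fun x => \big[andb/true]_(i <- s) h i x).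
Proof.
move=> mh; elim: s => [|i s IH].
  by under eq_fun do rewrite big_nil; exact: measurable_cst.
by under eq_fun do rewrite big_cons; exact: measurable_and.
Qed.

End MeasurableBigop.

(** * The Dirichlet distribution *)

Section DirichletDensity.
Context {R : realType} {O : finType} (o1 : O).
Local Open Scope classical_set_scope.
Local Open Scope ereal_scope.
Local Notation Q := (funSpace O (measurableTypeR R)).
Implicit Types (alpha : O -> R) (y : Q) (s : seq O).

Definition simplex (q : O -> R) : bool :=
  [forall o, (0 < q o)%R] && (\sum_o q o == 1)%R.

Definition simplex_pt (y : O -> R) : O -> R :=
  fun o => (if o == o1 then 1 - \sum_(o' | o' != o1) y o' else y o)%R.

Definition dir_density alpha (y : O -> R) : R :=
  (if [forall o, 0 < simplex_pt y o]
   then \prod_o (simplex_pt y o) `^ (alpha o - 1) else 0)%R.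

Lemma sum_simplex_pt (y : O -> R) : (\sum_o simplex_pt y o = 1)%R.
Proof.
rewrite (bigD1 o1)//= {1}/simplex_pt eqxx.
rewrite [X in (_ + X)%R](eq_bigr y) ?subrK// => o oo1.
by rewrite /simplex_pt (negbTE oo1).
Qed.

Lemma dir_density_ge0 alpha y : (0 <= dir_density alpha y)%R.
Proof.
by rewrite /dir_density; case: ifP => // _; apply: prodr_ge0 => o _; exact: powR_ge0.
Qed.

Lemma measurable_simplex_pt : measurable_fun [set: Q] (simplex_pt : Q -> Q).
Proof.
apply: measurable_into_funSpace => o; rewrite /simplex_pt; case: (o == o1).
  apply: measurable_funB => //.
  by apply: measurable_sum_cond => o'; exact: measurable_coord.
exact: measurable_coord.
Qed.

Lemma measurable_forall_pos (P : O -> Q -> R) :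
  (forall o, measurable_fun [set: Q] (P o)) ->
  measurable_fun [set: Q] (fun y => [forall o, (0 < P o y)%R]).
Proof.
move=> mP.
have -> : (fun y => [forall o, (0 < P o y)%R]) =
    (fun y => \big[andb/true]_(o <- enum O) (0 < P o y)%R).
  apply/funext => y; rewrite big_all; apply/forallP/allP => /= h o //.
  by apply: h; rewrite mem_enum.
apply: measurable_big_andb => o.
exact: (measurable_fun_ltr (f := cst 0%R)).
Qed.

Lemma measurable_dir_density alpha : measurable_fun [set: Q] (dir_density alpha).
Proof.
have mp o : measurable_fun [set: Q] (fun y : Q => simplex_pt y o).
  exact: (measurableT_comp (measurable_coord o) measurable_simplex_pt).
rewrite /dir_density; apply: measurable_fun_ifT.
- exact: measurable_forall_pos.
- apply: measurable_prod => o _.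
  exact: (measurableT_comp (measurable_powR (alpha o - 1)) (mp o)).
- exact: measurable_cst.
Qed.

(** Normalising constant in stick-breaking form: when coordinate [i] is integrated, the mass it
    shares is split with a residual coordinate carrying the parameters of [o1] and of the
    coordinates integrated before it. *)
Fixpoint dir_const alpha s : \bar R :=
  if s is i :: s' then
    ebeta (alpha i) (alpha o1 + \sum_(j <- s') alpha j)%R * dir_const alpha s'
  else 1.

(** Marginal density, up to [dir_const], once the coordinates in [s] are integrated out: they are
    merged with [o1] into one residual coordinate of mass [r], whose parameter is the sum of
    theirs. *)
Definition dir_partial alpha s (y : O -> R) : R :=
  let r := (1 - \sum_(o | (o \notin s) && (o != o1)) y o)%R in
  (if [forall (o | (o \notin s) && (o != o1)), 0 < y o] && (0 < r) then
    \prod_(o | (o \notin s) && (o != o1)) y o `^ (alpha o - 1) *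
    r `^ (alpha o1 + \sum_(j <- s) alpha j - 1) else 0)%R.

Lemma sum_alpha_gt0 alpha s : (forall o, (0 < alpha o)%R) ->
  (0 < alpha o1 + \sum_(j <- s) alpha j)%R.
Proof. by move=> a0; rewrite ltr_pwDl// sumr_ge0// => j _; rewrite ltW. Qed.

Lemma dir_const_ge0 alpha s : 0 <= dir_const alpha s.
Proof. by elim: s => //= i s IH; rewrite mule_ge0// ebeta_ge0. Qed.

Lemma dir_const_gt0 alpha s : 0 < dir_const alpha s.
Proof. by elim: s => //= i s IH; rewrite mule_gt0// ebeta_gt0. Qed.

Lemma dir_const_fin alpha s : (forall o, (0 < alpha o)%R) -> dir_const alpha s \is a fin_num.
Proof.
move=> a0; elim: s => //= i s IH; rewrite fin_numM//.
by rewrite ge0_fin_numE ?ebeta_ge0// ebeta_fin// sum_alpha_gt0.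
Qed.

Lemma dir_partial_nil alpha y : dir_density alpha y = dir_partial alpha [::] y.
Proof.
rewrite /dir_density /dir_partial big_nil addr0.
have -> : [forall o, (0 < simplex_pt y o)%R] =
   [forall (o | (o \notin [::]) && (o != o1)), (0 < y o)%R] &&
   (0 < 1 - \sum_(o | (o \notin [::]) && (o != o1)) y o)%R.
  apply/forallP/andP => [h|[/forallP h h1] o].
    split.
      apply/forallP => o; apply/implyP => /= oo1.
      by have := h o; rewrite /simplex_pt (negbTE oo1).
    by have := h o1; rewrite /simplex_pt eqxx.
  rewrite /simplex_pt; case: eqVneq => // oo1.
  by have /implyP := h o; rewrite oo1; exact.
case: ifP => // _; rewrite (bigD1 o1)//= mulrC {2}/simplex_pt eqxx; congr *%R.
by apply: eq_bigr => o oo1; rewrite /simplex_pt (negbTE oo1).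
Qed.

Lemma dir_partial_cons alpha s i y z : (forall o, (0 < alpha o)%R) ->
  i \notin s -> i != o1 ->
  dir_partial alpha s (upd y i z) =
  ((if [forall (o | (o \notin i :: s) && (o != o1)), 0 < y o] then
    \prod_(o | (o \notin i :: s) && (o != o1)) y o `^ (alpha o - 1) else 0) *
   beta_kernel (alpha i) (alpha o1 + \sum_(j <- s) alpha j)
     (1 - \sum_(o | (o \notin i :: s) && (o != o1)) y o) z)%R.
Proof.
move=> a0 si io1; rewrite /dir_partial.
have P o : ((o \notin s) && (o != o1)) && (o != i) = (o \notin i :: s) && (o != o1).
  by rewrite inE negb_or andbC andbA.
rewrite (bigD1 i) ?si//= upd_same (eq_bigl _ _ P).
rewrite (eq_bigr y); last first.
  by move=> o; rewrite inE negb_or /upd => /andP[/andP[/negbTE -> _] _].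
rewrite opprD addrCA addrC; set r := (1 - _)%R.
have -> : [forall (o | (o \notin s) && (o != o1)), (0 < upd y i z o)%R] =
    (0 < z)%R && [forall (o | (o \notin i :: s) && (o != o1)), (0 < y o)%R].
  apply/forallP/andP => [h|[z0 /forallP h] o].
    split; first by have /implyP := h i; rewrite si upd_same; apply.
    apply/forallP => o; apply/implyP; rewrite inE negb_or -andbA => /and3P[oi os oo1].
    by have /implyP := h o; rewrite os oo1 /upd (negbTE oi); apply.
  apply/implyP => /andP[os oo1]; rewrite /upd; case: eqVneq => [//|oi].
  by have /implyP := h o; rewrite inE negb_or oi os oo1; apply.
have -> : (\prod_(o | (o \notin s) && (o != o1)) upd y i z o `^ (alpha o - 1) =
    z `^ (alpha i - 1) *
    \prod_(o | (o \notin i :: s) && (o != o1)) y o `^ (alpha o - 1))%R.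
  rewrite (bigD1 i) ?si//= upd_same (eq_bigl _ _ P); congr *%R.
  apply: eq_bigr => o.
  by rewrite inE negb_or /upd => /andP[/andP[/negbTE -> _] _].
rewrite /beta_kernel subr_gt0.
case: (0 < z)%R => /=; last by rewrite mulr0.
case: [forall (o | (o \notin i :: s) && (o != o1)), (0 < y o)%R] => /=; last by rewrite mul0r.
have [zr|zr] := ltP z r; last by rewrite mulr0.
by set p := (\prod_(_ | _) _)%R; ring.
Qed.

Lemma leb_iter_dir_density alpha s y : (forall o, (0 < alpha o)%R) ->
  uniq s -> o1 \notin s ->
  leb_iter s (fun y => (dir_density alpha y)%:E) y =
  (dir_partial alpha s y)%:E * dir_const alpha s.
Proof.
move=> a0; elim: s y => [|i s IH] y /=; first by rewrite mule1 dir_partial_nil.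
move=> /andP[si us]; rewrite inE negb_or eq_sym => /andP[io1 o1s].
under eq_integral do rewrite IH// dir_partial_cons//.
set c := (if _ then _ else _); set b := (alpha o1 + _)%R; set r := (1 - _)%R.
have c0 : (0 <= c)%R.
  by rewrite /c; case: ifP => // _; apply: prodr_ge0 => o _; exact: powR_ge0.
rewrite ge0_integralZr//; last 3 first.
- by apply/measurable_EFinP; apply: measurable_funM => //; exact: measurable_beta_kernel.
- by move=> z _; rewrite lee_fin mulr_ge0// beta_kernel_ge0.
- exact: dir_const_ge0.
rewrite muleA; congr (_ * _).
under eq_integral do rewrite EFinM.
have := @ge0_integralZl_EFin _ _ _ lebesgue_measure setT measurableT
  (fun z => (beta_kernel (alpha i) b r z)%:E).
move=> -> ; last exact: c0.
- rewrite /dir_partial -/r big_cons addrCA -/b.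
  have [r0|r0] := ltP 0%R r; last first.
    rewrite andbF mul0e (_ : integral _ _ _ = 0) ?mule0//.
    apply: integral0_eq => z _; rewrite /beta_kernel.
    by case: ifP => // /andP[z0 zr]; have := lt_trans z0 zr; rewrite ltNge r0.
  rewrite integral_beta_kernel// muleA -EFinM andbT /c; congr (_%:E * _).
  by case: ifP => // _; rewrite mul0r.
- by move=> z _; rewrite lee_fin beta_kernel_ge0.
- by apply/measurable_EFinP; exact: measurable_beta_kernel.
Qed.

(** At the position of [o] the first argument of the beta integral grows by 1, at the positions
    integrated after it the second one does. The successive denominators cancel and leave the total
    parameter. *)
Lemma dir_const_incr alpha s o : (forall o, (0 < alpha o)%R) -> uniq s -> o1 \notin s ->
  o \in o1 :: s ->
  dir_const (fun o' => alpha o' + (o' == o)%:R)%R s =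
  (alpha o / (alpha o1 + \sum_(j <- s) alpha j))%:E * dir_const alpha s.
Proof.
move=> a0; elim: s => [|i s IH] /=.
  move=> _ _; rewrite inE => /eqP ->.
  by rewrite big_nil addr0 mulfV ?mule1// gt_eqF.
move=> /andP[si us]; rewrite inE negb_or eq_sym => /andP[io1 o1s] os.
have b0 := sum_alpha_gt0 alpha s a0.
have ne : (alpha i + (alpha o1 + \sum_(j <- s) alpha j) != 0)%R.
  by rewrite gt_eqF// addr_gt0.
have ne' : (alpha o1 + \sum_(j <- s) alpha j != 0)%R by rewrite gt_eqF.
rewrite big_cons addrCA.
have [io|io] := eqVneq i o.
  rewrite -io.
  have o1i : (o1 == i) = false by rewrite eq_sym (negbTE io1).
  rewrite o1i addr0.
  have -> : (\sum_(j <- s) (alpha j + (j == i)%:R) = \sum_(j <- s) alpha j)%R.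
    by apply: eq_big_seq => j js; case: eqP => [ji|_]; rewrite ?addr0//; move: si; rewrite -ji js.
  have -> : dir_const (fun o' => alpha o' + (o' == i)%:R)%R s = dir_const alpha s.
    elim: s si {IH us o1s os b0 ne ne'} => [_|j s IH]; first by [].
    rewrite inE negb_or => /andP[ij si].
    rewrite /= IH; last exact: si.
    rewrite o1i addr0 (eq_sym j) (negbTE ij) addr0; congr (ebeta _ (_ + _) * _).
    by apply: eq_big_seq => k ks; case: eqP => [ki|_]; rewrite ?addr0//; move: si; rewrite -ki ks.
  by rewrite (ebetaSl _ _ (a0 i) b0) muleA.
have os' : o \in o1 :: s by move: os; rewrite !inE (eq_sym o i) (negbTE io).
have -> : ((alpha o1 + (o1 == o)%:R) + \sum_(j <- s) (alpha j + (j == o)%:R) =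
    (alpha o1 + \sum_(j <- s) alpha j) + 1)%R.
  rewrite big_split/= addrACA; congr (_ + _)%R.
  move: os'; rewrite inE => /predU1P[->|os'].
    rewrite eqxx big1_seq ?addr0// => j /= js.
    by case: eqP => // jo1; move: o1s; rewrite -jo1 js.
  have -> : (o1 == o) = false by apply/negP => /eqP e; move: o1s; rewrite e os'.
  rewrite add0r (bigD1_seq o)//= eqxx big1 ?addr0// => j /negbTE -> //.
rewrite addr0 (ebetaSr _ _ (a0 i) b0) (IH us o1s os') !muleA; congr (_ * _).
rewrite muleAC -EFinM; congr (_%:E * _).
by field; rewrite ne' ne.
Qed.

End DirichletDensity.

Section DirichletMeasure.
Context {R : realType} {O : finType} (x0 : O).
Local Open Scope classical_set_scope.
Local Open Scope ereal_scope.
Local Notation Q := (funSpace O (measurableTypeR R)).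
Implicit Types (alpha : O -> R).

Lemma ohead_enum : exists o1 : O, ohead (enum O) = Some o1.
Proof.
case E : (enum O) => [|o1 s]; last by exists o1.
by have := mem_enum O x0; rewrite E.
Qed.

Definition dir_coords (o1 : O) := [seq o <- enum O | o != o1].

Lemma uniq_dir_coords o1 : uniq (dir_coords o1).
Proof. by rewrite filter_uniq// enum_uniq. Qed.

Lemma dir_coordsN o1 : o1 \notin dir_coords o1.
Proof. by rewrite mem_filter eqxx. Qed.

Lemma mem_dir_coords o1 o : o \in o1 :: dir_coords o1.
Proof. by rewrite inE mem_filter mem_enum andbT orbN. Qed.

Lemma sum_dir_coords o1 (f : O -> R) :
  (f o1 + \sum_(o <- dir_coords o1) f o = \sum_o f o)%R.
Proof. by rewrite /dir_coords big_filter big_enum_cond/= [RHS](bigD1 o1). Qed.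

Lemma dir_intE o1 alpha (g : (O -> R) -> \bar R) : ohead (enum O) = Some o1 ->
  dir_int alpha g =
  ((fine (leb_iter (dir_coords o1) (fun y => (dir_density o1 alpha y)%:E) (fun=> 0%R)))^-1)%:E *
  leb_iter (dir_coords o1)
    (fun y => (dir_density o1 alpha y)%:E * g (simplex_pt o1 y)) (fun=> 0%R).
Proof. by move=> o1E; rewrite /dir_int o1E. Qed.

Lemma dir_total o1 alpha : (forall o, (0 < alpha o)%R) ->
  leb_iter (dir_coords o1) (fun y => (dir_density o1 alpha y)%:E) (fun=> 0%R) =
  dir_const o1 alpha (dir_coords o1).
Proof.
move=> a0; rewrite leb_iter_dir_density ?uniq_dir_coords ?dir_coordsN//.
have P o : (o \notin dir_coords o1) && (o != o1) = false.
  by have := mem_dir_coords o1 o; rewrite inE; case: eqP => [_ _|_ /= ->]; rewrite ?andbF.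
rewrite /dir_partial.
have -> : [forall (o | (o \notin dir_coords o1) && (o != o1)), (0 < 0 :> R)%R].
  by apply/forallP => o; rewrite P.
rewrite !(eq_bigl _ _ P) !big_pred0_eq subr0 ltr01 mul1r.
by rewrite powR1 mul1e.
Qed.

Lemma simplex_simplex_pt o1 (y : O -> R) :
  [forall o, (0 < simplex_pt o1 y o)%R] = simplex (simplex_pt o1 y).
Proof. by rewrite /simplex sum_simplex_pt eqxx andbT. Qed.

Lemma eq_dir_int alpha (g g' : (O -> R) -> \bar R) :
  (forall q, simplex q -> g q = g' q) -> dir_int alpha g = dir_int alpha g'.
Proof.
move=> gg'; case: ohead_enum => o1 o1E; rewrite !(dir_intE o1)//.
congr (_ * leb_iter _ _ _); apply/funext => y.
rewrite /dir_density simplex_simplex_pt.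
by case: ifPn => [/gg' ->//|_]; rewrite !mul0e.
Qed.

(** Relative to the Gaussian product [G] on the free coordinates, the Dirichlet density becomes a
    probability density [h]; the image of that law under [simplex_pt] is the Dirichlet law. *)
Lemma dirichlet_measure alpha : (forall o, (0 < alpha o)%R) ->
  exists D : probability Q R, forall g : Q -> \bar R,
    (forall q, 0 <= g q) -> measurable_fun [set: Q] g ->
    dir_int alpha g = \int[D]_q g q.
Proof.
move=> a0; case: ohead_enum => o1 o1E.
set S := dir_coords o1.
have [G GE] := iter_int_measure (@gauss_measures R O) S (fun=> 0%R) (uniq_dir_coords o1).
have Zf := dir_const_fin o1 alpha S a0.
have Z0 : (0 < fine (dir_const o1 alpha S))%R.
  by rewrite fine_gt0// dir_const_gt0/= ltey_eq Zf.
pose h (y : Q) : R := ((fine (dir_const o1 alpha S))^-1 *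
  (\prod_(i <- S) (normal_pdf 0 1 (y i))^-1 * dir_density o1 alpha y))%R.
have h0 y : (0 <= h y)%R.
  by rewrite /h mulr_ge0 ?invr_ge0 ?(ltW Z0)// mulr_ge0 ?inv_pdfs_ge0 ?dir_density_ge0.
have mh : measurable_fun [set: Q] h.
  apply: measurable_funM => //; apply: measurable_funM.
    exact: measurable_inv_pdfs.
  exact: measurable_dir_density.
have mphi : measurable_fun [set: Q] (simplex_pt o1 : Q -> Q) by exact: measurable_simplex_pt.
have key (g : Q -> \bar R) : (forall q, 0 <= g q) -> measurable_fun [set: Q] g ->
    dir_int alpha g = \int[G]_y ((h y)%:E * g (simplex_pt o1 y)).
  move=> g0 mg; rewrite (dir_intE o1)// dir_total// -/S.
  have mF : measurable_fun [set: Q]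
      (fun y => (dir_density o1 alpha y)%:E * g (simplex_pt o1 y)).
    apply: emeasurable_funM.
      by apply/measurable_EFinP; exact: measurable_dir_density.
    exact: (measurableT_comp mg mphi).
  have F0 (y : Q) : 0 <= (dir_density o1 alpha y)%:E * g (simplex_pt o1 y).
    by rewrite mule_ge0// lee_fin dir_density_ge0.
  have mF' : measurable_fun [set: Q] (fun y : Q =>
      (\prod_(i <- S) (normal_pdf 0 1 (y i))^-1)%:E *
      ((dir_density o1 alpha y)%:E * g (simplex_pt o1 y))).
    by apply: emeasurable_funM => //; apply/measurable_EFinP; exact: measurable_inv_pdfs.
  have F0' (y : Q) : 0 <= (\prod_(i <- S) (normal_pdf 0 1 (y i))^-1)%:E *
      ((dir_density o1 alpha y)%:E * g (simplex_pt o1 y)).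
    by rewrite mule_ge0// lee_fin inv_pdfs_ge0.
  rewrite leb_iterE ?uniq_dir_coords//.
  rewrite -(GE _ F0' mF').
  have Zi : (0 <= (fine (dir_const o1 alpha S))^-1)%R by rewrite invr_ge0 ltW.
  rewrite -(ge0_integralZl_EFin _ measurableT (fun y _ => F0' y) mF' Zi).
  by apply: eq_integral => y _; rewrite /h !EFinM !muleA.
have h1 : \int[G]_y (h y)%:E = 1.
  have := key (cst 1) (fun=> lee01) (measurable_cst _).
  under [X in _ = X]eq_integral do rewrite mule1.
  move=> <-; rewrite (dir_intE o1)//.
  have -> : (fun y => (dir_density o1 alpha y)%:E * cst 1 (simplex_pt o1 y)) =
      (fun y => (dir_density o1 alpha y)%:E).
    by apply/funext => y; rewrite mule1.
  by rewrite dir_total// -[X in _ * X](fineK Zf) -EFinM mulVf// gt_eqF.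
have [D' D'E] := density_probability G h mh h0 h1.
have [D DE] := probability_image D' (simplex_pt o1 : Q -> Q) mphi.
exists D => g g0 mg; rewrite DE// D'E ?key//.
exact: (measurableT_comp mg mphi).
Qed.

Lemma dir_density_incr o1 alpha o (y : O -> R) :
  (dir_density o1 (fun o' => alpha o' + (o' == o)%:R) y =
   simplex_pt o1 y o * dir_density o1 alpha y)%R.
Proof.
rewrite /dir_density; case: ifPn => [/forallP p0|_]; last by rewrite mulr0.
rewrite (bigD1 o)//= [in RHS](bigD1 o)//= eqxx mulrA; congr *%R.
  have p1 : simplex_pt o1 y o != 0%R by rewrite gt_eqF.
  have -> : (alpha o + true%:R - 1 = 1 + (alpha o - 1))%R by rewrite addrAC addrC.
  set c := (alpha o - 1)%R.
  by rewrite powRD ?p1 ?implybT// powRr1// ltW.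
by apply: eq_bigr => i /negbTE ->; rewrite addr0.
Qed.

(** Multiplication by [q o] raises one exponent of the density, and [dir_const_incr] compares the
    two normalising constants: this is conjugacy with a single observation. *)
Lemma dir_int_incr alpha o (g : Q -> \bar R) : (forall o, (0 < alpha o)%R) ->
  dir_int alpha (fun q => (q o)%:E * g q) =
  (alpha o / \sum_o' alpha o')%:E *
  dir_int (fun o' => alpha o' + (o' == o)%:R)%R g.
Proof.
move=> a0; case: ohead_enum => o1 o1E; rewrite !(dir_intE o1)//.
have a0' o' : (0 < alpha o' + (o' == o)%:R)%R by rewrite ltr_pwDl.
rewrite !dir_total//.
rewrite dir_const_incr ?uniq_dir_coords ?dir_coordsN ?mem_dir_coords// sum_dir_coords.
have Zf := dir_const_fin o1 alpha (dir_coords o1) a0.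
have Z0 : (0 < fine (dir_const o1 alpha (dir_coords o1)))%R.
  by rewrite fine_gt0// dir_const_gt0/= ltey_eq Zf.
have A0 : (0 < \sum_o' alpha o')%R.
  by rewrite -(sum_dir_coords o1) sum_alpha_gt0.
rewrite muleA; congr (_ * _).
  rewrite fineM//= -EFinM; congr EFin; field.
  by rewrite !gt_eqF.
congr (leb_iter _ _ _); apply/funext => y; rewrite muleA -EFinM dir_density_incr.
by rewrite mulrC.
Qed.

End DirichletMeasure.

Lemma integrable_le {d} {T : measurableType d} {R : realType}
    (mu : {measure set T -> \bar R}) (f g : T -> R) :
  measurable_fun [set: T]%classic f -> (forall x, `|f x| <= g x) ->
  mu.-integrable [set: T]%classic (EFin \o g) -> mu.-integrable [set: T]%classic (EFin \o f).
Proof.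
move=> mf fg; apply: le_integrable => //; first exact/measurable_EFinP.
move=> x _ /=; rewrite lee_fin (le_trans (fg x))//; exact: ler_norm.
Qed.

(** * Convex comparison with the normal law *)

Section RealIntegrable.
Context {d : measure_display} {T : measurableType d} {R : realType}.
Local Open Scope classical_set_scope.
Variable mu : {measure set T -> \bar R}.
Implicit Types f g : T -> R.

Lemma integrable_addR f g : mu.-integrable [set: T] (EFin \o f) ->
  mu.-integrable [set: T] (EFin \o g) ->
  mu.-integrable [set: T] (EFin \o (fun x => f x + g x)).
Proof. by move=> fi gi; have := integrableD measurableT fi gi. Qed.

Lemma integrable_subR f g : mu.-integrable [set: T] (EFin \o f) ->
  mu.-integrable [set: T] (EFin \o g) ->
  mu.-integrable [set: T] (EFin \o (fun x => f x - g x)).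
Proof. by move=> fi gi; have := integrableB measurableT fi gi. Qed.

Lemma integrable_scaleR (c : R) f : mu.-integrable [set: T] (EFin \o f) ->
  mu.-integrable [set: T] (EFin \o (fun x => c * f x)).
Proof. by move=> fi; have := integrableZl measurableT c fi. Qed.

Lemma integrable_sumR {I : Type} (s : seq I) (P : pred I) (f : I -> T -> R) :
  (forall i, mu.-integrable [set: T] (EFin \o f i)) ->
  mu.-integrable [set: T] (EFin \o (fun x => \sum_(i <- s | P i) f i x)).
Proof.
move=> fi; have := @integrable_sum _ _ _ mu _ measurableT I s P (fun i => EFin \o f i).
move=> /(_ (fun i _ => fi i)); congr (integrable _ _ _).
by apply/funext => x /=; rewrite sumEFin.
Qed.

Lemma Rintegral_sum {I : Type} (s : seq I) (P : pred I) (f : I -> T -> R) :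
  (forall i, mu.-integrable [set: T] (EFin \o f i)) ->
  (\int[mu]_x (\sum_(i <- s | P i) f i x) = \sum_(i <- s | P i) \int[mu]_x f i x)%R.
Proof.
move=> fi; elim: s => [|i s IH].
  by rewrite big_nil; under eq_Rintegral do rewrite big_nil; rewrite /Rintegral integral0.
rewrite big_cons; under eq_Rintegral do rewrite big_cons.
case: (P i) => //; rewrite RintegralD// ?IH//; exact: integrable_sumR.
Qed.

End RealIntegrable.

Section GaussianMoments.
Context {R : realType}.
Local Open Scope classical_set_scope.
Local Notation leb := (@lebesgue_measure R).
Local Notation N01 := (@normal_prob R 0 1).
Implicit Types (x u t : R).

Lemma integral_id_expRN :
  (\int[leb]_(x in `[0%R, +oo[) (x * expR (- x))%:E = 1)%E.
Proof.
pose F (x : R) : R := - ((x + 1) * expR (- x)).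
have dF (x : R) : is_derive x (1 : R) F (x * expR (- x)).
  have d1 : is_derive x (1 : R) (fun x : R => expR (- x)) (- expR (- x)).
    have -> : (fun x : R => expR (- x)) = expR \o (-%R : R -> R) by [].
    by apply: is_derive_eq; rewrite mulrN1.
  have -> : F = - ((id + cst 1) * (fun x : R => expR (- x))) by [].
  apply: is_derive_eq; rewrite /= !fctE/= /GRing.scale/=; ring.
have cF (x : R) : {for x, continuous F}.
  apply: differentiable_continuous; apply/derivable1_diffP.
  exact: (@ex_derive _ _ _ _ _ _ _ (dF x)).
rewrite (@ge0_continuous_FTC2y _ _ F _ 0).
- by rewrite /F oppr0 expR0 mulr1 add0r -EFinN opprK add0r.
- by move=> x x0; rewrite mulr_ge0// expR_ge0.
- apply: continuous_subspaceT => x; apply: cvgM; first exact: cvg_id.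
  apply: (@continuous_comp _ _ _ (-%R : R -> R) expR); last exact: continuous_expR.
  exact: opp_continuous.
- rewrite -oppr0; apply: cvgN.
  (* [x + 1] is at most [2 * expR (x / 2)], which leaves half of the exponential decay. *)
  apply: (@squeeze_cvgr _ _ _ _ (cst 0) (fun x : R => 2 * expR (- (2^-1 * x)))).
  + near=> x.
    have x0 : 0 <= x by near: x; exact: nbhs_pinfty_ge.
    rewrite mulr_ge0 ?expR_ge0 ?addr_ge0//=.
    have -> : expR (- x) = expR (- (2^-1 * x)) * expR (- (2^-1 * x)).
      by rewrite -expRD; congr expR; lra.
    rewrite mulrA ler_wpM2r ?expR_ge0// expRN ler_pdivrMr ?expR_gt0//.
    by have := expR_ge1Dx (2^-1 * x); lra.
  + exact: cvg_cst.
  + rewrite -[X in _ --> X](mulr0 2); apply: cvgMl_tmp.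
    rewrite (_ : (fun x => expR (- (2^-1 * x))) =
               (fun z => expR (- z)) \o (fun z : R => 2^-1 * z))//.
    apply: (@cvg_comp _ _ _ _ _ _ (pinfty_nbhs R)); last exact: cvgr_expR.
    by apply: gt0_cvgMry => //; exact: cvg_id.
- by move=> x _; apply: ex_derive.
- by apply: cvg_at_right_filter; exact: cF.
- by move=> x _; rewrite derive1E; apply: derive_val.
Unshelve. all: by end_near. Qed.

Definition hinge (u x : R) : R := Num.max 0 (x - u).

Lemma hinge_ge0 u x : 0 <= hinge u x. Proof. by rewrite /hinge le_max lexx. Qed.

Lemma measurable_hinge u : measurable_fun [set: R] (hinge u).
Proof. by apply: measurable_maxr => //; exact: measurable_funB. Qed.

Lemma integral_hinge_expR (t u : R) : 0 < t ->
  (\int[leb]_x (hinge u x * expR (- (t * (x - u))))%:E = (t ^- 2)%:E)%E.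
Proof.
move=> t0.
pose g (y : R) := hinge 0 y * expR (- y).
have mg : measurable_fun [set: R] g.
  apply: measurable_funM; first exact: measurable_hinge.
  by apply: measurableT_comp => //; exact: measurable_expR.
have g0 y : (0 <= (g y)%:E)%E by rewrite lee_fin mulr_ge0 ?hinge_ge0 ?expR_ge0.
have mgE : measurable_fun [set: R] (fun y => (g y)%:E) by exact/measurable_EFinP.
have Ig : (\int[leb]_y (g y)%:E = 1)%E.
  rewrite -integral_id_expRN [RHS]integral_mkcond; apply: eq_integral => x _.
  rewrite patchE mem_setE in_itv/= andbT /g /hinge subr0.
  by case: (leP 0 x) => [//|_]; rewrite mul0r.
have := @ge0_integral_lebesgue_affine R t (- (t * u)) t0 (fun y => (g y)%:E) g0 mgE.
rewrite Ig mule1 => h.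
transitivity (\int[leb]_x (t^-1%:E * (g (t * x - t * u))%:E))%E.
  apply: eq_integral => x _; rewrite /g -mulrBr -EFinM; congr EFin.
  rewrite mulrA; congr (_ * _); rewrite /hinge subr0.
  have [xu|xu] := leP 0 (x - u).
    by rewrite max_r ?mulr_ge0// ?(ltW t0)// mulrA mulVf ?mul1r// gt_eqF.
  by rewrite max_l ?mulr0// nmulr_lle0// ltW.
rewrite ge0_integralZl_EFin//.
- by rewrite h -EFinM -expr2 exprVn.
- by apply: (measurableT_comp mgE); exact: measurable_funB.
- by rewrite invr_ge0 ltW.
Qed.

Lemma normal_pdf01E x : normal_pdf 0 1 x = normal_peak 1 * expR (- (x ^+ 2 / 2)).
Proof.
rewrite /normal_pdf oner_eq0 /normal_fun subr0.
by congr (_ * expR _); rewrite expr1n mulNr.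
Qed.

Lemma ge0_integral_N01 (f : R -> \bar R) :
  (forall x, 0 <= f x)%E -> measurable_fun [set: R] f ->
  (\int[N01]_x f x = \int[leb]_x ((normal_pdf 0 1 x)%:E * f x))%E.
Proof. exact: ge0_integral_normal_prob. Qed.

(* Exponential tilting: [- x ^+ 2 / 2 <= t ^+ 2 / 2 - t * x]. *)
Lemma gauss_hinge_le (t u : R) : 0 < t ->
  (\int[N01]_x (hinge u x)%:E <=
   (normal_peak 1 * expR (t ^+ 2 / 2 - t * u) / t ^+ 2)%:E)%E.
Proof.
move=> t0; rewrite ge0_integral_N01; last 2 first.
- by move=> x; rewrite lee_fin hinge_ge0.
- by apply/measurable_EFinP; exact: measurable_hinge.
have mhe : measurable_fun [set: R] (fun x => (hinge u x * expR (- (t * (x - u))))%:E).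
  apply/measurable_EFinP; apply: measurable_funM; first exact: measurable_hinge.
  apply: (measurableT_comp (@measurable_expR R)).
  apply: (measurableT_comp (@oppr_measurable _ _)); apply: measurable_funM => //.
  exact: measurable_funB.
have c0 : 0 <= normal_peak (1 : R) * expR (t ^+ 2 / 2 - t * u).
  by rewrite mulr_ge0 ?expR_ge0// normal_peak_ge0.
have he0 x : (0 <= (hinge u x * expR (- (t * (x - u))))%:E)%E.
  by rewrite lee_fin mulr_ge0 ?hinge_ge0 ?expR_ge0.
have -> : (normal_peak 1 * expR (t ^+ 2 / 2 - t * u) / t ^+ 2)%:E =
  (\int[leb]_x ((normal_peak 1 * expR (t ^+ 2 / 2 - t * u))%:E *
     (hinge u x * expR (- (t * (x - u))))%:E))%E.
  by rewrite ge0_integralZl_EFin// integral_hinge_expR// -EFinM.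
apply: ge0_le_integral => //.
- by move=> x _; rewrite -EFinM lee_fin mulr_ge0 ?hinge_ge0// normal_pdf_ge0.
- apply: emeasurable_funM; apply/measurable_EFinP; last exact: measurable_hinge.
  exact: measurable_normal_pdf.
- exact: emeasurable_funM.
- move=> x _; rewrite -!EFinM lee_fin normal_pdf01E.
  rewrite [leRHS](_ : _ = normal_peak 1 * (expR (t ^+ 2 / 2 - t * u) *
    expR (- (t * (x - u)))) * hinge u x); last by ring.
  rewrite ler_wpM2r ?hinge_ge0// ler_wpM2l ?normal_peak_ge0// -expRD ler_expR.
  by have := sqr_ge0 (x - t); rewrite sqrrB; lra.
Qed.

Lemma gauss_opp (f : R -> \bar R) :
  (forall x, 0 <= f x)%E -> measurable_fun [set: R] f ->
  (\int[N01]_x f (- x)%R = \int[N01]_x f x)%E.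
Proof.
move=> f0 mf.
have mfN : measurable_fun [set: R] (fun x => f (- x)%R).
  exact: (measurableT_comp mf (@oppr_measurable _ _)).
rewrite (ge0_integral_N01 (fun x => f (- x)))//.
rewrite (ge0_integral_N01 f)//.
rewrite -(ge0_integral_lebesgue_opp (fun x => ((normal_pdf 0 1 x)%:E * f x)%E)).
- apply: eq_integral => x _; congr (_%:E * _)%E.
  by rewrite !normal_pdf01E sqrrN.
- by move=> x; rewrite mule_ge0// lee_fin normal_pdf_ge0.
- apply: emeasurable_funM => //; apply/measurable_EFinP.
  exact: measurable_normal_pdf.
Qed.

Lemma gauss_abs_lty : (\int[N01]_x `|x|%:E < +oo)%E.
Proof.
have m1 := (measurable_EFinP _ _).2 (measurable_hinge 0).
have m2 : measurable_fun [set: R] (fun x => (hinge 0 (- x))%:E).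
  exact: (measurableT_comp m1 (@oppr_measurable _ _)).
have h0 x : (0 <= (hinge 0 x)%:E)%E by rewrite lee_fin hinge_ge0.
have h1 x : (0 <= (hinge 0 (- x))%:E)%E by rewrite lee_fin hinge_ge0.
have -> : (\int[N01]_x `|x|%:E = \int[N01]_x ((hinge 0 x)%:E + (hinge 0 (- x))%:E))%E.
  apply: eq_integral => x _; rewrite -EFinD; congr EFin; rewrite /hinge !subr0.
  case: (leP 0 x) => x0; first by rewrite ger0_norm// max_l ?addr0// oppr_le0.
  by rewrite ltr0_norm// max_r ?add0r// oppr_ge0 ltW.
rewrite ge0_integralD//; try exact: m1; try exact: m2.
rewrite (gauss_opp (fun x => (hinge 0 x)%:E))//.
have lt1 : (\int[N01]_x (hinge 0 x)%:E < +oo)%E.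
  by apply: le_lt_trans (gauss_hinge_le 1 0 ltr01) _; rewrite ltry.
by rewrite lte_add_pinfty.
Qed.

Lemma gauss_integrable (f : R -> R) (A B : R) : measurable_fun [set: R] f ->
  (forall x, `|f x| <= A + B * `|x|) -> N01.-integrable [set: R] (EFin \o f).
Proof.
move=> mf fAB.
have A0 : 0 <= A by have := fAB 0; rewrite normr0 mulr0 addr0; apply: le_trans.
have iabs : N01.-integrable [set: R] (EFin \o (fun x : R => x)).
  apply/integrableP; split; last exact: gauss_abs_lty.
  exact/measurable_EFinP.
apply: (@integrable_le _ _ _ N01 f (fun x => A + `|B| * `|x|) mf).
  move=> x; rewrite (le_trans (fAB x))// lerD2l ler_wpM2r//.
  exact: ler_norm.
have -> : EFin \o (fun x => A + `|B| * `|x|) =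
   (cst A%:E \+ (fun x => `|B|%:E * (EFin \o (Num.norm \o (fun x : R => x))) x))%E.
  by apply/funext => x /=; rewrite EFinD EFinM.
apply: integrableD => //; first exact: finite_measure_integrable_cst.
by apply: integrableZl => //; exact: integrable_norm.
Qed.

Lemma gauss_integrable_id : N01.-integrable [set: R] (EFin \o (fun x : R => x)).
Proof. by apply: (gauss_integrable _ 0 1) => // x; rewrite add0r mul1r. Qed.

Lemma gauss_mean : (\int[N01]_x x = 0 :> R)%R.
Proof.
rewrite /Rintegral integralE.
have -> : (\int[N01]_x (fun x : R => x%:E)^\- x = \int[N01]_x (fun x : R => x%:E)^\+ x)%E.
  rewrite -(gauss_opp (fun x => ((fun x : R => x%:E)^\+ x)%E)).
  - by apply: eq_integral => x _; rewrite funenegE funeposE.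
  - by move=> x; exact: funepos_ge0.
  - by apply: measurable_funepos; exact/measurable_EFinP.
by rewrite subee// integrable_pos_fin_num//; exact: gauss_integrable_id.
Qed.

Lemma gauss_cst (c : R) : (\int[N01]_x c = c)%R.
Proof. by rewrite Rintegral_cst//= probability_setT mulr1. Qed.

End GaussianMoments.

Section GaussianComparison.
Context {R : realType}.
Local Open Scope classical_set_scope.
Local Notation leb := (@lebesgue_measure R).
Local Notation N01 := (@normal_prob R 0 1).
Implicit Types (x u t : R).

Lemma normal_peak1_le : normal_peak (1 : R) <= 2^-1.
Proof.
rewrite /normal_peak lef_pV2 ?posrE// ?sqrtr_gt0; last first.
  by rewrite expr1n mul1r pmulrn_lgt0// pi_gt0.
rewrite -(@ler_pXn2r _ 2) ?nnegrE ?sqrtr_ge0//.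
rewrite sqr_sqrtr; last by rewrite expr1n mul1r mulrn_wge0// pi_ge0.
by rewrite expr1n mul1r; have := @pi_ge2 R; lra.
Qed.

Lemma integral_linear (a b : R) : a < b ->
  (\int[leb]_(x in `[a, b]) (x - a)%:E = ((b - a) ^+ 2 / 2)%:E)%E.
Proof.
move=> ab; pose F (x : R) : R := (x - a) * (x - a) / 2.
have dF (x : R) : is_derive x (1 : R) F (x - a).
  have -> : F = ((id - cst a) * (id - cst a)) * cst 2^-1 by [].
  by apply: is_derive_eq; rewrite !fctE/= /GRing.scale/=; lra.
have cF (x : R) : {for x, continuous F}.
  apply: differentiable_continuous; apply/derivable1_diffP.
  exact: (@ex_derive _ _ _ _ _ _ _ (dF x)).
rewrite (@continuous_FTC2 _ _ F)//.
- by rewrite /F subrr mul0r mul0r sube0 expr2.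
- by apply: continuous_subspaceT => x; apply: cvgB; [exact: cvg_id|exact: cvg_cst].
- split.
  + by move=> x _; apply: ex_derive.
  + by apply: cvg_at_right_filter; exact: cF.
  + by apply: cvg_at_left_filter; exact: cF.
- by move=> x _; rewrite derive1E; apply: derive_val.
Qed.

Lemma integral_linearN (a b : R) : a < b ->
  (\int[leb]_(x in `[a, b]) (b - x)%:E = ((b - a) ^+ 2 / 2)%:E)%E.
Proof.
move=> ab; pose F (x : R) : R := - ((b - x) * (b - x) / 2).
have dF (x : R) : is_derive x (1 : R) F (b - x).
  have -> : F = - (((cst b - id) * (cst b - id)) * cst 2^-1) by [].
  by apply: is_derive_eq; rewrite !fctE/= /GRing.scale/=; lra.
have cF (x : R) : {for x, continuous F}.
  apply: differentiable_continuous; apply/derivable1_diffP.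
  exact: (@ex_derive _ _ _ _ _ _ _ (dF x)).
rewrite (@continuous_FTC2 _ _ F)//.
- by rewrite /F subrr mul0r mul0r oppr0 add0e -EFinN opprK expr2.
- by apply: continuous_subspaceT => x; apply: cvgB; [exact: cvg_cst|exact: cvg_id].
- split.
  + by move=> x _; apply: ex_derive.
  + by apply: cvg_at_right_filter; exact: cF.
  + by apply: cvg_at_left_filter; exact: cF.
- by move=> x _; rewrite derive1E; apply: derive_val.
Qed.

Lemma gauss_restrict_le (D : set R) (f : R -> R) : measurable D ->
  measurable_fun [set: R] f -> (forall x, D x -> 0 <= f x) ->
  (\int[N01]_(x in D) (f x)%:E <= (2^-1)%:E * \int[leb]_(x in D) (f x)%:E)%E.
Proof.
move=> mD mf f0; rewrite integral_mkcond ge0_integral_N01; last 2 first.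
- by move=> x; rewrite patchE; case: ifPn => // /set_mem Dx; rewrite lee_fin f0.
- apply/(measurable_restrictT _ _).1 => //.
  by apply: measurable_funTS; exact/measurable_EFinP.
have c1 x : D x -> (0 <= (f x)%:E)%E by move=> Dx; rewrite lee_fin f0.
have c2 : measurable_fun D (fun x => (f x)%:E).
  by apply: measurable_funTS; exact/measurable_EFinP.
have h2 : (0 : R) <= 2^-1 by [].
have e := @ge0_integralZl_EFin _ _ _ leb D mD (fun x => (f x)%:E) c1 c2 2^-1 h2.
apply: le_trans (eq_ind _ (fun y => (_ <= y)%E) (lexx _) _ e).
rewrite [leRHS]integral_mkcond.
have m2 : measurable_fun [set: R]
    (fun x => (normal_pdf 0 1 x)%:E * ((fun x => (f x)%:E) \_ D) x)%E.
  apply: emeasurable_funM.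
    by apply/measurable_EFinP; exact: measurable_normal_pdf.
  exact: (measurable_restrictT _ mD).1 c2.
have m3 : measurable_fun [set: R] ((fun x => (2^-1)%:E * (f x)%:E)%E \_ D).
  have m4 : measurable_fun D (fun x => (2^-1)%:E * (f x)%:E)%E.
    by apply: emeasurable_funM.
  exact: (measurable_restrictT _ mD).1 m4.
apply: ge0_le_integral; [by []| |exact: m2|exact: m3|].
- move=> x _; rewrite patchE; case: ifPn => [/set_mem Dx|_]; last by rewrite mule0.
  by rewrite -EFinM lee_fin mulr_ge0 ?normal_pdf_ge0 ?f0.
- move=> x _; rewrite !patchE; case: ifPn => [/set_mem Dx|_]; last by rewrite mule0.
  rewrite -!EFinM lee_fin ler_wpM2r ?f0//.
  by rewrite (le_trans (normal_pdf_ub _ _ (oner_neq0 _)))// normal_peak1_le.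
Qed.

Lemma hinge_integrable u : N01.-integrable [set: R] (EFin \o hinge u).
Proof.
apply: (gauss_integrable _ `|u| 1); first exact: measurable_hinge.
move=> x; rewrite mul1r ger0_norm ?hinge_ge0// /hinge ge_max addr_ge0//=.
by have := ler_norm x; have := ler_norm (- u); rewrite normrN; lra.
Qed.

(* The density of the normal law is at most 1/2, so that it dominates the
   uniform law on [-1, 1] in the convex order. *)
Lemma gauss_hinge_ge t : -1 <= t -> t <= 1 ->
  (1 - t) ^+ 2 / 4 <= (\int[N01]_x hinge t x)%R.
Proof.
move=> t1 t2.
have [t_lt1|t_ge1] := ltP t 1; last first.
  have -> : t = 1 by apply/eqP; rewrite eq_le t2.
  by rewrite subrr expr0n/= mul0r; apply: Rintegral_ge0 => x _; exact: hinge_ge0.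
(* [l * (x + 1)] is the chord of [hinge t] between -1 and 1, of mean [l] under the normal law. It
   lies below the hinge outside [[-1, 1]]; inside, it exceeds the hinge by [k1] before [t] and by
   [k2] after, whose means are at most half of triangle areas. *)
pose l : R := (1 - t) / 2.
pose k1 x : R := if (-1 <= x) && (x <= t) then l * (x + 1) else 0.
pose k2 x : R := if (t <= x) && (x <= 1) then (1 - l) * (1 - x) else 0.
have l0 : 0 <= l by rewrite /l; lra.
have l1 : l <= 1 by rewrite /l; lra.
have mk (a b : R) (f : R -> R) : measurable_fun [set: R] f ->
    measurable_fun [set: R] (fun x => if (a <= x) && (x <= b) then f x else 0).
  move=> mf; apply: measurable_fun_ifT => //.
  apply: measurable_and; first exact: (measurable_fun_ler (f := cst a) (g := id)).
  exact: (measurable_fun_ler (f := id) (g := cst b)).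
have mk1 : measurable_fun [set: R] k1.
  by apply: mk; apply: measurable_funM => //; exact: measurable_funD.
have mk2 : measurable_fun [set: R] k2.
  by apply: mk; apply: measurable_funM => //; exact: measurable_funB.
have k10 x : 0 <= k1 x.
  by rewrite /k1; case: ifP => // /andP[? ?]; rewrite mulr_ge0//; lra.
have k20 x : 0 <= k2 x.
  by rewrite /k2; case: ifP => // /andP[? ?]; rewrite mulr_ge0//; lra.
have low x : l * (x + 1) - k1 x - k2 x <= hinge t x.
  rewrite /hinge le_max; have := k10 x; have := k20 x; rewrite /k1 /k2 => h2 h1.
  have [x1|x1] := ltP x (-1).
    apply/orP; left; rewrite /=.
    have h3 : l * (x + 1) <= 0 by apply: mulr_ge0_le0 => //; lra.
    by move: (if t <= x <= 1 then _ else _) h2 => K K0; lra.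
  have [xt|xt] := leP x t.
    rewrite /= in h1 *; apply/orP; left.
    by move: (if t <= x <= 1 then _ else _) h2 => K K0; lra.
  have [x2|x2] := leP x 1.
    by rewrite (ltW xt)/= in h1 h2 *; apply/orP; right; rewrite /l; lra.
  rewrite andbF andbF/=; apply/orP; right.
  have h3 : 0 <= (x - 1) * (1 - l) by apply: mulr_ge0 => //; lra.
  by move: h3; rewrite /l; lra.
have I1 : N01.-integrable [set: R] (EFin \o (fun x : R => l * (x + 1))).
  apply: (gauss_integrable _ l l).
    by apply: measurable_funM => //; exact: measurable_funD.
  move=> x; rewrite normrM (ger0_norm l0) [leRHS](_ : _ = l * (`|x| + 1)); last by ring.
  by rewrite ler_wpM2l// (le_trans (ler_normD _ _))// normr1.
have k1b x : k1 x <= 2.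
  rewrite /k1; case: ifP => // /andP[? ?].
  by rewrite -[leRHS]mul1r; apply: ler_pM => //; lra.
have k2b x : k2 x <= 2.
  rewrite /k2; case: ifP => // /andP[? ?].
  by rewrite -[leRHS]mul1r; apply: ler_pM => //; lra.
have Ik1 : N01.-integrable [set: R] (EFin \o k1).
  by apply: (gauss_integrable _ 2 0) => // x; rewrite mul0r addr0 ger0_norm.
have Ik2 : N01.-integrable [set: R] (EFin \o k2).
  by apply: (gauss_integrable _ 2 0) => // x; rewrite mul0r addr0 ger0_norm.
have E1 : (\int[N01]_x (l * (x + 1)) = l)%R.
  rewrite RintegralZl//; last first.
    by apply: (gauss_integrable _ 1 1) => [|x]; [exact: measurable_funD|
      rewrite (le_trans (ler_normD _ _))// normr1 mul1r addrC].
  rewrite RintegralD//; [|exact: gauss_integrable_id|].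
    by rewrite gauss_mean gauss_cst add0r mulr1.
  by apply: (gauss_integrable _ 1 0) => // x; rewrite normr1 mul0r addr0.
have B1 : (\int[N01]_x k1 x <= l * (t + 1) ^+ 2 / 4)%R.
  have [t1'|t1'] := leP t (-1).
    have -> : (\int[N01]_x k1 x = 0)%R.
      rewrite (_ : k1 = cst 0) ?gauss_cst//; apply/funext => x; rewrite /k1.
      case: ifP => // /andP[? ?]; have -> : x + 1 = 0 by lra.
      by rewrite mulr0.
    by rewrite divr_ge0// mulr_ge0// sqr_ge0.
  rewrite -lee_fin /Rintegral fineK; last exact: integrable_fin_num.
  have -> : (\int[N01]_x (k1 x)%:E = \int[N01]_(x in `[(-1)%R, t]) (l * (x - -1))%:E)%E.
    rewrite [RHS]integral_mkcond; apply: eq_integral => x _.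
    by rewrite patchE mem_setE in_itv/= /k1 opprK; case: ifP.
  apply: (le_trans (gauss_restrict_le _ (fun x => l * (x - -1)) _ _ _)) => //.
  - by apply: measurable_funM => //; exact: measurable_funB.
  - by move=> x /=; rewrite in_itv/= => /andP[? ?]; rewrite mulr_ge0//; lra.
  - under eq_integral do rewrite EFinM.
    rewrite ge0_integralZl_EFin//.
    + rewrite integral_linear// -!EFinM lee_fin opprK; lra.
    + by move=> x /=; rewrite in_itv/= => /andP[? ?]; rewrite lee_fin; lra.
    + by apply: measurable_funTS; apply/measurable_EFinP; exact: measurable_funB.
have B2 : (\int[N01]_x k2 x <= (1 - l) * (1 - t) ^+ 2 / 4)%R.
  rewrite -lee_fin /Rintegral fineK; last exact: integrable_fin_num.
  have -> : (\int[N01]_x (k2 x)%:E = \int[N01]_(x in `[t, 1%R]) ((1 - l) * (1 - x))%:E)%E.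
    rewrite [RHS]integral_mkcond; apply: eq_integral => x _.
    by rewrite patchE mem_setE in_itv/= /k2; case: ifP.
  apply: (le_trans (gauss_restrict_le _ (fun x => (1 - l) * (1 - x)) _ _ _)) => //.
  - by apply: measurable_funM => //; exact: measurable_funB.
  - by move=> x /=; rewrite in_itv/= => /andP[? ?]; rewrite mulr_ge0//; lra.
  - under eq_integral do rewrite EFinM.
    rewrite ge0_integralZl_EFin//.
    + rewrite integral_linearN// -!EFinM lee_fin; lra.
    + by move=> x /=; rewrite in_itv/= => /andP[? ?]; rewrite lee_fin; lra.
    + by apply: measurable_funTS; apply/measurable_EFinP; exact: measurable_funB.
    + by lra.
have : (\int[N01]_x (l * (x + 1) - k1 x - k2 x) <= \int[N01]_x hinge t x)%R.
  apply: le_Rintegral => //; last exact: hinge_integrable.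
  by apply: integrable_subR => //; exact: integrable_subR.
apply: le_trans.
rewrite RintegralB//; last first.
  exact: integrable_subR.
rewrite RintegralB// E1.
have -> : (1 - t) ^+ 2 / 4 = l - l * (t + 1) ^+ 2 / 4 - (1 - l) * (1 - t) ^+ 2 / 4.
  by rewrite /l; field.
by apply: lerB => //; apply: lerB.
Qed.

(* Two-point laws supported in an interval of length [s] are dominated by the
   centred normal law of standard deviation [s] in the convex order; the two
   supporting lines of [g] at the endpoints reduce this to [hinge]. *)
Definition subdiff (K : R) (g : R -> R) :=
  forall x, exists k, [/\ 0 <= k, k <= K & forall y, g x + k * (y - x) <= g y].

Lemma subdiff_ge0 K g : subdiff K g -> 0 <= K.
Proof. by move=> /(_ 0)[k [k0 kK _]]; exact: le_trans kK. Qed.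

Lemma subdiff_mono K g x y : subdiff K g -> x <= y -> g x <= g y.
Proof.
move=> gK xy; have [k [k0 _ kg]] := gK x.
by rewrite (le_trans _ (kg y))// lerDl mulr_ge0// subr_ge0.
Qed.

Lemma subdiff_lip K g x y : subdiff K g -> `|g y - g x| <= K * `|y - x|.
Proof.
move=> gK; wlog xy : x y / x <= y => [h|].
  case/orP: (le_total x y) => xy; first exact: h.
  by rewrite distrC (distrC y); exact: h.
have [k [k0 kK kg]] := gK y; have := kg x.
rewrite !ger0_norm ?subr_ge0//; last exact: subdiff_mono gK _.
move=> h; apply: (@le_trans _ _ (k * (y - x))); first lra.
by rewrite ler_wpM2r// subr_ge0.
Qed.

Lemma subdiff_measurable K g : subdiff K g -> measurable_fun [set: R] g.
Proof.
move=> gK; apply: continuous_measurable_fun => x.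
apply/cvgrPdist_lt => e e0.
have K1 : 0 < K + 1 by have := subdiff_ge0 _ _ gK; lra.
have d0 : 0 < e / (K + 1) by rewrite divr_gt0.
near=> y.
rewrite distrC (le_lt_trans (subdiff_lip _ _ x y gK))//.
have yx : `|y - x| < e / (K + 1).
  by rewrite distrC; near: y; exact: cvgr_dist_lt.
rewrite (@le_lt_trans _ _ ((K + 1) * `|y - x|))//.
  by rewrite ler_wpM2r// lerDl.
by rewrite mulrC -ltr_pdivlMr.
Unshelve. all: by end_near. Qed.

Lemma subdiff_integrable K g (m s : R) : subdiff K g ->
  N01.-integrable [set: R] (EFin \o (fun x => g (m + s * x))).
Proof.
move=> gK; apply: (gauss_integrable _ (`|g m|) (K * `|s|)).
  apply: (measurableT_comp (subdiff_measurable _ _ gK)).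
  by apply: measurable_funD => //; exact: measurable_funM.
move=> x; have := subdiff_lip _ _ m (m + s * x) gK.
rewrite (addrC m) addrK normrM mulrA => h.
rewrite -[X in `|X|](subrK (g m)) (le_trans (ler_normD _ _))//.
by rewrite [leRHS]addrC lerD2r.
Qed.

Lemma gauss_affine (a b : R) : (\int[N01]_x (a + b * x) = a)%R.
Proof.
rewrite RintegralD//.
- rewrite gauss_cst RintegralZl ?gauss_mean ?mulr0 ?addr0//.
  exact: gauss_integrable_id.
- by apply: (gauss_integrable _ `|a| 0) => // x; rewrite mul0r addr0.
- apply: (gauss_integrable _ 0 `|b|) => [|x]; first exact: measurable_funM.
  by rewrite add0r normrM.
Qed.

Lemma gauss_two_point K g (m lo s p : R) : subdiff K g -> 0 < s ->
  lo <= 0 -> 0 <= lo + s -> p * s = - lo ->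
  (1 - p) * g (m + lo) + p * g (m + (lo + s)) <= (\int[N01]_x g (m + s * x))%R.
Proof.
move=> gK s0 lo0 hi0 ps.
have [k1 [k10 k1K g1]] := gK (m + lo).
have [k2 [k20 k2K g2]] := gK (m + (lo + s)).
set A := g (m + lo) in g1 *; set B := g (m + (lo + s)) in g2 *.
have k12 : k1 <= k2.
  have h1 := g1 (m + (lo + s)); have h2 := g2 (m + lo).
  have : (k2 - k1) * s >= 0 by rewrite /A /B in h1 h2; lra.
  by rewrite pmulr_lge0// subr_ge0.
pose d := k2 - k1.
have d0 : 0 <= d by rewrite subr_ge0.
(* Equal slopes: the two supporting lines coincide, and their common affine function has the
   required mean. *)
have [d1|d1] := ltP 0 d; last first.
  have dE : k2 = k1 by apply/eqP; rewrite -subr_eq0; apply/eqP/le_anti; rewrite d0 d1.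
  have -> : (1 - p) * A + p * B = (\int[N01]_x (A - k1 * lo + k1 * s * x))%R.
    rewrite gauss_affine.
    have h1 := g1 (m + (lo + s)); have h2 := g2 (m + lo).
    have BE : B = A + k1 * s.
      by apply: le_anti; rewrite dE /A /B in h1 h2 *; apply/andP; split; lra.
    rewrite BE; transitivity (A + k1 * (p * s)); first by ring.
    by rewrite ps; ring.
  apply: le_Rintegral => //.
  - apply: (gauss_integrable _ `|A - k1 * lo| `|k1 * s|) => [|x].
      by apply: measurable_funD => //; exact: measurable_funM.
    by rewrite (le_trans (ler_normD _ _))// normrM.
  - exact: subdiff_integrable gK.
  - by move=> x _; apply: le_trans (g1 _); rewrite /A; lra.
(* Point, relative to [m], where the two supporting lines cross; their maximum is an affine function
   plus [d] times a hinge at [t]. *)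
pose t := (lo + s) - (B - A - k1 * s) / d.
have dt : d * ((lo + s) - t) = B - A - k1 * s.
  by rewrite /t subKr mulrC divfK// gt_eqF.
have t1 : t <= lo + s.
  rewrite -subr_ge0 -(pmulr_rge0 _ d1) dt; have h1 := g1 (m + (lo + s)).
  by rewrite /A /B in h1 *; lra.
have t2 : lo <= t.
  rewrite -subr_ge0 -(pmulr_rge0 _ d1).
  have -> : d * (t - lo) = d * s - d * (lo + s - t) by ring.
  rewrite dt /d; have h2 := g2 (m + lo); rewrite /A /B in h2 *; lra.
have sn : s != 0 by rewrite gt_eqF.
have hgE x : s * hinge (t / s) x = Num.max 0 (s * x - t).
  by rewrite /hinge maxr_pMr ?ltW// mulr0 mulrBr mulrCA mulfV// mulr1.
have lowg x : A - k1 * lo + k1 * s * x + d * s * hinge (t / s) x <= g (m + s * x).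
  rewrite -(mulrA d) hgE.
  have [xt|xt] := leP 0 (s * x - t).
    apply: le_trans (g2 _).
    have -> : B = A + k1 * s + d * (lo + s - t) by rewrite dt; ring.
    by rewrite /d; lra.
  by apply: le_trans (g1 _); rewrite /A; lra.
have Ih : N01.-integrable [set: R] (EFin \o (fun x => d * s * hinge (t / s) x)).
  have := integrableZl measurableT (d * s) (hinge_integrable (t / s)).
  by apply: eq_integrable => // x _.
have Il : N01.-integrable [set: R] (EFin \o (fun x => A - k1 * lo + k1 * s * x)).
  apply: (gauss_integrable _ `|A - k1 * lo| `|k1 * s|) => [|x].
    by apply: measurable_funD => //; exact: measurable_funM.
  by rewrite (le_trans (ler_normD _ _))// normrM.
apply: (@le_trans _ _ (\int[N01]_x (A - k1 * lo + k1 * s * x + d * s * hinge (t / s) x))%R).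
  rewrite RintegralD// gauss_affine RintegralZl//; last exact: hinge_integrable.
  have ts1 : -1 <= t / s by rewrite ler_pdivlMr//; lra.
  have ts2 : t / s <= 1 by rewrite ler_pdivrMr//; lra.
  have := gauss_hinge_ge _ ts1 ts2; set E := (\int[N01]_x hinge _ x)%R => HE.
  have HE2 : d * s * ((1 - t / s) ^+ 2 / 4) <= d * s * E.
    by rewrite ler_wpM2l// mulr_ge0// ltW.
  apply: le_trans (_ : _ <= A - k1 * lo + d * s * ((1 - t / s) ^+ 2 / 4)) _; last by lra.
  have -> : B = A + k1 * s + d * (lo + s - t) by rewrite dt; ring.
  have -> : (1 - p) * A + p * (A + k1 * s + d * (lo + s - t)) =
     A + k1 * (p * s) + d * (p * (lo + s - t)) by ring.
  rewrite ps mulrN lerD2l -[d * s * _]mulrA ler_wpM2l//.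
  have -> : lo = - (p * s) by rewrite ps opprK.
  have -> : s * ((1 - t / s) ^+ 2 / 4) = (s - t) ^+ 2 / (4 * s) by field.
  rewrite ler_pdivlMr ?mulr_gt0//.
  (* What remains is [p * (s - t - p * s) <= (s - t) ^+ 2 / (4 * s)], a completed square. *)
  have := sqr_ge0 (2 * p * s - (s - t)); rewrite !expr2; nra.
apply: le_Rintegral => //.
- exact: integrable_addR.
- exact: subdiff_integrable gK.
Qed.

End GaussianComparison.

(** * Sums of independent normal variables *)

Section GaussianConvolution.
Context {R : realType}.
Local Open Scope classical_set_scope.
Local Notation leb := (@lebesgue_measure R).
Local Notation N01 := (@normal_prob R 0 1).

(** The inner variable is changed to [w = a x + b y]. Completing the square in [x], with
    [a ^+ 2 = c ^+ 2 - b ^+ 2], separates the normal density at [w / c] from a normal density at an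
    affine function of [x], whose integral is [b / c]. *)
Lemma ge0_gauss_conv (a b c : R) (f : R -> \bar R) :
  0 < b -> 0 < c -> a ^+ 2 + b ^+ 2 = c ^+ 2 ->
  (forall x, 0 <= f x)%E -> measurable_fun [set: R] f ->
  (\int[N01]_x \int[N01]_y f (a * x + b * y)%R = \int[N01]_z f (c * z)%R)%E.
Proof.
move=> b0 c0 abc f0 mf.
pose phi : R -> R := normal_pdf 0 1.
have mphi : measurable_fun [set: R] phi by exact: measurable_normal_pdf.
have phi0 x : 0 <= phi x by exact: normal_pdf_ge0.
have bn : b != 0 by rewrite gt_eqF.
have cn : c != 0 by rewrite gt_eqF.
have mM (r : R) : measurable_fun [set: R] (fun x : R => r * x) by exact: measurable_funM.
have mMD (r m : R) : measurable_fun [set: R] (fun x : R => r * x + m).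
  exact: measurable_funD.
pose F (p : R * R) : \bar R := ((phi p.1 * b^-1 * phi ((p.2 - a * p.1) / b))%:E * f p.2)%E.
have F0 p : (0 <= F p)%E by rewrite mule_ge0// lee_fin !mulr_ge0// invr_ge0 ltW.
have mF : measurable_fun [set: R * R] F.
  apply: emeasurable_funM; last exact: (measurableT_comp mf measurable_snd).
  apply/measurable_EFinP; apply: measurable_funM.
    apply: measurable_funM => //.
    exact: (measurableT_comp mphi measurable_fst).
  apply: (measurableT_comp mphi); apply: measurable_funM => //.
  apply: measurable_funB; first exact: measurable_snd.
  exact: (measurableT_comp (mM a) measurable_fst).
have inner (x : R) : (\int[N01]_y f (a * x + b * y)%R =
    \int[leb]_w ((b^-1 * phi ((w - a * x) / b))%:E * f w))%E.
  have mfa : measurable_fun [set: R] (fun y => f (a * x + b * y)%R).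
    by apply: (measurableT_comp mf); exact: measurable_funD.
  apply: (etrans (ge0_integral_N01 _ (fun y => f0 _) mfa)).
  pose h (w : R) : \bar R := ((phi ((w - a * x) / b))%:E * f w)%E.
  have h0 w : (0 <= h w)%E by rewrite mule_ge0// lee_fin.
  have mh : measurable_fun [set: R] h.
    apply: emeasurable_funM => //; apply/measurable_EFinP.
    apply: (measurableT_comp mphi); apply: measurable_funM => //.
    exact: measurable_funB.
  have := ge0_integral_lebesgue_affine b (a * x) b0 h h0 mh.
  have bi : 0 <= b^-1 by rewrite invr_ge0 ltW.
  have e := @ge0_integralZl_EFin _ _ _ leb setT measurableT h (fun w _ => h0 w) mh b^-1 bi.
  move=> e2; apply: etrans (etrans e2 (etrans (esym e) _)).
    apply: eq_integral => y _; rewrite /h addrK (mulrC b) mulfK//.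
    by rewrite (addrC (a * x)).
  by apply: eq_integral => w _; rewrite /h muleA -EFinM.
have outer (w : R) : (\int[leb]_x F (x, w) = (c^-1 * phi (w / c))%:E * f w)%E.
  have phiE (x : R) : phi x * b^-1 * phi ((w - a * x) / b) =
      phi (w / c) * b^-1 * phi ((c / b) * x + (- (a * w / (b * c)))).
    rewrite /phi !normal_pdf01E.
    rewrite [LHS](_ : _ = normal_peak 1 ^+ 2 * b^-1 *
      (expR (- (x ^+ 2 / 2)) * expR (- (((w - a * x) / b) ^+ 2 / 2)))); last by ring.
    rewrite [RHS](_ : _ = normal_peak 1 ^+ 2 * b^-1 *
      (expR (- ((w / c) ^+ 2 / 2)) *
       expR (- ((c / b * x + - (a * w / (b * c))) ^+ 2 / 2)))); last by ring.
    congr (_ * _); rewrite -!expRD; congr expR.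
    have a2 : a ^+ 2 = c ^+ 2 - b ^+ 2 by rewrite -abc addrK.
    have -> : - ((w / c) ^+ 2 / 2) - (c / b * x + - (a * w / (b * c))) ^+ 2 / 2 =
      - ((w / c) ^+ 2 / 2) - ((c / b * x) ^+ 2 - 2 * a * w * x / b ^+ 2
         + a ^+ 2 * w ^+ 2 / (b * c) ^+ 2) / 2 by field; rewrite bn cn.
    have -> : - (x ^+ 2 / 2) - ((w - a * x) / b) ^+ 2 / 2 =
      - (x ^+ 2 / 2) - (w ^+ 2 - 2 * a * w * x + a ^+ 2 * x ^+ 2) / b ^+ 2 / 2
      by field.
    by rewrite a2; field; rewrite bn cn.
  have cb : 0 < c / b by rewrite divr_gt0.
  pose k : R := phi (w / c) * b^-1.
  have k0 : 0 <= k by rewrite mulr_ge0// invr_ge0 ltW.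
  have mphiE : measurable_fun [set: R] (fun x => (phi x)%:E) by exact/measurable_EFinP.
  have phiE0 x : (0 <= (phi x)%:E)%E by rewrite lee_fin.
  have e1 := ge0_integral_lebesgue_affine (c / b) (- (a * w / (b * c))) cb
    (fun x => (phi x)%:E) phiE0 mphiE.
  have mphiA : measurable_fun [set: R]
      (fun x => (phi (c / b * x - a * w / (b * c)))%:E).
    exact: (measurableT_comp mphiE (mMD _ _)).
  have e2 := @ge0_integralZl_EFin _ _ _ leb setT measurableT
    (fun x => (phi (c / b * x - a * w / (b * c)))%:E) (fun x _ => phiE0 _) mphiA k k0.
  have mphik : measurable_fun [set: R] (fun x => k%:E * (phi (c / b * x - a * w / (b * c)))%:E)%E.
    exact: emeasurable_funM.
  transitivity (\int[leb]_x (f w * (k%:E * (phi (c / b * x - a * w / (b * c)))%:E)))%E.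
    by apply: eq_integral => x _; rewrite /F /= phiE EFinM muleC.
  rewrite ge0_integralZl; [|exact: measurableT|exact: mphik| |exact: f0]; last first.
    by move=> x _; rewrite mule_ge0// lee_fin.
  rewrite muleC; congr (_ * _)%E.
  apply: (etrans e2).
  have -> : (\int[leb]_x (phi (c / b * x - a * w / (b * c)))%:E = ((c / b)^-1)%:E)%E.
    by apply: etrans e1 _; rewrite integral_normal_pdf mule1.
  by rewrite -EFinM /k; congr EFin; field; rewrite bn cn.
have mfc : measurable_fun [set: R] (fun z => f (c * z)%R) by exact: (measurableT_comp mf (mM c)).
have rhs : (\int[N01]_z f (c * z)%R = \int[leb]_w ((c^-1 * phi (w / c))%:E * f w))%E.
  apply: (etrans (ge0_integral_N01 _ (fun y => f0 _) mfc)).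
  pose h (w : R) : \bar R := ((phi (w / c))%:E * f w)%E.
  have h0 w : (0 <= h w)%E by rewrite mule_ge0// lee_fin.
  have mh : measurable_fun [set: R] h.
    apply: emeasurable_funM => //; apply/measurable_EFinP.
    by apply: (measurableT_comp mphi); exact: measurable_funM.
  have e1 := ge0_integral_lebesgue_affine c 0 c0 h h0 mh.
  have ci : 0 <= c^-1 by rewrite invr_ge0 ltW.
  have e := @ge0_integralZl_EFin _ _ _ leb setT measurableT h (fun w _ => h0 w) mh c^-1 ci.
  apply: etrans (etrans e1 (etrans (esym e) _)).
    by apply: eq_integral => z _; rewrite /h addr0 (mulrC c) mulfK.
  by apply: eq_integral => w _; rewrite /h muleA -EFinM.
apply: etrans (esym rhs).
transitivity (\int[leb]_x \int[leb]_w F (x, w))%E; last first.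
  have ft := @fubini_tonelli _ _ _ _ R leb leb F mF F0.
  apply: (etrans ft).
  by apply: eq_integral => w _; exact: outer.
have mI : measurable_fun [set: R] (fun x : R => \int[leb]_w ((b^-1 * phi ((w - a * x) / b))%:E * f w))%E.
  pose G (p : R * R) : \bar R := ((b^-1 * phi ((p.2 - a * p.1) / b))%:E * f p.2)%E.
  have mG : measurable_fun [set: R * R] G.
    apply: emeasurable_funM; last exact: (measurableT_comp mf measurable_snd).
    apply/measurable_EFinP; apply: measurable_funM => //.
    apply: (measurableT_comp mphi); apply: measurable_funM => //.
    apply: measurable_funB; first exact: measurable_snd.
    exact: (measurableT_comp (mM a) measurable_fst).
  have G0 p : (0 <= G p)%E by rewrite mule_ge0// lee_fin mulr_ge0// invr_ge0 ltW.
  have h := @measurable_fun_fubini_tonelli_F _ _ _ _ R leb G mG G0.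
  rewrite /fubini_F in h.
  exact: h.
transitivity (\int[N01]_x \int[leb]_w ((b^-1 * phi ((w - a * x) / b))%:E * f w))%E.
  by apply: eq_integral => x _; exact: inner.
have I0 (x : R) : (0 <= \int[leb]_w ((b^-1 * phi ((w - a * x) / b))%:E * f w))%E.
  by apply: integral_ge0 => w _; rewrite mule_ge0// lee_fin mulr_ge0// invr_ge0 ltW.
apply: (etrans (ge0_integral_N01 _ I0 mI)).
apply: eq_integral => x _.
have m1 : measurable_fun [set: R] (fun w => (b^-1 * phi ((w - a * x) / b))%:E * f w)%E.
  apply: emeasurable_funM => //; apply/measurable_EFinP; apply: measurable_funM => //.
  by apply: (measurableT_comp mphi); apply: measurable_funM => //; exact: measurable_funB.
have n1 (w : R) : (0 <= (b^-1 * phi ((w - a * x) / b))%:E * f w)%E.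
  by rewrite mule_ge0// lee_fin mulr_ge0// invr_ge0 ltW.
have e := @ge0_integralZl_EFin _ _ _ leb setT measurableT
   (fun w => (b^-1 * phi ((w - a * x) / b))%:E * f w)%E (fun w _ => n1 w) m1 (phi x) (phi0 x).
apply: (etrans (esym e)).
apply: eq_integral => w _; rewrite /F /= muleA -EFinM; congr (_%:E * _)%E.
by rewrite /phi mulrA.
Qed.

Lemma gauss_conv (a b c : R) (g : R -> R) :
  0 < b -> 0 < c -> a ^+ 2 + b ^+ 2 = c ^+ 2 -> measurable_fun [set: R] g ->
  (\int[(N01 \x N01)%E]_p (g (a * p.1 + b * p.2))%:E = \int[N01]_z (g (c * z))%:E)%E.
Proof.
move=> b0 c0 abc mg.
have key (f : R -> \bar R) : (forall x, 0 <= f x)%E -> measurable_fun [set: R] f ->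
    (\int[(N01 \x N01)%E]_p f (a * p.1 + b * p.2)%R = \int[N01]_z f (c * z)%R)%E.
  move=> f0 mf.
  have m1 : measurable_fun [set: measurableTypeR R * measurableTypeR R]
     (fun p : measurableTypeR R * measurableTypeR R => f (a * p.1 + b * p.2)%R).
    apply: (measurableT_comp mf); apply: measurable_funD.
      by apply: measurable_funM => //; exact: measurable_fst.
    by apply: measurable_funM => //; exact: measurable_snd.
  apply: etrans (fubini_tonelli1 _ m1 (fun=> f0 _)) _.
  exact: (ge0_gauss_conv a b c f b0 c0 abc f0 mf).
have mgE : measurable_fun [set: R] (EFin \o g) by exact/measurable_EFinP.
rewrite integralE [RHS]integralE.
have e1 := key (EFin \o g)^\+%E (funepos_ge0 _) (measurable_funepos mgE).
have e2 := key (EFin \o g)^\-%E (funeneg_ge0 _) (measurable_funeneg mgE).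
by congr (_ - _)%E; [apply: (etrans _ (etrans e1 _))|apply: (etrans _ (etrans e2 _))];
  apply: eq_integral => p _; rewrite ?funeposE ?funenegE.
Qed.

End GaussianConvolution.

(** * Dirichlet averages are dominated by normal ones *)

Section DirichletMoments.
Context {R : realType} {O : finType} (x0 : O).
Local Open Scope classical_set_scope.
Local Open Scope ereal_scope.
Local Notation Q := (funSpace O (measurableTypeR R)).
Implicit Types (alpha v : O -> R).

Definition incr alpha (o : O) : O -> R := fun o' => (alpha o' + (o' == o)%:R)%R.

Lemma incr_gt0 alpha o : (forall o, 0 < alpha o)%R -> (forall o', 0 < incr alpha o o')%R.
Proof. by move=> a0 o'; rewrite ltr_pwDl. Qed.

Lemma sum_incrM alpha v o : (\sum_o' incr alpha o o' * v o' = \sum_o' alpha o' * v o' + v o)%R.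
Proof.
under eq_bigr do rewrite mulrDl.
rewrite big_split/=; congr (_ + _)%R.
by rewrite (bigD1 o)//= eqxx mul1r big1 ?addr0// => i /negbTE ->; rewrite mul0r.
Qed.

Lemma sum_incr alpha o : (\sum_o' incr alpha o o' = \sum_o' alpha o' + 1)%R.
Proof.
transitivity (\sum_o' incr alpha o o' * 1)%R; first by apply: eq_bigr => i _; rewrite mulr1.
rewrite (sum_incrM alpha (fun=> 1%R) o); congr (_ + _)%R.
by apply: eq_bigr => o' _; rewrite mulr1.
Qed.

Lemma sum_dir_gt0 alpha : (forall o, 0 < alpha o)%R -> (0 < \sum_o alpha o)%R.
Proof. by move=> a0; rewrite (bigD1 x0)//= ltr_pwDl// sumr_ge0// => o _; rewrite ltW. Qed.

Lemma dir_int_cst alpha (k : R) : (forall o, 0 < alpha o)%R -> (0 <= k)%R ->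
  dir_int alpha (fun=> k%:E) = k%:E.
Proof.
move=> a0 k0; have [D DE] := dirichlet_measure x0 alpha a0.
rewrite DE; [|by move=> q; rewrite lee_fin|exact: measurable_cst].
by rewrite integral_cst//= probability_setT mule1.
Qed.

Lemma dir_int_avg alpha v (h : Q -> \bar R) : (forall o, 0 < alpha o)%R ->
  (forall o, 0 <= v o)%R -> (forall q, 0 <= h q) -> measurable_fun [set: Q] h ->
  dir_int alpha (fun q => (\sum_o q o * v o)%:E * h q) =
  \sum_o (alpha o / (\sum_o' alpha o') * v o)%:E * dir_int (incr alpha o) h.
Proof.
move=> a0 v0 h0 mh.
have [D DE] := dirichlet_measure x0 alpha a0.
(* Off the simplex [q o] may be negative; the absolute value makes each term nonnegative and leaves
   the Dirichlet integral unchanged. *)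
pose t o (q : Q) := (`|q o|%R * v o)%:E * h q.
have t0 o q : 0 <= t o q by rewrite mule_ge0// lee_fin mulr_ge0.
have mt o : measurable_fun [set: Q] (t o).
  apply: emeasurable_funM => //; apply/measurable_EFinP.
  apply: measurable_funM => //; apply: measurableT_comp => //.
  exact: measurable_coord.
transitivity (dir_int alpha (fun q => \sum_(o <- enum O) t o q)).
  apply: (eq_dir_int x0) => q /andP[/forallP q0 _].
  rewrite -sumEFin ge0_sume_distrl; last first.
    by move=> o _; rewrite lee_fin mulr_ge0// ltW.
  by rewrite big_enum; apply: eq_bigr => o _; rewrite /t gtr0_norm.
rewrite DE; last 2 first.
- by move=> q; apply: sume_ge0.
- exact: emeasurable_sum.
rewrite ge0_integral_sum//.
rewrite big_enum; apply: eq_bigr => o _.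
rewrite -DE//.
transitivity (dir_int alpha (fun q => (q o)%:E * ((v o)%:E * h q))).
  apply: (eq_dir_int x0) => q /andP[/forallP q0 _].
  by rewrite /t gtr0_norm// muleA -EFinM.
rewrite (dir_int_incr x0)// -/(incr alpha o).
have [D' DE'] := dirichlet_measure x0 (incr alpha o) (incr_gt0 _ o a0).
have v0' : 0 <= (v o)%:E by rewrite lee_fin.
rewrite !DE'//.
- by rewrite ge0_integralZl_EFin// muleA -EFinM.
- by move=> q; rewrite mule_ge0.
- by apply: emeasurable_funM => //; exact: measurable_cst.
Qed.

(** Coordinates sum to 1 on the simplex, so a Dirichlet law is the mixture of its updates by one
    observation drawn from its mean. *)
Lemma dir_int_step alpha (h : Q -> \bar R) : (forall o, 0 < alpha o)%R ->
  (forall q, 0 <= h q) -> measurable_fun [set: Q] h ->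
  dir_int alpha h = \sum_o (alpha o / (\sum_o' alpha o'))%:E * dir_int (incr alpha o) h.
Proof.
move=> a0 h0 mh.
transitivity (dir_int alpha (fun q => (\sum_o q o * 1)%:E * h q)).
  apply: (eq_dir_int x0) => q /andP[_ /eqP q1].
  by under eq_bigr do rewrite mulr1; rewrite q1 mul1e.
rewrite dir_int_avg//; apply: eq_bigr => o _; by rewrite mulr1.
Qed.

Definition dmean alpha v : R := ((\sum_o alpha o * v o) / \sum_o alpha o)%R.

Lemma dmean_itv alpha v (c : R) : (forall o, 0 < alpha o)%R ->
  (forall o, 0 <= v o <= c)%R -> (0 <= dmean alpha v <= c)%R.
Proof.
move=> a0 vc; have b0 : (0 < \sum_o alpha o)%R by exact: sum_dir_gt0.
apply/andP; split.
  apply: divr_ge0; last exact: ltW.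
  by apply: sumr_ge0 => o _; have /andP[? _] := vc o; rewrite mulr_ge0// ltW.
rewrite /dmean ler_pdivrMr// mulr_sumr ler_sum// => o _.
by rewrite mulrC ler_wpM2r ?(ltW (a0 o))//; have /andP[] := vc o.
Qed.

Lemma dir_int_mean alpha v : (forall o, 0 < alpha o)%R -> (forall o, 0 <= v o)%R ->
  dir_int alpha (fun q => (\sum_o q o * v o)%:E) = (dmean alpha v)%:E.
Proof.
move=> a0 v0.
transitivity (dir_int alpha (fun q => (\sum_o q o * v o)%:E * 1)).
  by apply: (eq_dir_int x0) => q _; rewrite mule1.
rewrite dir_int_avg// /dmean mulr_suml -sumEFin; apply: eq_bigr => o _.
by rewrite dir_int_cst ?mule1//; [congr EFin; rewrite mulrAC|exact: incr_gt0].
Qed.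

(** One factor of the square is absorbed by [dir_int_avg], the other is a mean under the updated
    law. The variance is at most [m * (c - m) / (b + 1)], hence small for a large pseudocount. *)
Lemma dir_int_mean2 alpha v (c : R) : (forall o, 0 < alpha o)%R ->
  (forall o, 0 <= v o <= c)%R ->
  dir_int alpha (fun q => ((\sum_o q o * v o) ^+ 2)%:E) <=
  (dmean alpha v ^+ 2 + c ^+ 2 / (\sum_o alpha o + 1))%:E.
Proof.
move=> a0 vc; have b0 : (0 < \sum_o alpha o)%R by exact: sum_dir_gt0.
have v0 o : (0 <= v o)%R by case/andP: (vc o).
pose Y (q : Q) : \bar R := (\sum_o `|q o| * v o)%:E.
have -> : dir_int alpha (fun q => ((\sum_o q o * v o) ^+ 2)%:E) =
    dir_int alpha (fun q => (\sum_o q o * v o)%:E * Y q).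
  apply: (eq_dir_int x0) => q /andP[/forallP q0 _].
  rewrite /Y -EFinM expr2; congr (_ * _)%:E.
  by apply: eq_bigr => o _; rewrite gtr0_norm.
rewrite dir_int_avg//; last 2 first.
- by move=> q; rewrite lee_fin sumr_ge0// => o _; rewrite mulr_ge0.
- apply/measurable_EFinP; apply: measurable_sum => o.
  apply: measurable_funM => //; apply: measurableT_comp => //.
  exact: measurable_coord.
rewrite (eq_bigr (fun o => (alpha o / (\sum_o' alpha o') * v o *
   ((\sum_o' alpha o' * v o' + v o) / (\sum_o' alpha o' + 1)))%:E)) => [|o _]; last first.
  rewrite [dir_int _ _](_ : _ = dir_int (incr alpha o) (fun q => (\sum_o q o * v o)%:E)).
    by rewrite dir_int_mean//; [rewrite /dmean sum_incr sum_incrM -EFinM|exact: incr_gt0].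
  apply: (eq_dir_int x0) => q /andP[/forallP q0 _]; congr EFin.
  by apply: eq_bigr => o' _; rewrite gtr0_norm.
rewrite sumEFin lee_fin.
have /andP[m0 mc] := dmean_itv alpha v c a0 vc.
set b := (\sum_o' alpha o')%R in b0 *.
have Sm : (\sum_o' alpha o' * v o' = b * dmean alpha v)%R.
  by rewrite /dmean mulrC divfK// gt_eqF.
apply: (@le_trans _ _ ((b * dmean alpha v + c) / (b + 1) * dmean alpha v)%R).
  rewrite [X in (_ <= _ * X)%R]/dmean -/b mulr_suml mulr_sumr ler_sum// => o _.
  rewrite Sm [leRHS](_ : _ =
    alpha o / b * v o * ((b * dmean alpha v + c) / (b + 1)))%R; last first.
    by rewrite mulrC; congr (_ * _)%R; rewrite mulrAC.
  rewrite ler_wpM2l//; first by rewrite mulr_ge0// divr_ge0// ltW.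
  rewrite ler_wpM2r ?invr_ge0//; first by lra.
  by rewrite lerD2l; have /andP[] := vc o.
set m := dmean alpha v in m0 mc *.
have -> : ((b * m + c) / (b + 1) * m = m ^+ 2 + m * (c - m) / (b + 1))%R.
  by field; rewrite gt_eqF//; lra.
rewrite lerD2l ler_wpM2r ?invr_ge0//; [lra|nra].
Qed.

End DirichletMoments.

Section DirichletGaussian.
Context {R : realType} {O : finType} (x0 : O).
Local Open Scope classical_set_scope.
Local Notation N01 := (@normal_prob R 0 1).
Local Notation Q := (funSpace O (measurableTypeR R)).
Implicit Types (alpha v : O -> R).

Definition gauss_mix (g : R -> R) (m s : R) : R := (\int[N01]_x g (m + s * x))%R.

Lemma gauss_mix_mono K g (m m' s : R) : subdiff K g -> m <= m' ->
  gauss_mix g m s <= gauss_mix g m' s.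
Proof.
move=> gK mm'; apply: le_Rintegral; [exact: measurableT|exact: subdiff_integrable gK|
  exact: subdiff_integrable gK|].
by move=> x _; apply: (subdiff_mono _ _ _ _ gK); rewrite lerD2r.
Qed.

(** Jensen's inequality, through the supporting line at [m]. *)
Lemma gauss_mix_ge K g (m s : R) : subdiff K g -> g m <= gauss_mix g m s.
Proof.
move=> gK; have [k [k0 kK kg]] := gK m.
rewrite -[leLHS](gauss_affine (g m) (k * s)).
apply: le_Rintegral; [exact: measurableT| |exact: subdiff_integrable gK|].
  apply: (gauss_integrable _ `|g m| `|k * s|).
    by apply: measurable_funD => //; exact: measurable_funM.
  by move=> x; rewrite -normrM ler_normD.
move=> x _; apply: le_trans (kg _); rewrite -mulrA.
by have -> : m + s * x - m = s * x by ring.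
Qed.

Lemma gauss_mix_prod_integrable K g (m a b c : R) : subdiff K g -> 0 < b -> 0 < c ->
  a ^+ 2 + b ^+ 2 = c ^+ 2 ->
  (N01 \x N01)%E.-integrable setT (fun p : measurableTypeR R * measurableTypeR R =>
    (g (m + (a * p.1 + b * p.2)))%:E).
Proof.
move=> gK b0 c0 abc.
have mgm : measurable_fun [set: R] (fun x => g (m + x)).
  by apply: (measurableT_comp (subdiff_measurable _ _ gK)); exact: measurable_funD.
have mlin : measurable_fun [set: measurableTypeR R * measurableTypeR R]
    (fun p : measurableTypeR R * measurableTypeR R => a * p.1 + b * p.2).
  apply: measurable_funD.
    by apply: measurable_funM => //; exact: measurable_fst.
  by apply: measurable_funM => //; exact: measurable_snd.
have mga : measurable_fun [set: R] (fun x => `|g (m + x)|) by exact: measurableT_comp.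
have /integrableP[_ i] := subdiff_integrable K g m c gK.
have e := gauss_conv a b c (fun x => `|g (m + x)|) b0 c0 abc mga.
apply/integrableP; split; last by rewrite [X in (X < _)%E]e.
by apply/measurable_EFinP; exact: (measurableT_comp mgm mlin).
Qed.

Lemma gauss_mix_fubini K g (m a b x : R) : subdiff K g ->
  (\int[N01]_y (g (m + (a * x + b * y)))%:E)%E = (gauss_mix g (m + a * x) b)%:E.
Proof.
move=> gK; rewrite /gauss_mix /Rintegral fineK.
  by apply: eq_integral => y _; rewrite addrA.
apply: integrable_fin_num => //; exact: (subdiff_integrable K g (m + a * x) b gK).
Qed.

Lemma gauss_mix_integrable K g (m a b c : R) : subdiff K g -> 0 < b -> 0 < c ->
  a ^+ 2 + b ^+ 2 = c ^+ 2 ->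
  N01.-integrable setT (EFin \o (fun x => gauss_mix g (m + a * x) b)).
Proof.
move=> gK b0 c0 abc.
have := integrable_fubini_F (gauss_mix_prod_integrable K g m a b c gK b0 c0 abc).
congr (integrable _ _ _); apply/funext => x; exact: (gauss_mix_fubini K g m a b x gK).
Qed.

Lemma gauss_mix_gauss K g (m a b c : R) : subdiff K g -> 0 < b -> 0 < c ->
  a ^+ 2 + b ^+ 2 = c ^+ 2 ->
  (\int[N01]_x gauss_mix g (m + a * x) b)%R = gauss_mix g m c.
Proof.
move=> gK b0 c0 abc.
have mgm : measurable_fun [set: R] (fun x => g (m + x)).
  by apply: (measurableT_comp (subdiff_measurable _ _ gK)); exact: measurable_funD.
have F := integral12_prod_meas1 (gauss_mix_prod_integrable K g m a b c gK b0 c0 abc).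
have e := gauss_conv a b c (fun x => g (m + x)) b0 c0 abc mgm.
rewrite /gauss_mix [in RHS]/Rintegral; apply: (etrans _ (congr1 fine (etrans F e))).
rewrite /Rintegral; congr fine.
apply: eq_integral => x _; apply: esym; exact: (gauss_mix_fubini K g m a b x gK).
Qed.

(* The standard deviation shrinks with the pseudocount exactly so that one more
   observation is absorbed by a two-point comparison: see [dir_gauss_step]. *)
Definition dir_gauss g c alpha v : R :=
  gauss_mix g (dmean alpha v) (c / Num.sqrt (\sum_o alpha o)).

(** The variances split as c^2/b = c^2/(b+1) + c^2/(b(b+1)). One observation moves the mean by
    [d o], centred under the predictive law and confined to an interval of length c/(b+1), at most
    the second standard deviation [s]. By convexity this move is dominated by a two-point law at
    distance [s], hence by a normal variable of deviation [s], which adds up with the first one. *)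
Lemma dir_gauss_step K g (c : R) alpha v : subdiff K g -> 0 < c ->
  (forall o, 0 < alpha o) -> (forall o, 0 <= v o <= c) ->
  \sum_o alpha o / (\sum_o' alpha o') * dir_gauss g c (incr alpha o) v <=
  dir_gauss g c alpha v.
Proof.
move=> gK c0 a0 vc; have b0 : 0 < \sum_o alpha o by exact: sum_dir_gt0.
have /andP[m0 mc] := dmean_itv x0 alpha v c a0 vc.
rewrite /dir_gauss; under eq_bigr do rewrite sum_incr.
set b := \sum_o alpha o in b0 *; set m := dmean alpha v in m0 mc *.
have b10 : 0 < b + 1 by lra.
have bn : b != 0 by rewrite gt_eqF.
have b1n : b + 1 != 0 by rewrite gt_eqF.
have Sm : \sum_o' alpha o' * v o' = b * m by rewrite /m /dmean mulrC divfK.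
pose d o := (v o - m) / (b + 1).
have md o : dmean (incr alpha o) v = m + d o.
  by rewrite /dmean sum_incr sum_incrM Sm -/b /d; field.
pose r := Num.sqrt (b + 1); pose r' := Num.sqrt b.
have r0 : 0 < r by rewrite sqrtr_gt0.
have r'0 : 0 < r' by rewrite sqrtr_gt0.
have rr : r ^+ 2 = b + 1 by rewrite sqr_sqrtr// ltW.
have rr' : r' ^+ 2 = b by rewrite sqr_sqrtr// ltW.
have rn : r != 0 by rewrite gt_eqF.
have r'n : r' != 0 by rewrite gt_eqF.
have r'r : r' <= r by rewrite ler_sqrt; lra.
pose s := c / (r * r').
have s0 : 0 < s by rewrite divr_gt0// mulr_gt0.
have abc : (c / r) ^+ 2 + s ^+ 2 = (c / r') ^+ 2.
  rewrite /s; have -> : (c / r) ^+ 2 + (c / (r * r')) ^+ 2 =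
    c ^+ 2 * (r' ^+ 2 + 1) / (r ^+ 2 * r' ^+ 2) by field; rewrite rn r'n.
  by rewrite exprMn exprVn rr rr'; field; rewrite bn b1n.
pose lo := - m / (b + 1).
have lo0 : lo <= 0 by rewrite /lo mulNr oppr_le0 divr_ge0// ltW.
have cs : c / (b + 1) <= s.
  by rewrite /s -rr ler_pM2l// lef_pV2 ?posrE ?mulr_gt0 ?exprn_gt0// expr2 ler_pM2l.
have los o : lo <= d o <= lo + s.
  have /andP[vo0 voc] := vc o; apply/andP; split.
    by rewrite /lo /d; apply: ler_wpM2r; [rewrite invr_ge0 ltW|lra].
  rewrite (@le_trans _ _ (lo + c / (b + 1)))// ?lerD2l//.
  by rewrite /lo /d -mulrDl; apply: ler_wpM2r; [rewrite invr_ge0 ltW|lra].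
have hi0 : 0 <= lo + s.
  rewrite (@le_trans _ _ (lo + c / (b + 1)))// ?lerD2l//.
  by rewrite /lo -mulrDl; apply: divr_ge0; [lra|exact: ltW].
pose p := - lo / s.
have ps : p * s = - lo by rewrite /p divfK// gt_eqF.
pose w o := alpha o / b.
have w0 o : 0 <= w o by rewrite divr_ge0// ltW.
have w1 : \sum_o w o = 1 by rewrite -mulr_suml divff.
have wd : \sum_o w o * d o = 0.
  rewrite (eq_bigr (fun o => (alpha o * v o - m * alpha o) / (b * (b + 1)))).
    by rewrite -mulr_suml big_split/= sumrN -mulr_sumr -/b Sm (mulrC m) subrr mul0r.
  by move=> o _; rewrite /w /d; field; rewrite bn b1n.
have chord z : \sum_o w o * g (z + d o) <= gauss_mix g z s.
  apply: le_trans (gauss_two_point K g z lo s p gK s0 lo0 hi0 ps).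
  have -> : (1 - p) * g (z + lo) + p * g (z + (lo + s)) =
      \sum_o w o * (g (z + lo) + (d o - lo) / s * (g (z + (lo + s)) - g (z + lo))).
    rewrite [RHS](eq_bigr (fun o => w o * (g (z + lo) - lo / s * (g (z + (lo + s)) - g (z + lo)))
       + w o * d o * ((g (z + (lo + s)) - g (z + lo)) / s))) => [|o _]; last first.
      by field; rewrite gt_eqF.
    rewrite big_split/= -mulr_suml -(mulr_suml _ _ (fun o => w o * d o)) w1 wd /p.
    by field; rewrite gt_eqF.
  rewrite ler_sum// => o _; rewrite ler_wpM2l//.
  have /andP[l1 l2] := los o.
  set q := (d o - lo) / s.
  have qs : q * s = d o - lo by rewrite /q divfK// gt_eqF.
  have q0 : 0 <= q by rewrite divr_ge0 ?subr_ge0// ltW.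
  have q1 : q <= 1 by rewrite /q ler_pdivrMr// mul1r lerBlDl.
  have [k [k0 kK kg]] := gK (z + d o).
  have k1 := kg (z + lo); have k2 := kg (z + (lo + s)).
  have e1 : z + lo - (z + d o) = - (q * s) by rewrite qs; ring.
  have e2 : z + (lo + s) - (z + d o) = s - q * s by rewrite qs; ring.
  rewrite e1 in k1; rewrite e2 in k2.
  have h1 := ler_wpM2l (_ : 0 <= 1 - q) k1; have h2 := ler_wpM2l q0 k2.
  have q1' : 0 <= 1 - q by lra.
  have {}h1 := h1 q1'.
  move: h1 h2; set g1 := g (z + lo); set g2 := g (z + (lo + s)); set g3 := g (z + d o).
  clear; lra.
rewrite -(gauss_mix_gauss K g m (c / r) s (c / r') gK s0 _ abc); last by rewrite divr_gt0.
apply: (@le_trans _ _ (\int[N01]_x (\sum_o w o * g (m + c / r * x + d o)))%R); last first.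
  apply: le_Rintegral => //.
  - apply: integrable_sumR => o; apply: integrable_scaleR.
    have := subdiff_integrable K g (m + d o) (c / r) gK.
    by congr (integrable _ _ _); apply/funext => x /=; congr (g _)%:E; ring.
  - by apply: (gauss_mix_integrable K g m (c / r) s (c / r')) => //; rewrite divr_gt0.
rewrite Rintegral_sum; last first.
  move=> o; apply: integrable_scaleR.
  have := subdiff_integrable K g (m + d o) (c / r) gK.
  by congr (integrable _ _ _); apply/funext => x /=; congr (g _)%:E; ring.
rewrite le_eqVlt; apply/orP; left; apply/eqP; apply: eq_bigr => o _.
rewrite RintegralZl//; last first.
  have := subdiff_integrable K g (m + d o) (c / r) gK.
  by congr (integrable _ _ _); apply/funext => x /=; congr (g _)%:E; ring.
rewrite md; congr (_ * _); apply: eq_Rintegral => x _; congr g; ring.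
Qed.

(** The threshold does not depend on [alpha], as the induction on the number of observations
    requires. The Lipschitz bound gives [g m + K |Y - m|], and [K |z| <= K eta + (K / eta) z ^+ 2]
    reduces the second term to the variance. *)
Lemma dir_int_gauss_large K g (c : R) v e : subdiff K g -> 0 < c ->
  (forall o, 0 <= v o <= c) -> 0 < e -> exists B, forall alpha,
  (forall o, 0 < alpha o) -> B <= \sum_o alpha o ->
  (dir_int alpha (fun q => (g `|\sum_o q o * v o| - g 0)%:E) <=
  (dir_gauss g c alpha v - g 0 + e)%:E)%E.
Proof.
move=> gK c0 vc e0; have K0 := subdiff_ge0 _ _ gK.
have v0 o : 0 <= v o by case/andP: (vc o).
pose eta := e / (2 * (K + 1)).
have K1 : 0 < K + 1 by lra.
have eta0 : 0 < eta by rewrite divr_gt0// mulr_gt0.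
pose k := K / eta; have k0 : 0 <= k by rewrite divr_ge0// ltW.
exists (2 * k * c ^+ 2 / e) => alpha a0 Bb.
have b0 : 0 < \sum_o alpha o by exact: sum_dir_gt0.
have /andP[m0 mc] := dmean_itv x0 alpha v c a0 vc.
have ek : K * eta <= e / 2.
  have -> : K * eta = (e / 2) * (K / (K + 1)) by rewrite /eta; field; rewrite gt_eqF.
  rewrite ger_pMr ?divr_gt0// ler_pdivrMr//; lra.
have kb : k * (c ^+ 2 / (\sum_o alpha o + 1)) <= e / 2.
  rewrite mulrA ler_pdivrMr; last by lra.
  by move: Bb; rewrite ler_pdivrMr//; lra.
have [D DE] := dirichlet_measure x0 alpha a0.
have mS : measurable_fun [set: Q] (fun q : Q => \sum_o q o * v o).
  apply: measurable_sum => o; apply: measurable_funM => //; exact: measurable_coord.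
pose Y (q : Q) := `|\sum_o q o * v o|.
have Y0 q : 0 <= Y q by exact: normr_ge0.
have mY : measurable_fun [set: Q] Y by exact: measurableT_comp.
have YE q : simplex q -> Y q = \sum_o q o * v o.
  move=> /andP[/forallP q0 _]; rewrite /Y ger0_norm// sumr_ge0// => o _.
  by rewrite mulr_ge0// ltW.
pose G (q : Q) := g (Y q) - g 0.
have G0 q : 0 <= G q by rewrite subr_ge0; exact: subdiff_mono gK _.
have mG : measurable_fun [set: Q] G.
  by apply: measurable_funB => //; exact: (measurableT_comp (subdiff_measurable _ _ gK)).
have mGE : measurable_fun [set: Q] (fun q => (G q)%:E) by exact/measurable_EFinP.
have mYE : measurable_fun [set: Q] (fun q => (Y q)%:E) by exact/measurable_EFinP.
have mY2E : measurable_fun [set: Q] (fun q => (Y q ^+ 2)%:E).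
  by apply/measurable_EFinP; exact: measurable_funX.
set m := dmean alpha v in m0 mc *.
pose C := g m - g 0 + K * eta + k * m ^+ 2.
have gm0 : 0 <= g m - g 0 by rewrite subr_ge0; exact: subdiff_mono gK _.
have C0 : 0 <= C.
  have h1 := mulr_ge0 K0 (ltW eta0); have h2 := mulr_ge0 k0 (exprn_ge0 2 m0).
  by rewrite /C; lra.
have EY : (\int[D]_q (Y q)%:E = m%:E)%E.
  rewrite -DE; [|by move=> q; rewrite lee_fin|by []].
  rewrite -(dir_int_mean x0 alpha v a0 v0); apply: (eq_dir_int x0) => q sq.
  by rewrite YE.
have EY2 : (\int[D]_q (Y q ^+ 2)%:E <= (m ^+ 2 + c ^+ 2 / (\sum_o alpha o + 1))%:E)%E.
  rewrite -DE; [|by move=> q; rewrite lee_fin exprn_ge0|by []].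
  apply: le_trans (dir_int_mean2 x0 alpha v c a0 vc).
  rewrite le_eqVlt; apply/orP; left; apply/eqP; apply: (eq_dir_int x0) => q sq.
  by rewrite YE.
(* The cross term of the square is moved to the left, so that both sides are nonnegative and can be
   integrated termwise. *)
have pw q : G q + k * (2 * m) * Y q <= C + k * Y q ^+ 2.
  have h1 := subdiff_lip _ _ m (Y q) gK.
  have h2 : g (Y q) - g m <= `|g (Y q) - g m| by exact: ler_norm.
  set z := `|Y q - m| in h1.
  have z2 : z ^+ 2 = (Y q - m) ^+ 2 by rewrite real_normK// num_real.
  have zb : K * z <= K * eta + k * z ^+ 2.
    rewrite /k -mulrA -mulrDr ler_wpM2l//.
    rewrite -subr_ge0 (_ : _ - z = (eta ^+ 2 + z ^+ 2 - eta * z) / eta); last first.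
      by field; rewrite gt_eqF.
    apply: divr_ge0; last exact: ltW.
    clear; nra.
  rewrite z2 in zb; rewrite /G /C.
  move: h1 h2 zb; clear; nra.
have T : (dir_int alpha (fun q => (G q)%:E) + (k * (2 * m) * m)%:E <=
   C%:E + (k * (m ^+ 2 + c ^+ 2 / (\sum_o alpha o + 1)))%:E)%E.
  have km : 0 <= k * (2 * m) by rewrite mulr_ge0// mulr_ge0.
  rewrite DE; [|by move=> q; rewrite lee_fin|by []].
  rewrite (EFinM (k * (2 * m))) -EY -ge0_integralZl_EFin//; last by move=> q _; rewrite lee_fin.
  rewrite -ge0_integralD//; last 3 first.
  - by move=> q _; rewrite lee_fin.
  - by move=> q _; rewrite mule_ge0// lee_fin.
  - by apply: emeasurable_funM => //; exact: measurable_cst.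
  rewrite (EFinM k (m ^+ 2 + _)).
  apply: (@le_trans _ _ (C%:E + k%:E * \int[D]_q (Y q ^+ 2)%:E)%E); last first.
    by apply: leeD2l; apply: lee_wpmul2l; [rewrite lee_fin|].
  rewrite -ge0_integralZl_EFin//; last by move=> q _; rewrite lee_fin exprn_ge0.
  have -> : C%:E = (\int[D]_q (fun=> C%:E) q)%E.
    by rewrite integral_cst//= probability_setT mule1.
  have mkY2 : measurable_fun [set: Q] (fun q => k%:E * (Y q ^+ 2)%:E)%E.
    by apply: emeasurable_funM => //; exact: measurable_cst.
  have mkY : measurable_fun [set: Q] (fun q => (k * (2 * m))%:E * (Y q)%:E)%E.
    by apply: emeasurable_funM => //; exact: measurable_cst.
  have kY2 q : (0 <= k%:E * (Y q ^+ 2)%:E)%E by rewrite mule_ge0// lee_fin exprn_ge0.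
  have kY q : (0 <= (k * (2 * m))%:E * (Y q)%:E)%E by rewrite mule_ge0// lee_fin.
  rewrite -ge0_integralD; [|by []|by move=> q _; rewrite lee_fin|exact: measurable_cst
    |by move=> q _|by []].
  apply: ge0_le_integral; [by []| | | |].
  - by move=> q _; rewrite adde_ge0// lee_fin.
  - exact: emeasurable_funD.
  - by apply: emeasurable_funD => //; exact: measurable_cst.
  - by move=> q _; rewrite -!EFinM -!EFinD lee_fin.
have gm : g m <= dir_gauss g c alpha v by exact: (gauss_mix_ge K).
have [r rE] : exists r, dir_int alpha (fun q => (G q)%:E) = r%:E.
  have I0 : (0 <= dir_int alpha (fun q => (G q)%:E))%E.
    rewrite DE; [|by move=> q; rewrite lee_fin|by []].
    by apply: integral_ge0 => q _; rewrite lee_fin.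
  move: T I0; case: (dir_int _ _) => [r _ _| |//]; first by exists r.
  by rewrite addye// -EFinD leye_eq.
rewrite -[X in (X <= _)%E]/(dir_int alpha (fun q => (G q)%:E)).
move: T; rewrite rE -!EFinD !lee_fin /C.
move: ek kb gm; clear; nra.
Qed.

(* Iterating [dir_int_step] makes the pseudocount arbitrarily large, where both
   sides are close to [g] at the mean by [dir_int_gauss_large]; along the way the
   Gaussian side can only decrease by [dir_gauss_step]. *)
Theorem dir_int_gauss_le K g (c : R) alpha v : subdiff K g -> 0 < c ->
  (forall o, 0 < alpha o) -> (forall o, 0 <= v o <= c) ->
  (dir_int alpha (fun q => (g (\sum_o q o * v o) - g 0)%:E) <=
  (dir_gauss g c alpha v - g 0)%:E)%E.
Proof.
move=> gK c0 a0 vc; have v0 o : 0 <= v o by case/andP: (vc o).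
pose G (q : Q) := (g `|\sum_o q o * v o| - g 0)%:E.
have G0 q : (0 <= G q)%E by rewrite lee_fin subr_ge0; exact: subdiff_mono gK _.
have mG : measurable_fun [set: Q] G.
  apply/measurable_EFinP; apply: measurable_funB => //.
  apply: (measurableT_comp (subdiff_measurable _ _ gK)); apply: measurableT_comp => //.
  apply: measurable_sum => o; apply: measurable_funM => //; exact: measurable_coord.
rewrite (eq_dir_int x0 alpha _ G) => [|q /andP[/forallP q0 _]]; last first.
  rewrite /G ger0_norm// sumr_ge0// => o _.
  by rewrite mulr_ge0// ltW.
apply/lee_addgt0Pr => e e0; rewrite -EFinD.
have [B HB] := dir_int_gauss_large K g c v e gK c0 vc e0.
have [n Bn] : exists n, B <= \sum_o alpha o + n%:R.
  have b0 : 0 < \sum_o alpha o by exact: sum_dir_gt0.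
  exists (Num.truncn `|B|).+1; have := truncnS_gt `|B|; have := ler_norm B; lra.
elim: n alpha a0 Bn => [|n IH] alpha a0 Bn; first by apply: HB => //; rewrite addr0 in Bn.
rewrite (dir_int_step x0)//.
have b0 : 0 < \sum_o alpha o by exact: sum_dir_gt0.
apply: (@le_trans _ _ (\sum_o (alpha o / (\sum_o' alpha o') *
    (dir_gauss g c (incr alpha o) v - g 0 + e))%:E)%E).
  apply: lee_sum => o _; rewrite [leRHS]EFinM; apply: lee_wpmul2l.
    by rewrite lee_fin divr_ge0 ?ltW.
  apply: IH; first exact: incr_gt0.
  by rewrite sum_incr; move: Bn; rewrite -natr1; lra.
rewrite sumEFin lee_fin.
under eq_bigr do rewrite -addrA mulrDr.
rewrite big_split/= -!mulr_suml divff ?gt_eqF// mul1r -addrA lerD2r.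
exact: dir_gauss_step gK _ _ _.
Qed.

End DirichletGaussian.

(** * Prior, posterior and trajectories *)

Section IteratedConjugacy.
Context {d : measure_display} {T : measurableType d} {R : realType} {I : eqType}.
Local Open Scope classical_set_scope.
Local Open Scope ereal_scope.
Local Notation prodType := (funSpace I T).

Lemma iter_int_cst (mu : I -> probability T R) s (c : R) y :
  iter_int mu s (fun=> c%:E) y = c%:E.
Proof.
elim: s y => //= i s IH y; under eq_integral do rewrite IH.
by rewrite integral_cst//= probability_setT mule1.
Qed.

Lemma iter_int_coord (mu : I -> probability T R) s (phi : T -> \bar R) y k (c : R) :
  (forall z, 0 <= phi z) -> measurable_fun setT phi -> uniq s -> k \in s ->
  \int[mu k]_z phi z = c%:E ->
  iter_int mu s (fun y => phi (y k)) y = c%:E.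
Proof.
move=> phi0 mphi us ks phic.
have mf : measurable_fun [set: prodType] (fun y : prodType => phi (y k)).
  exact: (measurableT_comp mphi (measurable_coord k)).
rewrite (iter_int_resample mu s (fun y : prodType => phi (y k)) y k)// -(iter_int_cst mu s c y).
by apply: eq_iter_int => y' _; rewrite -phic; apply: eq_integral => z _; rewrite upd_same.
Qed.

(** The weight depends on coordinate [k] only: the one-coordinate identity is applied where [k] is
    integrated, and the constant [w] passes through the other integrals. *)
Lemma iter_int_conj (mu nu : I -> probability T R) s (h : T -> R) (w : R)
    (f : prodType -> \bar R) y k : uniq s -> k \in s -> (0 <= w)%R ->
  (forall q, 0 <= h q)%R -> measurable_fun setT h ->
  (forall y, 0 <= f y) -> measurable_fun setT f ->
  (forall j, j != k -> mu j = nu j) ->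
  (forall g, (forall q, 0 <= g q) -> measurable_fun setT g ->
     \int[mu k]_q ((h q)%:E * g q) = w%:E * \int[nu k]_q g q) ->
  iter_int mu s (fun y => (h (y k))%:E * f y) y = w%:E * iter_int nu s f y.
Proof.
move=> us ks w0 h0 mh f0 mf munu hk.
elim: s y us ks => //= j s IH y /andP[js us].
rewrite inE => /orP[/eqP kj|ks].
  rewrite kj in munu hk *.
  have -> : \int[mu j]_z iter_int mu s (fun y => (h (y j))%:E * f y) (upd y j z) =
            \int[mu j]_z ((h z)%:E * iter_int nu s f (upd y j z)).
    apply: eq_integral => z _; rewrite -ge0_iter_intZ//.
    rewrite (eq_iter_int_measure mu nu); last first.
      by move=> i is_; apply: munu; apply: contraNneq js => <-.
    by apply: eq_iter_int => y' y'E; rewrite y'E// upd_same.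
  apply: hk; first by move=> q; exact: iter_int_ge0.
  exact: (measurableT_comp (measurable_iter_int nu s f f0 mf) (measurable_updr j y)).
have jk : j != k by apply: contraNneq js => ->.
under eq_integral do rewrite IH//.
rewrite munu// ge0_integralZl//; last by move=> z _; exact: iter_int_ge0.
exact: (measurableT_comp (measurable_iter_int nu s f f0 mf) (measurable_updr j y)).
Qed.

End IteratedConjugacy.

Section SimplexRetraction.
Context {R : realType} {O : finType} (x0 : O).
Local Open Scope classical_set_scope.
Local Notation Q := (funSpace O (measurableTypeR R)).

(* Precomposing with this retraction turns statements about all models into
   statements about stochastic ones, at no cost since the Dirichlet laws are
   carried by [simplex]. *)
Definition retr (q : O -> R) : O -> R :=
  if simplex q then q else fun=> (#|O|%:R)^-1.

Lemma simplex_retr q : simplex (retr q).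
Proof.
rewrite /retr; case: ifP => // _; rewrite /simplex.
have O0 : (0 < #|O|)%N by apply/card_gt0P; exists x0.
apply/andP; split; first by apply/forallP => o; rewrite invr_gt0 ltr0n.
by rewrite sumr_const -[X in X *+ _]mulr1 -mulrnAr mulVf// pnatr_eq0 -lt0n.
Qed.

Lemma retr_id q : simplex q -> retr q = q.
Proof. by rewrite /retr => ->. Qed.

Lemma measurable_retr : measurable_fun [set: Q] (retr : Q -> Q).
Proof.
have mS : measurable_fun [set: Q] (simplex : Q -> bool).
  apply: measurable_and.
    apply: (measurable_forall_pos (fun o (q : Q) => q o)) => o.
    exact: measurable_coord.
  apply: measurable_fun_eqr; last exact: measurable_cst.
  by apply: measurable_sum => o; exact: measurable_coord.
apply: measurable_into_funSpace => o.
rewrite [X in measurable_fun _ X](_ : _ =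
  fun q : Q => if simplex q then q o else (#|O|%:R)^-1 : R); last first.
  by apply/funext => q; rewrite /retr; case: ifP.
apply: measurable_fun_ifT => //; exact: measurable_coord.
Qed.

Lemma ones_gt0 : forall o : O, 0 < (fun=> 1 : R) o.
Proof. by move=> o; exact: ltr01. Qed.

(** Total in [a]: parameters that are not all positive get the uniform law on the simplex as
    default, so that this is a law for every parameter. *)
Definition dirD (a : O -> R) : probability Q R :=
  match pselect (forall o, 0 < a o) with
  | left a0 => sval (cid (dirichlet_measure x0 a a0))
  | right _ => sval (cid (dirichlet_measure x0 _ ones_gt0))
  end.

Lemma dirDE a (g : Q -> \bar R) : (forall o, 0 < a o) ->
  (forall q, 0 <= g q)%E -> measurable_fun [set: Q] g ->
  dir_int a g = (\int[dirD a]_q g q)%E.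
Proof.
move=> a0; rewrite /dirD; case: pselect => // a0'.
by case: cid => D /= DE; exact: DE.
Qed.

Lemma dir_int_retr a (g : Q -> \bar R) : (forall o, 0 < a o) ->
  (forall q, simplex q -> 0 <= g q)%E -> measurable_fun [set: Q] g ->
  dir_int a g = (\int[dirD a]_q g (retr q))%E.
Proof.
move=> a0 g0 mg; rewrite -(dirDE a (g \o retr)) //=.
- by apply: (eq_dir_int x0) => q sq; rewrite /= retr_id.
- by move=> q; apply: g0; exact: simplex_retr.
- exact: (measurableT_comp mg measurable_retr).
Qed.

End SimplexRetraction.

Section PriorMeasure.
Context {R : realType} {X A : finType} {H : nat} (x0 : outcome X).
Local Open Scope classical_set_scope.
Local Notation K := (sa_index X A H).
Local Notation O := (outcome X).
Local Notation Q := (funSpace O (measurableTypeR R)).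
Local Notation M := (funSpace K Q).
Implicit Types (alpha : K -> O -> R) (P : M).

Definition legit (P : K -> O -> R) := forall k, simplex (P k).

Definition retrM (P : K -> O -> R) : K -> O -> R := fun k => retr (P k).

Lemma legit_retrM P : legit (retrM P).
Proof. by move=> k; exact: simplex_retr. Qed.

Lemma measurable_retrM : measurable_fun [set: M] (retrM : M -> M).
Proof.
apply: measurable_into_funSpace => k.
exact: (measurableT_comp measurable_retr (measurable_coord k)).
Qed.

Definition pos_params alpha := forall k o, 0 < alpha k o.

(** Coordinates outside [s] are never drawn, so they must lie in the simplex for the retraction to
    fix them. For the full enumeration this is vacuous, and the zero model can serve as starting
    point. *)
Lemma prior_intE alpha s (f : M -> \bar R) P : pos_params alpha ->
  (forall P, legit P -> 0 <= f P)%E -> measurable_fun [set: M] f ->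
  (forall k, k \notin s -> simplex (P k)) ->
  prior_int alpha s f P = iter_int (fun k => dirD x0 (alpha k)) s (f \o retrM) P.
Proof.
move=> a0 f0 mf; elim: s P => [|k s IH] P Ps /=.
  by congr f; apply/funext => k; rewrite /retrM retr_id// Ps.
pose fR (P' : M) := f (retrM P').
have fR0 P' : (0 <= fR P')%E by apply: f0; exact: legit_retrM.
have mfR : measurable_fun [set: M] fR by exact: (measurableT_comp mf measurable_retrM).
rewrite -(dirDE x0 (alpha k) (fun q => iter_int (fun k => dirD x0 (alpha k)) s fR (upd P k q))); last 3 first.
- exact: a0.
- by move=> q; exact: iter_int_ge0.
- exact: (measurableT_comp (measurable_iter_int _ s fR fR0 mfR) (measurable_updr k P)).
apply: (eq_dir_int x0) => q sq; apply: IH => j js; rewrite /upd.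
by case: eqP => // /eqP jk; apply: Ps; rewrite inE negb_or jk.
Qed.

Definition zeroM : M := fun _ _ => 0.

Definition priorM alpha : probability M R :=
  sval (cid (iter_int_measure (fun k => dirD x0 (alpha k)) (enum {: K}) zeroM (enum_uniq _))).

Lemma priorME alpha (f : M -> \bar R) :
  (forall P, 0 <= f P)%E -> measurable_fun [set: M] f ->
  (\int[priorM alpha]_P f P)%E = iter_int (fun k => dirD x0 (alpha k)) (enum {: K}) f zeroM.
Proof. by rewrite /priorM; case: cid => Pi /= PiE; exact: PiE. Qed.

(* Bounded measurable, the bound being required on stochastic models only. *)
Definition bm (f : M -> R) :=
  measurable_fun [set: M] f /\ exists C, forall P, legit P -> `|f P| <= C.

Lemma bm_cst (c : R) : bm (fun=> c).
Proof. by split => //; exists `|c|. Qed.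

Lemma bm_coord k o : bm (fun P => P k o).
Proof.
split; first exact: (measurableT_comp (measurable_coord o) (measurable_coord k)).
exists 1 => P lP; have /andP[/forallP P0 /eqP P1] := lP k.
rewrite gtr0_norm// -P1 (bigD1 o)//= lerDl sumr_ge0// => o' _; exact: ltW.
Qed.

Lemma bm_add f g : bm f -> bm g -> bm (fun P => f P + g P).
Proof.
move=> [mf [C fC]] [mg [C' gC]]; split; first exact: measurable_funD.
exists (C + C') => P lP; rewrite (le_trans (ler_normD _ _))// lerD ?fC ?gC//.
Qed.

Lemma bm_mul f g : bm f -> bm g -> bm (fun P => f P * g P).
Proof.
move=> [mf [C fC]] [mg [C' gC]]; split; first exact: measurable_funM.
by exists (C * C') => P lP; rewrite normrM ler_pM ?fC ?gC.
Qed.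

Lemma bm_scale c f : bm f -> bm (fun P => c * f P).
Proof. by move=> bf; apply: bm_mul => //; exact: bm_cst. Qed.

Lemma bm_sub f g : bm f -> bm g -> bm (fun P => f P - g P).
Proof.
move=> bf bg; have := bm_add _ _ bf (bm_scale (-1) _ bg).
by congr bm; apply/funext => P; rewrite mulN1r.
Qed.

Lemma bm_sum {J : Type} (s : seq J) (p : pred J) (f : J -> M -> R) :
  (forall j, bm (f j)) -> bm (fun P => \sum_(j <- s | p j) f j P).
Proof.
move=> bf; elim: s => [|j s IH].
  by under eq_fun do rewrite big_nil; exact: bm_cst.
under eq_fun do rewrite big_cons.
by case: (p j) => //; exact: bm_add.
Qed.

Lemma bm_max f g : bm f -> bm g -> bm (fun P => Num.max (f P) (g P)).
Proof.
move=> [mf [C fC]] [mg [C' gC]]; split; first exact: measurable_maxr.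
exists (Num.max C C') => P lP; rewrite le_max.
by case: (leP (f P) (g P)) => _; rewrite ?fC ?gC// orbT.
Qed.

Lemma bm_bigmax {J : Type} (s : seq J) (g : M -> R) (f : J -> M -> R) :
  bm g -> (forall j, bm (f j)) -> bm (fun P => \big[Num.max/g P]_(j <- s) f j P).
Proof.
move=> bg bf; elim: s => [|j s IH].
  by under eq_fun do rewrite big_nil.
by under eq_fun do rewrite big_cons; exact: bm_max.
Qed.

(** Models are retracted before [f] is applied, so facts about [legit] models hold at every point
    rather than almost surely. *)
Definition Er alpha (f : M -> R) : R := (\int[priorM alpha]_P f (retrM P))%R.

Lemma bm_integrable alpha f : bm f ->
  (priorM alpha).-integrable [set: M] (EFin \o (f \o retrM)).
Proof.
move=> [mf [C fC]].
apply: (integrable_le (priorM alpha) (f \o retrM) (fun=> C)).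
- exact: (measurableT_comp mf measurable_retrM).
- by move=> P /=; apply: fC; exact: legit_retrM.
- by apply: finite_measure_integrable_cst.
Qed.

Lemma Er_eq alpha f g : (forall P, legit P -> f P = g P) -> Er alpha f = Er alpha g.
Proof. by move=> fg; apply: eq_Rintegral => P _; apply: fg; exact: legit_retrM. Qed.

Lemma Er_le alpha f g : bm f -> bm g -> (forall P, legit P -> f P <= g P) ->
  Er alpha f <= Er alpha g.
Proof.
move=> bf bg fg; apply: le_Rintegral; [by []|exact: bm_integrable|exact: bm_integrable|].
by move=> P _; apply: fg; exact: legit_retrM.
Qed.

Lemma Er_cst alpha c : Er alpha (fun=> c) = c.
Proof. by rewrite /Er Rintegral_cst//= probability_setT mulr1. Qed.

Lemma Er_add alpha f g : bm f -> bm g ->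
  Er alpha (fun P => f P + g P) = Er alpha f + Er alpha g.
Proof. by move=> bf bg; apply: RintegralD => //; exact: bm_integrable. Qed.

Lemma Er_scale alpha c f : bm f -> Er alpha (fun P => c * f P) = c * Er alpha f.
Proof. by move=> bf; apply: RintegralZl => //; exact: bm_integrable. Qed.

Lemma Er_sub alpha f g : bm f -> bm g ->
  Er alpha (fun P => f P - g P) = Er alpha f - Er alpha g.
Proof.
move=> bf bg; rewrite -mulN1r -Er_scale// -Er_add//; last exact: bm_scale.
by apply: Er_eq => P _; rewrite mulN1r.
Qed.

Lemma Er_sum alpha {J : Type} (s : seq J) (p : pred J) (f : J -> M -> R) :
  (forall j, bm (f j)) ->
  Er alpha (fun P => \sum_(j <- s | p j) f j P) = \sum_(j <- s | p j) Er alpha (f j).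
Proof.
by move=> bf; apply: Rintegral_sum => j; exact: bm_integrable.
Qed.

Lemma Er_iter alpha f : bm f -> (forall P, legit P -> 0 <= f P) ->
  (Er alpha f)%:E = iter_int (fun k => dirD x0 (alpha k)) (enum {: K})
    (fun P => (f (retrM P))%:E) zeroM.
Proof.
move=> bf f0; rewrite -priorME; last 2 first.
- by move=> P; rewrite lee_fin; apply: f0; exact: legit_retrM.
- by apply/measurable_EFinP; exact: (measurableT_comp bf.1 measurable_retrM).
by rewrite /Er /Rintegral fineK//; apply: integrable_fin_num => //; exact: bm_integrable.
Qed.

Lemma prior_int_Er alpha f : pos_params alpha -> bm f -> (forall P, legit P -> 0 <= f P) ->
  prior_int alpha (enum {: K}) (EFin \o f) (fun _ _ => 0) = (Er alpha f)%:E.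
Proof.
move=> a0 bf f0; rewrite Er_iter// prior_intE//.
- by apply/measurable_EFinP; exact: bf.1.
- by move=> k; rewrite mem_enum.
Qed.

Definition incrM alpha (k : K) (o : O) : K -> O -> R :=
  fun k' => if k' == k then incr (alpha k) o else alpha k'.

(** Bayes' rule: weighting by the probability of an observation yields its predictive probability
    times the expectation under the updated parameters. Adding a constant reduces to nonnegative
    [f], the case of [iter_int_conj]. *)
Lemma Er_conj alpha k o f : pos_params alpha -> bm f ->
  Er alpha (fun P => P k o * f P) =
  alpha k o / (\sum_o' alpha k o') * Er (incrM alpha k o) f.
Proof.
move=> a0 bf; wlog f0 : f bf / forall P, legit P -> 0 <= f P => [hw|].
  have [C fC] := bf.2.
  have bfC : bm (fun P => f P + C) by apply: bm_add => //; exact: bm_cst.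
  have h1 : Er alpha (fun P => P k o * (f P + C)) =
      alpha k o / (\sum_o' alpha k o') * Er (incrM alpha k o) (fun P => f P + C).
    apply: hw => // P lP; have := fC P lP; rewrite ler_norml => /andP[]; lra.
  have h2 : Er alpha (fun P => P k o * C) =
      alpha k o / (\sum_o' alpha k o') * Er (incrM alpha k o) (fun=> C).
    apply: hw; first exact: bm_cst.
    by move=> P lP; apply: le_trans (fC P lP).
  have b1 : bm (fun P => P k o * f P) by apply: bm_mul => //; exact: bm_coord.
  have b2 : bm (fun P => P k o * C) by apply: bm_mul; [exact: bm_coord|exact: bm_cst].
  rewrite (Er_add _ f (fun=> C))// in h1; last exact: bm_cst.
  rewrite (Er_eq alpha _ (fun P => P k o * f P + P k o * C)) in h1; last first.
    by move=> P _; rewrite mulrDr.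
  by rewrite Er_add// mulrDr h2 in h1; apply: addIr h1.
have b1 : bm (fun P => P k o * f P) by apply: bm_mul => //; exact: bm_coord.
have Pk0 P : legit P -> 0 <= P k o by move=> lP; have /andP[/forallP P0 _] := lP k; exact: ltW.
have S0 : 0 < \sum_o' alpha k o' by exact: (sum_dir_gt0 x0 (alpha k) (a0 k)).
apply: EFin_inj; rewrite EFinM Er_iter//; last first.
  by move=> P lP; apply: mulr_ge0; [exact: Pk0|exact: f0].
rewrite Er_iter//.
have w0 : 0 <= alpha k o / (\sum_o' alpha k o') by rewrite divr_ge0// ltW.
have h0 (q : Q) : 0 <= retr q o.
  by have /andP[/forallP q0 _] := simplex_retr x0 q; exact: ltW.
have mh : measurable_fun [set: Q] (fun q => retr q o).
  exact: (measurableT_comp (measurable_coord o) measurable_retr).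
have fR0 P : (0 <= (f (retrM P))%:E)%E by rewrite lee_fin; apply: f0; exact: legit_retrM.
have mfR : measurable_fun [set: M] (fun P => (f (retrM P))%:E).
  by apply/measurable_EFinP; exact: (measurableT_comp bf.1 measurable_retrM).
rewrite -(iter_int_conj (fun k => dirD x0 (alpha k)) (fun k' => dirD x0 (incrM alpha k o k'))
  (enum {: K}) (fun q => retr q o) _ _ zeroM k)//.
- exact: enum_uniq.
- by rewrite mem_enum.
- by move=> j jk; rewrite /incrM (negbTE jk).
move=> g g0 mg; rewrite /incrM eqxx.
have ai o' : 0 < incr (alpha k) o o' by exact: incr_gt0.
rewrite -(dirDE x0 (incr (alpha k) o) g)// -(dir_int_incr x0 (alpha k) o g)//.
rewrite -(dirDE x0 (alpha k) (fun q => (retr q o)%:E * g q)%E)//.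
- by apply: (eq_dir_int x0) => q sq; rewrite retr_id.
- by move=> q; rewrite mule_ge0// lee_fin.
- by apply: emeasurable_funM => //; exact/measurable_EFinP.
Qed.

End PriorMeasure.

(** * Trajectories as nested sums *)

Section SumOverSequences.
Context {R : realType} {O : finType}.

(** Intermediate form between the sum over finite functions in [Wreg] and the recursion of
    [pathsum], which follows time. *)
Fixpoint sumseq (n : nat) (G : seq O -> R) : R :=
  if n is n'.+1 then \sum_o sumseq n' (fun s => G (o :: s)) else G [::].

Lemma eq_sumseq n (G G' : seq O -> R) : (forall s, size s = n -> G s = G' s) ->
  sumseq n G = sumseq n G'.
Proof.
elim: n G G' => [|n IH] G G' GG /=; first exact: GG.
by apply: eq_bigr => o _; apply: IH => s sn; apply: GG; rewrite /= sn.
Qed.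

Lemma sumseqZ n (c : R) G : sumseq n (fun s => c * G s) = c * sumseq n G.
Proof.
elim: n G => //= n IH G; rewrite mulr_sumr; apply: eq_bigr => o _.
exact: (IH (fun s => G (o :: s))).
Qed.

Lemma sum_ffun_seq n (G : seq O -> R) :
  \sum_(os : {ffun 'I_n -> O}) G [seq os i | i <- enum 'I_n] = sumseq n G.
Proof.
elim: n G => [|n IH] G /=.
  rewrite (big_pred1 (ffun0 (card_ord 0))) => [|os].
    by rewrite (_ : enum 'I_0 = [::])//; apply/size0nil; rewrite size_enum_ord.
  by apply/esym/eqP/ffunP => -[].
pose join (p : O * {ffun 'I_n -> O}) : {ffun 'I_n.+1 -> O} :=
  [ffun i => if unlift ord0 i is Some j then p.2 j else p.1].
pose split (os : {ffun 'I_n.+1 -> O}) : O * {ffun 'I_n -> O} :=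
  (os ord0, [ffun j => os (lift ord0 j)]).
have joinK : cancel join split.
  move=> [z os]; rewrite /split /join ffunE unlift_none; congr pair.
  by apply/ffunP => j; rewrite !ffunE liftK.
have splitK : cancel split join.
  move=> os; apply/ffunP => i; rewrite /split /join ffunE.
  by case: unliftP => [j ->|->]; rewrite /= ?ffunE.
rewrite (reindex join); last by exists split => ? _; [exact: joinK|exact: splitK].
under [RHS]eq_bigr do rewrite -IH.
rewrite pair_big; apply: eq_bigr => -[z os] _ /=; congr G.
rewrite enum_ordSl /= /join ffunE unlift_none/=; congr cons.
by rewrite -map_comp; apply: eq_map => j /=; rewrite ffunE liftK.
Qed.

End SumOverSequences.

Section Paths.
Context {R : realType} {X A : finType} {H : nat}.
Local Notation K := (sa_index X A H).
Local Notation O := (outcome X).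
Local Notation D := (data X A H).
Implicit Types (P : K -> O -> R) (pi : policy X A H) (F : D -> R).

Fixpoint mkpath pi (t : nat) (x : X) (s : seq O) : D :=
  match s, (insub t : option 'I_H) with
  | o :: s', Some i => ((i, x, pi (i, x)), o) :: mkpath pi t.+1 o.2 s'
  | _, _ => [::]
  end.

(** Expectation of [F] over the rest of an episode from state [x] at period [t]; [F] receives the
    transitions in the form in which they are appended to the data. *)
Fixpoint pathsum P pi (d t : nat) (x : X) F : R :=
  match d, (insub t : option 'I_H) with
  | d'.+1, Some i =>
      let k := (i, x, pi (i, x)) in
      \sum_o P k o * pathsum P pi d' t.+1 o.2 (fun l => F ((k, o) :: l))
  | _, _ => F [::]
  end.

Lemma sumseq_pathsum P pi d t x F : (d + t = H)%N ->
  sumseq d (fun s => (\prod_(e <- mkpath pi t x s) P e.1 e.2) * F (mkpath pi t x s)) =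
  pathsum P pi d t x F.
Proof.
elim: d t x F => [|d IH] t x F dt /=; first by rewrite big_nil mul1r.
have tH : (t < H)%N by rewrite -dt addSn ltnS leq_addl.
case: insubP => [i _ _|]; last by rewrite tH.
apply: eq_bigr => o _; rewrite -IH; last by rewrite addnS -addSn.
by rewrite -sumseqZ; apply: eq_sumseq => s _; rewrite big_cons /= mulrA.
Qed.

Lemma traj_dataE pi x0 (os : {ffun 'I_H -> O}) :
  traj_data pi x0 os = mkpath pi 0 x0 [seq os i | i <- enum 'I_H].
Proof.
rewrite /traj_data; apply/esym.
have key d t x : (d + t = H)%N -> (forall i : 'I_H, val i = t -> x = epstate x0 os i) ->
    mkpath pi t x [seq os i | i <- drop t (enum 'I_H)] =
    [seq ((i, epstate x0 os i, pi (i, epstate x0 os i)), os i) | i <- drop t (enum 'I_H)].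
  elim: d t x => [|d IH] t x dt xE.
    have tH : (H <= t)%N by rewrite -dt.
    by rewrite drop_oversize ?size_enum_ord.
  have tH : (t < H)%N by rewrite -dt addSn ltnS leq_addl.
  pose i : 'I_H := Ordinal tH.
  rewrite (drop_nth i) ?size_enum_ord//.
  have -> : nth i (enum 'I_H) t = i by apply: val_inj; rewrite /= nth_enum_ord.
  rewrite /= insubT /= -/i -(xE i)//; congr cons.
  apply: IH; first by rewrite addnS -addSn.
  move=> j jt; rewrite /epstate jt /= insubT /=.
  by congr (os _).2; apply: val_inj.
have := key H 0 x0; rewrite drop0; apply; first by rewrite addn0.
by move=> i i0; rewrite /epstate; case: insubP => // j _ _; rewrite i0.
Qed.

Lemma sum_traj (rho : X -> R) P pi x0 F :
  \sum_(os : {ffun 'I_H -> O}) traj_prob rho P pi x0 os * F (traj_data pi x0 os) =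
  rho x0 * pathsum P pi H 0 x0 F.
Proof.
rewrite -sumseq_pathsum ?addn0// -sumseqZ -sum_ffun_seq.
apply: eq_bigr => os _; rewrite -traj_dataE mulrA; congr (_ * _ * _).
by rewrite /traj_data big_map big_enum.
Qed.

Lemma eq_pathsum P pi d t x F F' : (forall l, F l = F' l) ->
  pathsum P pi d t x F = pathsum P pi d t x F'.
Proof.
elim: d t x F F' => [|d IH] t x F F' FF /=; first exact: FF.
case: insubP => [i _ _|_]; last exact: FF.
by apply: eq_bigr => o _; congr *%R; apply: IH.
Qed.

Lemma eq_pathsum_level P P' pi d t x F :
  (forall k : K, (t <= k.1.1)%N -> P k = P' k) ->
  pathsum P pi d t x F = pathsum P' pi d t x F.
Proof.
elim: d t x F => [|d IH] t x F PP //=.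
case: insubP => [i _ it|//].
apply: eq_bigr => o _; rewrite PP/=; last by rewrite it.
by congr *%R; apply: IH => k tk; apply: PP; exact: ltnW.
Qed.

Lemma le_pathsum P pi d t x F F' : (forall k o, 0 <= P k o) -> (forall l, F l <= F' l) ->
  pathsum P pi d t x F <= pathsum P pi d t x F'.
Proof.
move=> P0; elim: d t x F F' => [|d IH] t x F F' FF /=; first exact: FF.
case: insubP => [i _ _|_]; last exact: FF.
by rewrite ler_sum// => o _; rewrite ler_wpM2l//; exact: IH.
Qed.

Lemma pathsum_cst P pi d t x (c : R) : (forall k, \sum_o P k o = 1) ->
  pathsum P pi d t x (fun=> c) = c.
Proof.
move=> P1; elim: d t x => [//|d IH] t x /=.
case: insubP => [i _ _|//].
by under eq_bigr do rewrite IH; rewrite -mulr_suml P1 mul1r.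
Qed.

Lemma pathsumD P pi d t x F F' :
  pathsum P pi d t x (fun l => F l + F' l) = pathsum P pi d t x F + pathsum P pi d t x F'.
Proof.
elim: d t x F F' => [//|d IH] t x F F' /=.
case: insubP => [i _ _|//].
by rewrite -big_split /=; apply: eq_bigr => o _; rewrite -mulrDr -IH.
Qed.

Lemma Vpi_pathsum P pi d t x : (forall k, \sum_o P k o = 1) ->
  Vpi_aux P pi d t x = pathsum P pi d t x (fun l => \sum_(e <- l) rew e.2).
Proof.
move=> P1; elim: d t x => [|d IH] t x /=; first by rewrite big_nil.
case: insubP => [i _ _|_]; last by rewrite big_nil.
apply: eq_bigr => o _; congr *%R; rewrite IH -{1}(pathsum_cst P pi d t.+1 o.2 (rew o) P1).
by rewrite -pathsumD; apply: eq_pathsum => l; rewrite big_cons.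
Qed.

Definition post (alpha : K -> O -> R) (l : D) : K -> O -> R :=
  fun k o => alpha k o + (count (pred1 (k, o)) l)%:R.

(** Posterior mean, which is also the predictive law of the next outcome. *)
Definition hatP alpha l : K -> O -> R :=
  fun k o => post alpha l k o / \sum_o' post alpha l k o'.

Lemma post_nil alpha : post alpha [::] = alpha.
Proof. by apply/funext => k; apply/funext => o; rewrite /post /= addr0. Qed.

Lemma post_gt0 alpha l : pos_params alpha -> pos_params (post alpha l).
Proof. by move=> a0 k o; rewrite ltr_pwDl. Qed.

Lemma post_rcons alpha l k o : incrM (post alpha l) k o = post alpha (rcons l (k, o)).
Proof.
apply/funext => k'; apply/funext => o'; rewrite /incrM /incr /post -cats1 count_cat/= addn0.
rewrite natrD addrA xpair_eqE; case: (eqVneq k' k) => [->|kk'].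
  by rewrite andTb (eq_sym o).
by rewrite /= addr0.
Qed.

Lemma sum_post alpha l k : \sum_o post alpha l k o = \sum_o alpha k o + (nvisits l k)%:R.
Proof.
rewrite big_split/=; congr (_ + _); rewrite -natr_sum; congr _%:R.
rewrite /nvisits; elim: l => [|[k' o'] l IH] /=; first by rewrite big1.
rewrite big_split/= IH; congr (_ + _)%N.
under eq_bigr do rewrite xpair_eqE.
rewrite (bigD1 o')//= eqxx andbT big1 ?addn0// => o oo'.
by rewrite (eq_sym o') (negbTE oo') ?andbF.
Qed.

Lemma hatP_level alpha (l : D) t (k : K) (o : O) :
  (k.1.1 < t)%N -> forall k' : K, (t <= k'.1.1)%N ->
  hatP alpha (rcons l (k, o)) k' = hatP alpha l k'.
Proof.
move=> kt k' tk'; have kk' : k != k'.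
  by apply: contraTneq tk' => <-; rewrite -ltnNge.
have e o' : post alpha (rcons l (k, o)) k' o' = post alpha l k' o'.
  by rewrite /post -cats1 count_cat/= xpair_eqE (negbTE kk')/= !addn0.
apply/funext => o'; rewrite /hatP e; congr (_ / _).
by apply: eq_bigr => o'' _; exact: e.
Qed.

Context (x0 : outcome X).

Lemma hatP_gt0 alpha l k o : pos_params alpha -> 0 < hatP alpha l k o.
Proof.
move=> a0; rewrite divr_gt0 ?post_gt0//.
exact: (sum_dir_gt0 x0 (post alpha l k) (post_gt0 _ _ a0 k)).
Qed.

Lemma sum_hatP alpha l k : pos_params alpha -> \sum_o hatP alpha l k o = 1.
Proof.
move=> a0; rewrite -mulr_suml divff// gt_eqF//.
exact: (sum_dir_gt0 x0 (post alpha l k) (post_gt0 _ _ a0 k)).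
Qed.

Local Notation M := (funSpace K (funSpace O (measurableTypeR R))).

Lemma bm_pathsum pi d t x (f : M -> D -> R) : (forall l, bm (fun P => f P l)) ->
  bm (fun P => pathsum P pi d t x (f P)).
Proof.
elim: d t x f => [|d IH] t x f bf /=; first exact: bf.
case: insubP => [i _ _|_]; last exact: bf.
apply: bm_sum => o; apply: bm_mul; first exact: bm_coord.
by apply: (IH _ _ (fun P l => f P ((i, x, pi (i, x), o) :: l))) => l; exact: bf.
Qed.

(** [Er_conj] turns the random probability of the first transition into its predictive probability
    and updates the posterior. The rest of the path meets later periods only, where by [hatP_level]
    the update leaves [hatP] unchanged: the kernel stays that of the data before the episode, while
    [f] is averaged under the updated posterior. *)
Lemma Er_pathsum alpha l pi d t x (f : M -> D -> R) : pos_params alpha ->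
  (forall l, bm (fun P => f P l)) ->
  Er x0 (post alpha l) (fun P => pathsum P pi d t x (f P)) =
  pathsum (hatP alpha l) pi d t x (fun l' => Er x0 (post alpha (l ++ l')) (f^~ l')).
Proof.
move=> a0; elim: d l t x f => [|d IH] l t x f bf /=; first by rewrite cats0.
case: insubP => [i _ it|_]; last by rewrite cats0.
set k := (i, x, pi (i, x)).
have bp o : bm (fun P : M => pathsum P pi d t.+1 o.2 (fun l' => f P ((k, o) :: l'))).
  by apply: (bm_pathsum _ _ _ _ (fun P l' => f P ((k, o) :: l'))) => l'; exact: bf.
rewrite Er_sum; last by move=> o; apply: bm_mul => //; exact: bm_coord.
apply: eq_bigr => o _; rewrite Er_conj//; last exact: post_gt0.
congr *%R; rewrite post_rcons.
rewrite (IH (rcons l (k, o)) t.+1 o.2 (fun P l' => f P ((k, o) :: l'))); last first.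
  by move=> l'; exact: bf.
rewrite (eq_pathsum_level _ (hatP alpha l)); last first.
  by move=> k' tk'; apply: (hatP_level _ _ t.+1) => //; rewrite /= it.
by apply: eq_pathsum => l'; rewrite cat_rcons.
Qed.

Lemma bm_Vpi pi x : bm (fun P : M => Vpi P pi x).
Proof.
rewrite /Vpi; suff h d t y : bm (fun P : M => Vpi_aux P pi d t y) by exact: h.
elim: d t y => [|d IH] t y /=; first exact: bm_cst.
case: insubP => [i _ _|_]; last exact: bm_cst.
apply: bm_sum => o; apply: bm_mul; first exact: bm_coord.
by apply: bm_add; [exact: bm_cst|exact: IH].
Qed.

Lemma bm_Vstar (a0 : A) x : bm (fun P : M => Vstar a0 P x).
Proof. by apply: bm_bigmax => [|pi]; exact: bm_Vpi. Qed.

(** The value is the expected total reward along a path, and this reward no longer depends on the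
    model once the path is given. *)
Lemma Er_Vpi alpha l pi x : pos_params alpha ->
  Er x0 (post alpha l) (fun P => Vpi P pi x) = Vpi (hatP alpha l) pi x.
Proof.
move=> a0; rewrite (Er_eq x0 _ _ (fun P => pathsum P pi H 0 x (fun l => \sum_(e <- l) rew e.2))).
  rewrite (Er_pathsum alpha l pi H 0 x (fun P l => \sum_(e <- l) rew e.2)) => [|//|l']; last exact: bm_cst.
  rewrite /Vpi Vpi_pathsum => [|k]; last exact: sum_hatP.
  by apply: eq_pathsum => l'; rewrite Er_cst.
by move=> P lP; apply: Vpi_pathsum => k; have /andP[_ /eqP] := lP k.
Qed.

End Paths.

(** * Dynamic programming and RLSVI *)

Section SubdiffClosure.
Context {R : realType}.

Lemma subdiff_cst K (c : R) : 0 <= K -> subdiff K (fun=> c).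
Proof. by move=> K0 x; exists 0; split => // y; rewrite mul0r addr0. Qed.

Lemma subdiff_id : subdiff 1 (fun x : R => x).
Proof. by move=> x; exists 1; split => // y; rewrite mul1r addrC subrK. Qed.

Lemma subdiff_max K (f g : R -> R) : subdiff K f -> subdiff K g ->
  subdiff K (fun x => Num.max (f x) (g x)).
Proof.
move=> fK gK x; case: (leP (f x) (g x)) => fg.
  have [k [k0 kK kg]] := gK x; exists k; split => // y.
  by rewrite le_max kg orbT.
have [k [k0 kK kf]] := fK x; exists k; split => // y.
by rewrite le_max kf.
Qed.

Lemma subdiff_bigmax {J : Type} K (s : seq J) (g : R -> R) (f : J -> R -> R) :
  subdiff K g -> (forall j, subdiff K (f j)) ->
  subdiff K (fun x => \big[Num.max/g x]_(j <- s) f j x).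
Proof.
move=> gK fK; elim: s => [|j s IH]; first by under eq_fun do rewrite big_nil.
by under eq_fun do rewrite big_cons; exact: subdiff_max.
Qed.

Lemma subdiff_affine {J : finType} (c : R) (w : J -> R) (f : J -> R -> R) :
  (forall j, 0 <= w j) -> \sum_j w j <= 1 -> (forall j, subdiff 1 (f j)) ->
  subdiff 1 (fun x => c + \sum_j w j * f j x).
Proof.
move=> w0 w1 fK x.
have /choice[k kP] : forall j, exists k, [/\ 0 <= k, k <= 1 &
    forall y, f j x + k * (y - x) <= f j y] by move=> j; exact: fK.
exists (\sum_j w j * k j); split.
- by apply: sumr_ge0 => j _; rewrite mulr_ge0//; have [] := kP j.
- apply: le_trans w1; apply: ler_sum => j _.
  by rewrite ler_piMr//; have [] := kP j.
move=> y; rewrite -addrA lerD2l mulr_suml -big_split ler_sum//= => j _.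
by rewrite -mulrA -mulrDr ler_wpM2l//; have [_ _] := kP j; exact.
Qed.

End SubdiffClosure.

Section BigMax.
Context {R : realType} {X A : finType} (a0 : A).
Implicit Types (Q : X -> A -> R).

Lemma maxQ_ge Q x a : Q x a <= maxQ a0 Q x.
Proof. by rewrite /maxQ (le_bigmax_cond _ (Q x)). Qed.

Lemma maxQ_le Q x (c : R) : (forall a, Q x a <= c) -> maxQ a0 Q x <= c.
Proof. by move=> Qc; apply: bigmax_le => //. Qed.

Lemma eq_maxQ Q Q' x : (forall a, Q x a = Q' x a) -> maxQ a0 Q x = maxQ a0 Q' x.
Proof. by move=> QQ; rewrite /maxQ QQ; apply: eq_bigr => a _; exact: QQ. Qed.

Lemma maxQ0 x : maxQ a0 (fun (_ : X) _ => 0 : R) x = 0.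
Proof.
apply/eqP; rewrite eq_le (maxQ_ge (fun _ _ => 0) x a0) andbT.
exact: (@maxQ_le (fun _ _ => 0)).
Qed.

End BigMax.

Section DynamicProgram.
Context {R : realType} {X A : finType} (a0 : A) {H : nat}.
Local Notation K := (sa_index X A H).
Local Notation O := (outcome X).
Implicit Types (c : K -> R) (w : K -> O -> R) (P : K -> O -> R).

Definition qstep c w (V : X -> R) (k : K) : R := c k + \sum_o w k o * V o.2.

Fixpoint DP c w (d t : nat) (x : X) : R :=
  match d, (insub t : option 'I_H) with
  | d'.+1, Some i => maxQ a0 (fun y a => qstep c w (DP c w d' t.+1) (i, y, a)) x
  | _, _ => 0
  end.

Definition qval c w (k : K) : R := qstep c w (DP c w (H - k.1.1.+1) k.1.1.+1) k.

Lemma DP_S c w d t x (i : 'I_H) : (d.+1 + t = H)%N -> t = i ->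
  DP c w d.+1 t x = maxQ a0 (fun y a => qval c w (i, y, a)) x.
Proof.
move=> dt ti /=; case: insubP => [j _ jt|]; last by rewrite ti ltn_ord.
have -> : j = i by apply: val_inj; rewrite /= jt.
apply: eq_maxQ => a; rewrite /qval /= -ti.
by have -> : (H - t.+1 = d)%N by rewrite -dt addSnnS addnK.
Qed.

Lemma eq_DP c w c' w' d t x : (forall k : K, (t <= k.1.1)%N -> c k = c' k /\ w k = w' k) ->
  DP c w d t x = DP c' w' d t x.
Proof.
elim: d t x => [//|d IH] t x cw /=; case: insubP => // i _ it.
apply: eq_maxQ => a; have [|e1 e2] := cw (i, x, a); first by rewrite /= it.
rewrite /qstep e1 e2; congr (_ + _); apply: eq_bigr => o _; rewrite (IH t.+1)// => k tk.
by apply: cw; exact: ltnW.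
Qed.

(** Granting row [k] its own value as reward, with no continuation, gives the same program: the row
    acts only through the single number [qval c w k]. *)
Lemma DP_override c w k d t x : (d + t = H)%N ->
  DP c w d t x = DP (upd c k (qval c w k)) (upd w k (fun=> 0)) d t x.
Proof.
elim: d t x => [//|d IH] t x dt.
have tH : (t < H)%N by rewrite -dt addSn ltnS leq_addl.
pose i := Ordinal tH.
rewrite !(DP_S _ _ d t x i)//; apply: eq_maxQ => a.
rewrite {2}/qval /qstep {1 2}/upd; case: eqP => [<-|ne].
  by rewrite big1 ?addr0// => o _; rewrite mul0r.
rewrite /qval /qstep /=; congr (_ + _); apply: eq_bigr => o _.
have -> : (H - t.+1 = d)%N by rewrite -dt addSnnS addnK.
by rewrite IH// addnS -addSn.
Qed.

(** The value [y] of row [k] enters through maxima and averages of total weight at most 1. These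
    preserve what [subdiff 1] packages: convexity, monotonicity and the Lipschitz constant 1. *)
Lemma DP_subdiff c w k d t x :
  (forall k' o, 0 <= w k' o) -> (forall k', \sum_o w k' o <= 1) ->
  subdiff 1 (fun y => DP (upd c k y) (upd w k (fun=> 0)) d t x).
Proof.
move=> w0 w1; elim: d t x => [|d IH] t x /=; first exact: subdiff_cst.
case: insubP => [i _ _|_]; last exact: subdiff_cst.
have step a : subdiff 1 (fun y => qstep (upd c k y) (upd w k (fun=> 0))
    (DP (upd c k y) (upd w k (fun=> 0)) d t.+1) (i, x, a)).
  rewrite /qstep {1 2}/upd; case: eqP => [_|_].
    have := @subdiff_id R; congr subdiff; apply/funext => y.
    by rewrite big1 ?addr0// => o _; rewrite mul0r.
  by apply: (subdiff_affine _ _ (fun o y =>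
    DP (upd c k y) (upd w k (fun=> 0)) d t.+1 o.2)).
by rewrite /maxQ; apply: subdiff_bigmax.
Qed.

Lemma DP_ge c w (b : R) d t x : 0 <= b -> (forall k, - b <= c k) ->
  (forall k' o, 0 <= w k' o) -> (forall k', \sum_o w k' o <= 1) ->
  - (d%:R * b) <= DP c w d t x.
Proof.
move=> b0 cb w0 w1; elim: d t x => [|d IH] t x /=; first by rewrite mul0r oppr0.
case: insubP => [i _ _|_]; last by rewrite oppr_le0 mulr_ge0.
apply: le_trans (maxQ_ge a0 _ _ a0); rewrite /qstep.
rewrite -natr1 mulrDl mul1r opprD addrC lerD//.
apply: (@le_trans _ _ (\sum_o w (i, x, a0) o * - (d%:R * b))).
  rewrite -mulr_suml mulrN lerN2 ler_piMl//; exact: mulr_ge0.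
by apply: ler_sum => o _; rewrite ler_wpM2l.
Qed.

Definition mean_rew P (k : K) : R := \sum_o P k o * rew o.

Lemma rew_itv (o : O) : 0 <= (rew o : R) <= 1.
Proof. by rewrite /rew; case: o.1; rewrite /= ?lexx ?ler01. Qed.

Lemma DP_itv P d t x : (forall k o, 0 <= P k o) ->
  (forall k : K, (t <= k.1.1)%N -> \sum_o P k o = 1) ->
  0 <= DP (mean_rew P) P d t x <= d%:R.
Proof.
move=> P0; elim: d t x => [|d IH] t x P1 /=; first by rewrite lexx.
case: insubP => [i _ it|_]; last by rewrite lexx ler0n.
have IH' y : 0 <= DP (mean_rew P) P d t.+1 y <= d%:R.
  by apply: IH => k tk; apply: P1; exact: ltnW.
have q a : 0 <= qstep (mean_rew P) P (DP (mean_rew P) P d t.+1) (i, x, a) <= d.+1%:R.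
  rewrite /qstep /mean_rew -big_split /=; apply/andP; split.
    apply: sumr_ge0 => o _; rewrite -mulrDr mulr_ge0// addr_ge0//.
    by case/andP: (IH' o.2).
  have -> : d.+1%:R = \sum_o P (i, x, a) o * d.+1%:R :> R.
    by rewrite -mulr_suml P1 ?mul1r//= it.
  rewrite ler_sum// => o _.
  rewrite -mulrDr ler_wpM2l// -natr1 addrC lerD//.
    by case/andP: (IH' o.2).
  by case/andP: (rew_itv o).
apply/andP; split; first by apply: le_trans (maxQ_ge a0 _ _ a0); case/andP: (q a0).
by apply: maxQ_le => a; case/andP: (q a).
Qed.

Lemma Vpi_le_DP P pi d t x : (forall k o, 0 <= P k o) ->
  Vpi_aux P pi d t x <= DP (mean_rew P) P d t x.
Proof.
move=> P0; elim: d t x => [|d IH] t x //=; case: insubP => // i _ _.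
apply: le_trans (maxQ_ge a0 _ _ (pi (i, x))).
rewrite /qstep /mean_rew -big_split /= ler_sum// => o _.
by rewrite -mulrDr ler_wpM2l// lerD2l.
Qed.

Lemma Vstar_le_DP P x : (forall k o, 0 <= P k o) ->
  Vstar a0 P x <= DP (mean_rew P) P H 0 x.
Proof. by move=> P0; apply: bigmax_le => [|pi _]; exact: Vpi_le_DP. Qed.

Lemma Vpi_itv P pi x : (forall k o, 0 <= P k o) -> (forall k, \sum_o P k o = 1) ->
  0 <= Vpi P pi x <= H%:R.
Proof.
move=> P0 P1; apply/andP; split; last first.
  apply: le_trans (Vpi_le_DP _ _ _ _ _ P0) _.
  by have /andP[] := DP_itv P H 0 x P0 (fun k _ => P1 k).
rewrite /Vpi; suff h d t y : 0 <= Vpi_aux P pi d t y by exact: h.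
elim: d t y => [|d IH] t y //=; case: insubP => // i _ _.
by apply: sumr_ge0 => o _; rewrite mulr_ge0// addr_ge0.
Qed.

Lemma Vstar_ge P pi x : Vpi P pi x <= Vstar a0 P x.
Proof. by rewrite /Vstar (le_bigmax_cond _ (fun pi => Vpi P pi x)). Qed.

Local Open Scope classical_set_scope.

Lemma measurable_DP {d'} {T : measurableType d'} (c : T -> K -> R) (w : T -> K -> O -> R) d t x :
  (forall k, measurable_fun [set: T] (c ^~ k)) ->
  (forall k o, measurable_fun [set: T] (fun y => w y k o)) ->
  measurable_fun [set: T] (fun y => DP (c y) (w y) d t x).
Proof.
move=> mc mw; elim: d t x => [|d IH] t x /=; first exact: measurable_cst.
case: insubP => [i _ _|_]; last exact: measurable_cst.
have mq a : measurable_fun [set: T] (fun y => qstep (c y) (w y) (DP (c y) (w y) d t.+1) (i, x, a)).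
  apply: measurable_funD => //; apply: measurable_sum => o.
  by apply: measurable_funM.
rewrite /maxQ; elim: (index_enum A) => [|a s IHs].
  have := mq a0; congr measurable_fun; apply/funext => y; by rewrite big_nil.
have := measurable_maxr (mq a) IHs.
by congr measurable_fun; apply/funext => y; rewrite big_cons.
Qed.

End DynamicProgram.

(** * RLSVI as a dynamic program *)

Section RLSVI.
Context {R : realType} {X A : finType} (a0 : A) {H : nat} (beta : R).
Hypothesis (H0 : (0 < H)%N) (beta0 : 0 < beta).
Local Notation K := (sa_index X A H).
Local Notation O := (outcome X).
Local Notation v := ((H ^ 2)%:R : R).
Local Notation lambda := (v / beta).
Local Notation theta := (fun _ : K => H%:R : R).
Implicit Types (l : data X A H) (xi : K -> R).

Definition pcount l k : R := beta + (nvisits l k)%:R.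

Definition noise_sd l k : R := H%:R / Num.sqrt (pcount l k).

(* [RLSVI] is the dynamic program with reward [gc] and substochastic kernel
   [gw]: the prior mass [beta] of the kernel is missing and is accounted for by the
   constant [beta * H] of the reward, i.e. by the optimistic initial value [H]. *)
Definition gw l (k : K) (o : O) : R := (count (pred1 (k, o)) l)%:R / pcount l k.

Definition gc l xi (k : K) : R :=
  (beta * H%:R + \sum_o (count (pred1 (k, o)) l)%:R * rew o) / pcount l k
  + noise_sd l k * xi k.

Lemma pcount_gt0 l k : 0 < pcount l k.
Proof. by rewrite ltr_pwDl. Qed.

Lemma noise_sd_gt0 l k : 0 < noise_sd l k.
Proof. by rewrite divr_gt0 ?ltr0n// sqrtr_gt0 pcount_gt0. Qed.

Lemma sum_data l k (f : O -> R) :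
  \sum_(e <- l | e.1 == k) f e.2 = \sum_o (count (pred1 (k, o)) l)%:R * f o.
Proof.
elim: l => [|[k' o'] l IH] /=; first by rewrite big_nil big1// => o _; rewrite mul0r.
rewrite big_cons /= IH.
under [RHS]eq_bigr do rewrite natrD mulrDl xpair_eqE.
rewrite big_split /=; case: eqP => [_|_] /=; last first.
  by rewrite [X in _ = X + _]big1 ?add0r// => o _; rewrite mul0r.
congr (_ + _); rewrite (bigD1 o')//= eqxx mul1r big1 ?addr0// => o oo'.
by rewrite ?(eq_sym o') (negbTE oo') mul0r.
Qed.

Lemma sigma2E l k : sigma2 v lambda l k = v / pcount l k.
Proof.
have v0 : v != 0 by rewrite pnatr_eq0 expn_eq0 negb_and -lt0n H0.
have p0 : pcount l k != 0 by rewrite gt_eqF// pcount_gt0.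
rewrite /sigma2 invf_div -mulrDl invf_div//.
Qed.

Lemma sqrt_sigma2 l k : Num.sqrt (sigma2 v lambda l k) = noise_sd l k.
Proof.
rewrite sigma2E sqrtrM ?ler0n// sqrtrV ?ltW ?pcount_gt0// natrX sqrtr_sqr.
by rewrite ger0_norm.
Qed.

Lemma sum_gw_le1 l k : \sum_o gw l k o <= 1.
Proof.
rewrite -mulr_suml ler_pdivrMr ?pcount_gt0// mul1r /pcount.
rewrite [leLHS](_ : _ = (nvisits l k)%:R) ?lerDr 1?ltW//.
have := sum_post (fun _ _ => 0 : R) l k; rewrite /post [X in _ = X + _]big1// add0r => <-.
by apply: eq_bigr => o _; rewrite add0r.
Qed.

Lemma gw_ge0 l k o : 0 <= gw l k o.
Proof. by rewrite divr_ge0 ?ler0n// ltW// pcount_gt0. Qed.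

(** The choice [lambda = v / beta] gives weight [beta] to the initial guess [H] and weight 1 to each
    observed target, out of a total of [pcount]. *)
Lemma Qaux_step l xi (Qn : X -> A -> R) (V : X -> R) k :
  (forall y, maxQ a0 Qn y = V y) ->
  sigma2 v lambda l k *
    (H%:R / lambda + v^-1 * \sum_(e <- l | e.1 == k) (rew e.2 + maxQ a0 Qn e.2.2)) +
  Num.sqrt (sigma2 v lambda l k) * xi k = qstep (gc l xi) (gw l) V k.
Proof.
move=> QV.
have alg (u b h p s1 s2 : R) : u != 0 -> p != 0 -> b != 0 ->
    u / p * (h / (u / b) + u^-1 * (s1 + s2)) = (b * h + s1) / p + s2 / p.
  by move=> u0 p0 b0; field; rewrite u0 p0 b0.
rewrite (sum_data l k (fun o => rew o + maxQ a0 Qn o.2)) sqrt_sigma2 sigma2E.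
rewrite /qstep /gc addrAC; congr (_ + _).
rewrite (eq_bigr (fun o => (count (pred1 (k, o)) l)%:R * rew o +
  (count (pred1 (k, o)) l)%:R * V o.2)) => [|o _]; last by rewrite mulrDr QV.
rewrite big_split /= alg ?pnatr_eq0 ?expn_eq0 ?negb_and -?lt0n ?H0 ?gt_eqF ?pcount_gt0//.
by congr (_ + _); rewrite mulr_suml; apply: eq_bigr => o _; rewrite /gw mulrAC.
Qed.

Lemma Qaux_DP l xi d t x :
  maxQ a0 (Qaux a0 theta v lambda l xi d t) x = DP a0 (gc l xi) (gw l) d t x.
Proof.
elim: d t x => [|d IH] t x /=; first exact: maxQ0.
case: insubP => [i _ _|_]; last exact: maxQ0.
by apply: eq_maxQ => a; apply: Qaux_step => y; exact: IH.
Qed.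

Lemma Qrlsvi_qval l xi (i : 'I_H) x a :
  Qrlsvi a0 theta v lambda l xi i x a = qval a0 (gc l xi) (gw l) (i, x, a).
Proof.
rewrite /Qrlsvi /qval -(subnSK (ltn_ord i)) /=.
case: insubP => [j _ ji|]; last by rewrite ltn_ord.
have -> : j = i by apply: val_inj.
by apply: Qaux_step => y; exact: Qaux_DP.
Qed.

Lemma rlsvi_greedy l xi (i : 'I_H) x a :
  qval a0 (gc l xi) (gw l) (i, x, a) <=
  qval a0 (gc l xi) (gw l) (i, x, rlsvi_policy a0 theta v lambda l xi (i, x)).
Proof.
rewrite -!Qrlsvi_qval /rlsvi_policy ffunE /=.
by case: arg_maxP => // b _ /(_ a isT).
Qed.

End RLSVI.

Lemma subdiff_addr {R : realType} K (g : R -> R) (c : R) :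
  subdiff K g -> subdiff K (fun x => g x + c).
Proof.
move=> gK x; have [k [k0 kK kg]] := gK x; exists k; split => // y.
by rewrite addrAC lerD2r.
Qed.

(** * Stochastic optimism *)

Section ProductMarginals.
Context {d d' : measure_display} {T : measurableType d} {T' : measurableType d'} {R : realType}.
Local Open Scope classical_set_scope.
Local Open Scope ereal_scope.

Lemma integral_fst (mu : probability T R) (nu : probability T' R) (g : T -> \bar R) :
  (forall x, 0 <= g x) -> measurable_fun [set: T] g ->
  \int[mu \x nu]_p g p.1 = \int[mu]_x g x.
Proof.
move=> g0 mg.
have m1 : measurable_fun [set: T * T'] (fun p : T * T' => g p.1).
  exact: (measurableT_comp mg measurable_fst).
have e := @fubini_tonelli1 _ _ _ _ R mu nu _ m1 (fun p => g0 _).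
apply: (etrans e); apply: eq_integral => x _.
by rewrite /fubini_F /= integral_cst//= probability_setT mule1.
Qed.

Lemma integral_snd (mu : probability T R) (nu : probability T' R) (g : T' -> \bar R) :
  (forall x, 0 <= g x) -> measurable_fun [set: T'] g ->
  \int[mu \x nu]_p g p.2 = \int[nu]_x g x.
Proof.
move=> g0 mg.
have m1 : measurable_fun [set: T * T'] (fun p : T * T' => g p.2).
  exact: (measurableT_comp mg measurable_snd).
have e := @fubini_tonelli1 _ _ _ _ R mu nu _ m1 (fun p => g0 _).
apply: (etrans e); rewrite /fubini_F /= integral_cst//=.
by rewrite [X in _ * X]probability_setT mule1.
Qed.

Lemma iter_int_map {I : eqType} (mu : I -> probability T R) (nu : I -> probability T' R)
    (phi : T -> T') s (f : funSpace I T' -> \bar R) (y : funSpace I T) :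
  (forall k (g : T' -> \bar R), (forall z, 0 <= g z) -> measurable_fun [set: T'] g ->
     \int[mu k]_p g (phi p) = \int[nu k]_z g z) ->
  (forall y, 0 <= f y) -> measurable_fun [set: funSpace I T'] f ->
  iter_int mu s (fun w => f (phi \o w)) y = iter_int nu s f (phi \o y).
Proof.
move=> munu f0 mf; elim: s y => //= i s IH y.
rewrite -munu; last 2 first.
- by move=> z; exact: iter_int_ge0.
- exact: (measurableT_comp (measurable_iter_int nu s f f0 mf) (measurable_updr i _)).
apply: eq_integral => p _; rewrite IH; congr iter_int.
by apply/funext => j; rewrite /upd /=; case: eqP.
Qed.

End ProductMarginals.

Section Optimism.
Context {R : realType} {X A : finType} (a0 : A) {H : nat} (beta : R) (x0 : outcome X).
Hypothesis (H0 : (0 < H)%N) (beta0 : 0 < beta).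
Local Notation K := (sa_index X A H).
Local Notation O := (outcome X).
Local Notation Q := (funSpace O (measurableTypeR R)).
Local Notation T := (Q * measurableTypeR R)%type.
Local Notation N01 := (@normal_prob R 0 1 : probability (measurableTypeR R) R).
Variables (alpha : K -> O -> R) (l : data X A H) (B : R).
Hypothesis (alpha0 : pos_params alpha) (alphab : forall k, \sum_o alpha k o = beta).
Hypothesis B0 : 0 <= B.
Local Open Scope classical_set_scope.
Implicit Types (S : seq K) (w : funSpace K T).

(* Indices in [S] already carry the RLSVI targets, the others the posterior. *)
Definition hybrid_c S (w : K -> T) (k : K) : R :=
  if k \in S then gc beta l (fun k => (w k).2) k else mean_rew (fun k => retr (w k).1) k.

Definition hybrid_w S (w : K -> T) (k : K) : O -> R :=
  if k \in S then gw beta l k else retr (w k).1.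

(* Truncating at [- B] and shifting makes the integrand nonnegative, so that no
   integrability has to be checked. *)
Definition hybrid S x (w : K -> T) : R :=
  Num.max (DP a0 (hybrid_c S w) (hybrid_w S w) H 0 x) (- B) + B.

(** The random row and the noise of an index live on one space, so that replacing one by the other
    changes the integrand only. *)
Definition joint (k : K) : probability T R := (dirD x0 (post alpha l k) \x N01)%E.

Lemma hybrid_ge0 S x w : 0 <= hybrid S x w.
Proof. by rewrite /hybrid -lerBlDr sub0r le_max lexx orbT. Qed.

Lemma measurable_hybrid S x : measurable_fun [set: funSpace K T] (hybrid S x).
Proof.
have m1 (k : K) : measurable_fun [set: funSpace K T] (fun w : funSpace K T => retr (w k).1 : Q).
  apply: (measurableT_comp measurable_retr).
  exact: (measurableT_comp measurable_fst (measurable_coord k)).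
have m1o (k : K) (o : O) : measurable_fun [set: funSpace K T] (fun w : funSpace K T => retr (w k).1 o).
  exact: (measurableT_comp (measurable_coord o) (m1 k)).
apply: measurable_funD => //; apply: measurable_maxr => //.
apply: measurable_DP => [k|k o].
- rewrite /hybrid_c; case: (k \in S).
    apply: measurable_funD => //; apply: measurable_funM => //.
    exact: (measurableT_comp measurable_snd (measurable_coord k)).
  apply: measurable_sum => o; exact: measurable_funM.
- rewrite /hybrid_w; case: (k \in S); [exact: measurable_cst|exact: m1o].
Qed.

Lemma hybrid_w_ge0 S w k o : 0 <= hybrid_w S w k o.
Proof.
rewrite /hybrid_w; case: ifP => _; first exact: gw_ge0.
by have /andP[/forallP q0 _] := simplex_retr x0 (w k).1; exact: ltW.
Qed.

Lemma hybrid_w_le1 S w k : \sum_o hybrid_w S w k o <= 1.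
Proof.
rewrite /hybrid_w; case: ifP => _; first exact: sum_gw_le1.
by have /andP[_ /eqP ->] := simplex_retr x0 (w k).1.
Qed.

(** With the other coordinates fixed, both sides are expectations of one function [G] of the value
    of row [k]. Indices of later periods are outside [S], so the continuation [V] is a value in a
    stochastic model and [f] has values in [[0, H]]; [dir_int_gauss_le] with [c = H] compares the
    Dirichlet average of [f] with a normal variable of deviation [noise_sd]. *)
Lemma hybrid_step S x k w : k \notin S -> (forall k', k' \in S -> (k'.1.1 <= k.1.1)%N) ->
  (\int[joint k]_p (hybrid S x (upd w k p))%:E <=
   \int[joint k]_p (hybrid (rcons S k) x (upd w k p))%:E)%E.
Proof.
move=> kS Sk.
pose P := fun k => retr (w k).1.
have P0 k' o : 0 <= P k' o.
  by have /andP[/forallP q0 _] := simplex_retr x0 (w k').1; exact: (ltW (q0 o)).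
have P1 k' : \sum_o P k' o = 1 by have /andP[_ /eqP] := simplex_retr x0 (w k').1.
pose V y := DP a0 (mean_rew P) P (H - k.1.1.+1) k.1.1.+1 y.
pose f (o : O) : R := rew o + V o.2.
have fH o : 0 <= f o <= H%:R.
  have /andP[v0 v1] := DP_itv a0 P (H - k.1.1.+1) k.1.1.+1 o.2 P0 (fun k _ => P1 k).
  have /andP[r0 r1] := @rew_itv R X o.
  rewrite /f addr_ge0//= (le_trans (lerD r1 v1))// nat1r ler_nat.
  by rewrite subnSK// leq_subr.
pose G y := Num.max (DP a0 (upd (hybrid_c S w) k y) (upd (hybrid_w S w) k (fun=> 0)) H 0 x)
   (- B) + B.
have GK : subdiff 1 G.
  apply: subdiff_addr; apply: subdiff_max; last exact: subdiff_cst.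
  by apply: DP_subdiff; [exact: hybrid_w_ge0|exact: hybrid_w_le1].
have G0 y : 0 <= G y by rewrite /G -lerBlDr sub0r le_max lexx orbT.
have mG := subdiff_measurable _ _ GK.
have cE S' p y : (forall j, j != k -> (j \in S') = (j \in S)) ->
    upd (hybrid_c S' (upd w k p)) k y = upd (hybrid_c S w) k y.
  move=> S'S; apply/funext => j; rewrite /upd; case: eqP => // /eqP jk.
  rewrite /hybrid_c S'S// /gc /mean_rew (negbTE jk).
  by [].
have wE S' p : (forall j, j != k -> (j \in S') = (j \in S)) ->
    upd (hybrid_w S' (upd w k p)) k (fun=> 0) = upd (hybrid_w S w) k (fun=> 0).
  move=> S'S; apply/funext => j; rewrite /upd; case: eqP => // /eqP jk.
  by rewrite /hybrid_w S'S// (negbTE jk).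
have hE S' p : (forall j, j != k -> (j \in S') = (j \in S)) ->
    hybrid S' x (upd w k p) =
    G (qval a0 (hybrid_c S' (upd w k p)) (hybrid_w S' (upd w k p)) k).
  by move=> S'S; rewrite /hybrid (DP_override a0 _ _ k) ?addn0// cE// wE.
have VE S' p y : (forall j, j != k -> (j \in S') = (j \in S)) ->
    DP a0 (hybrid_c S' (upd w k p)) (hybrid_w S' (upd w k p)) (H - k.1.1.+1) k.1.1.+1 y = V y.
  move=> S'S; apply: eq_DP => j kj.
  have jk : j != k by apply: contraTneq kj => ->; rewrite ltnn.
  have jS : (j \in S) = false.
    by apply/negbTE; apply: contraTN kj => /Sk jk'; rewrite -leqNgt.
  by rewrite /hybrid_c /hybrid_w S'S// jS /mean_rew /P /upd (negbTE jk).
have hS p : hybrid S x (upd w k p) = G (\sum_o retr p.1 o * f o).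
  rewrite hE//; congr G; rewrite /qval /qstep {1}/hybrid_c {1}/hybrid_w (negbTE kS).
  rewrite /mean_rew upd_same -big_split /=; apply: eq_bigr => o _.
  by rewrite VE// -mulrDr.
set m := dmean (post alpha l k) f.
have sp : \sum_o post alpha l k o = pcount beta l k by rewrite sum_post alphab.
have pc0 : 0 < pcount beta l k by exact: pcount_gt0.
(* Centre of the RLSVI target. The prior mass [beta] is credited with [H], at least [f], so the
   centre is at least the posterior mean [m]. *)
pose c0 := (beta * H%:R + \sum_o (count (pred1 (k, o)) l)%:R * f o) / pcount beta l k.
have mc0 : m <= c0.
  rewrite /m /dmean sp; apply: ler_wpM2r; first by rewrite invr_ge0 ltW.
  rewrite /post; under eq_bigr do rewrite mulrDl.
  rewrite big_split /= lerD2r -(alphab k) mulr_suml ler_sum// => o _.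
  by rewrite ler_wpM2l ?(ltW (alpha0 k o))//; case/andP: (fH o).
have hSk p : hybrid (rcons S k) x (upd w k p) = G (c0 + noise_sd beta l k * p.2).
  have S'S j : j != k -> (j \in rcons S k) = (j \in S) by rewrite mem_rcons inE => /negbTE ->.
  rewrite hE//; congr G; rewrite /qval /qstep {1}/hybrid_c {1}/hybrid_w mem_rcons inE eqxx /=.
  rewrite /gc upd_same addrAC; congr (_ + _).
  rewrite /c0 /f [in RHS](eq_bigr (fun o => (count (pred1 (k, o)) l)%:R * rew o +
     (count (pred1 (k, o)) l)%:R * V o.2)) => [|o _]; last by rewrite mulrDr.
  rewrite big_split /= addrA [RHS]mulrDl; congr (_ + _).
  rewrite mulr_suml; apply: eq_bigr => o _; rewrite VE//.
  by rewrite /gw mulrAC.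
have mS : measurable_fun [set: Q] (fun q : Q => \sum_o q o * f o).
  by apply: measurable_sum => o; apply: measurable_funM => //; exact: measurable_coord.
have mGS : measurable_fun [set: Q] (fun q : Q => (G (\sum_o q o * f o))%:E).
  by apply/measurable_EFinP; exact: (measurableT_comp mG mS).
have mGSr : measurable_fun [set: Q] (fun q : Q => (G (\sum_o retr q o * f o))%:E).
  exact: (measurableT_comp mGS measurable_retr).
have mGc : measurable_fun [set: measurableTypeR R]
    (fun z : measurableTypeR R => (G (c0 + noise_sd beta l k * z))%:E).
  apply/measurable_EFinP; apply: (measurableT_comp mG).
  by apply: measurable_funD => //; exact: measurable_funM.
under eq_integral do rewrite hS.
under [X in (_ <= X)%E]eq_integral do rewrite hSk.
rewrite /joint.
have e1 := integral_fst (dirD x0 (post alpha l k)) N01 (fun q => (G (\sum_o retr q o * f o))%:E)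
  (fun q => _) mGSr.
have e2 := integral_snd (dirD x0 (post alpha l k)) N01
  (fun z => (G (c0 + noise_sd beta l k * z))%:E) (fun q => _) mGc.
have {}e1 := e1 (fun q => G0 _).
have {}e2 := e2 (fun q => G0 _).
rewrite [X in (X <= _)%E]e1 [X in (_ <= X)%E]e2.
have HR : 0 < H%:R :> R by rewrite ltr0n.
have opt := dir_int_gauss_le x0 1 G H%:R (post alpha l k) f GK HR (post_gt0 alpha l alpha0 k) fH.
have GG q : simplex q -> (0 <= (G (\sum_o q o * f o) - G 0)%:E)%E.
  move=> /andP[/forallP q0 _]; rewrite lee_fin subr_ge0; apply: (subdiff_mono _ _ _ _ GK).
  by apply: sumr_ge0 => o _; rewrite mulr_ge0 ?(ltW (q0 o))//; case/andP: (fH o).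
have mGG : measurable_fun [set: Q] (fun q : Q => (G (\sum_o q o * f o) - G 0)%:E).
  apply/measurable_EFinP; apply: measurable_funB => //; exact: (measurableT_comp mG mS).
rewrite (dir_int_retr x0 (post alpha l k) (fun q => (G (\sum_o q o * f o) - G 0)%:E)) in opt;
  [|exact: post_gt0|exact: GG|exact: mGG].
have mGGr : measurable_fun [set: Q] (fun q : Q => (G (\sum_o retr q o * f o) - G 0)%:E).
  exact: (measurableT_comp mGG measurable_retr).
have R2 : (\int[N01]_z (G (c0 + noise_sd beta l k * z))%:E =
    (gauss_mix G c0 (noise_sd beta l k))%:E)%E.
  rewrite /gauss_mix /Rintegral fineK//; apply: integrable_fin_num => //.
  exact: (subdiff_integrable 1 G c0 (noise_sd beta l k) GK).
have L2 : (\int[dirD x0 (post alpha l k)]_q (G (\sum_o retr q o * f o))%:E =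
    \int[dirD x0 (post alpha l k)]_q (G (\sum_o retr q o * f o) - G 0)%:E + (G 0)%:E)%E.
  have <- : (\int[dirD x0 (post alpha l k)]_q (cst (G 0)%:E) q = (G 0)%:E)%E.
    by rewrite integral_cst//= probability_setT mule1.
  rewrite -ge0_integralD; [|by []|by move=> q _; apply: GG; exact: simplex_retr|exact: mGGr
    |by move=> q _; rewrite lee_fin|exact: measurable_cst].
  by apply: eq_integral => q _; rewrite /= -EFinD subrK.
have opt2 := le_trans (leeD2r (G 0)%:E opt) (lexx _).
rewrite R2 L2; apply: (le_trans opt2).
rewrite -EFinD lee_fin subrK /dir_gauss sp -/m.
exact: (gauss_mix_mono 1).
Qed.

Lemma hybrid_mono x s1 s2 : uniq (s1 ++ s2) ->
  pairwise (fun k k' : K => k.1.1 <= k'.1.1)%N (s1 ++ s2) ->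
  (iter_int joint (enum {: K}) (fun w => (hybrid s1 x w)%:E) (fun _ => (fun=> 0, 0)%R) <=
   iter_int joint (enum {: K}) (fun w => (hybrid (s1 ++ s2) x w)%:E) (fun _ => (fun=> 0, 0)%R))%E.
Proof.
elim: s2 s1 => [|k s2 IH] s1; first by rewrite cats0.
move=> us ps; rewrite -cat_rcons; apply: le_trans (IH (rcons s1 k) _ _); last 2 first.
- by rewrite cat_rcons.
- by rewrite cat_rcons.
have mh S : measurable_fun [set: funSpace K T] (fun w => (hybrid S x w)%:E).
  by apply/measurable_EFinP; exact: measurable_hybrid.
have h0 S w : (0 <= (hybrid S x w)%:E)%E by rewrite lee_fin hybrid_ge0.
have kK : k \in enum {: K} by rewrite mem_enum.
rewrite (iter_int_resample joint (enum {: K}) (fun w => (hybrid s1 x w)%:E) _ k)//; last exact: enum_uniq.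
rewrite (iter_int_resample joint (enum {: K}) (fun w => (hybrid (rcons s1 k) x w)%:E) _ k)//;
  last exact: enum_uniq.
have mu S : measurable_fun [set: funSpace K T]
    (fun w => \int[joint k]_p (hybrid S x (upd w k p))%:E)%E.
  have mc := measurableT_comp (mh S) (measurable_upd k).
  exact: (measurable_fun_fubini_tonelli_F _ mc (fun=> h0 _ _)).
apply: le_iter_int => [w|//|w|//|w].
- by apply: integral_ge0 => p _; exact: h0.
- by apply: integral_ge0 => p _; exact: h0.
apply: hybrid_step.
  by move: us; rewrite cat_uniq /= negb_or => /and3P[_ /andP[]].
move: ps; rewrite pairwise_cat => /and3P[/allrelP rs _ _] k' k's.
by apply: rs => //; rewrite mem_head.
Qed.

Local Notation M := (funSpace K Q).

Lemma bm_DP x : bm (fun P : M => DP a0 (mean_rew P) P H 0 x).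
Proof.
split.
  apply: measurable_DP => [k|k o].
    apply: measurable_sum => o; apply: measurable_funM => //.
    exact: (measurableT_comp (measurable_coord o) (measurable_coord k)).
  exact: (measurableT_comp (measurable_coord o) (measurable_coord k)).
exists H%:R => P lP; have /andP[h0 h1] : 0 <= DP a0 (mean_rew P) P H 0 x <= H%:R.
  apply: DP_itv => [k o|k _].
    by have /andP[/forallP P0 _] := lP k; exact: (ltW (P0 o)).
  by have /andP[_ /eqP] := lP k.
by rewrite ger0_norm.
Qed.

Lemma optimism x :
  ((Er x0 (post alpha l) (fun P => DP a0 (mean_rew P) P H 0 x) + B)%:E <=
   gauss_int (fun xi : K -> R => (Num.max (DP a0 (gc beta l xi) (gw beta l) H 0 x) (- B) + B)%:E))%E.
Proof.
pose r (k k' : K) := (k.1.1 <= k'.1.1)%N.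
pose s := sort r (enum {: K}).
have us : uniq s by rewrite sort_uniq enum_uniq.
have ps : pairwise r s.
  rewrite -sorted_pairwise; last by move=> k1 k2 k3; exact: leq_trans.
  by apply: sort_sorted => k1 k2; exact: leq_total.
have := hybrid_mono x [::] s us ps; rewrite cat0s.
have bDP := bm_DP x.
have DP0 (P : M) : legit P -> 0 <= DP a0 (mean_rew P) P H 0 x.
  move=> lP; suff /andP[] : 0 <= DP a0 (mean_rew P) P H 0 x <= H%:R by [].
  apply: DP_itv => [k o|k _].
    by have /andP[/forallP P0 _] := lP k; exact: (ltW (P0 o)).
  by have /andP[_ /eqP] := lP k.
have -> : Er x0 (post alpha l) (fun P => DP a0 (mean_rew P) P H 0 x) + B =
    Er x0 (post alpha l) (fun P => DP a0 (mean_rew P) P H 0 x + B).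
  by rewrite Er_add ?Er_cst//; exact: bm_cst.
have bDPB : bm (fun P : M => DP a0 (mean_rew P) P H 0 x + B) by apply: bm_add => //; exact: bm_cst.
rewrite Er_iter//; last by move=> P lP; rewrite addr_ge0// DP0.
have lR P := @legit_retrM R X A H x0 P.
have m1 : measurable_fun [set: M] (fun P : M => (DP a0 (mean_rew (retrM P)) (retrM P) H 0 x + B)%:E).
  by apply/measurable_EFinP; exact: (measurableT_comp bDPB.1 measurable_retrM).
have -> : iter_int (fun k => dirD x0 (post alpha l k)) (enum {: K})
     (fun P : M => (DP a0 (mean_rew (retrM P)) (retrM P) H 0 x + B)%:E) zeroM =
   iter_int joint (enum {: K}) (fun w => (hybrid [::] x w)%:E) (fun _ => (fun=> 0, 0)).
  rewrite -(@iter_int_map _ _ _ _ R _ joint (fun k => dirD x0 (post alpha l k)) fst (enum {: K})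
    (fun P : M => (DP a0 (mean_rew (retrM P)) (retrM P) H 0 x + B)%:E) (fun _ => (fun=> 0, 0))).
  - apply: eq_iter_int => w _; rewrite /hybrid; congr (_ + _)%:E.
    (* On the posterior side the value is nonnegative, so the truncation at [- B] is inactive. *)
    by rewrite max_l// (le_trans _ (DP0 _ (lR _)))// oppr_le0.
  - by move=> k g g0 mg; exact: (integral_fst (dirD x0 (post alpha l k)) N01 g g0 mg).
  - by move=> P; rewrite lee_fin addr_ge0// DP0.
  - exact: m1.
move=> h; apply: (le_trans h).
have m2 : measurable_fun [set: funSpace K (measurableTypeR R)]
    (fun xi : funSpace K (measurableTypeR R) => (Num.max (DP a0 (gc beta l xi) (gw beta l) H 0 x) (- B) + B)%:E).
  apply/measurable_EFinP; apply: measurable_funD => //; apply: measurable_maxr => //.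
  apply: measurable_DP => [k|k o]; last exact: measurable_cst.
  apply: measurable_funD => //; apply: measurable_funM => //; exact: measurable_coord.
have g2 (xi : K -> R) : (0 <= (Num.max (DP a0 (gc beta l xi) (gw beta l) H 0 x) (- B) + B)%:E)%E.
  by rewrite lee_fin -lerBlDr sub0r le_max lexx orbT.
rewrite gauss_intE//.
rewrite -(@iter_int_map _ _ _ _ R _ joint gauss_measures snd (enum {: K})
    (fun xi : funSpace K (measurableTypeR R) => (Num.max (DP a0 (gc beta l xi) (gw beta l) H 0 x) (- B) + B)%:E)
    (fun _ => (fun=> 0, 0))).
- rewrite le_eqVlt; apply/orP; left; apply/eqP.
  apply: eq_iter_int => w _; rewrite /hybrid; congr (Num.max _ _ + _)%:E.
  by apply: eq_DP => k _; rewrite /hybrid_c /hybrid_w mem_sort mem_enum.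
- by move=> k g g0 mg; exact: (integral_snd (dirD x0 (post alpha l k)) N01 g g0 mg).
- exact: g2.
- exact: m2.
Qed.

End Optimism.

Lemma pathsum_ge0 {R : realType} {X A : finType} {H : nat} (P : sa_index X A H -> outcome X -> R)
    (pi : policy X A H) d t x (F : data X A H -> R) :
  (forall k o, 0 <= P k o) -> (forall l, 0 <= F l) -> 0 <= pathsum P pi d t x F.
Proof.
move=> P0; elim: d t x F => [|d IH] t x F F0 /=; first exact: F0.
case: insubP => [i _ _|_]; last exact: F0.
by apply: sumr_ge0 => o _; rewrite mulr_ge0//; exact: IH.
Qed.

Lemma prior_int_eq {R : realType} {X A : finType} {H : nat} (x0 : outcome X)
    (alpha : sa_index X A H -> outcome X -> R) (f g : model X A H -> \bar R) :
  (forall P, legit P -> f P = g P) ->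
  prior_int alpha (enum {: sa_index X A H}) f (fun _ _ => 0) =
  prior_int alpha (enum {: sa_index X A H}) g (fun _ _ => 0).
Proof.
move=> fg; have key s P : (forall k, k \notin s -> simplex (P k)) ->
    prior_int alpha s f P = prior_int alpha s g P.
  elim: s P => [|k s IH] P Ps /=; first by apply: fg => k; exact: Ps.
  apply: (eq_dir_int x0) => q sq; apply: IH => j js; rewrite /upd.
  by case: eqP => // /eqP jk; apply: Ps; rewrite inE negb_or jk.
by apply: key => k; rewrite mem_enum.
Qed.

(** * Regret as an expectation over the prior *)

Section FiniteValued.
Context {d : measure_display} {T : measurableType d} {R : realType} {I : finType}.
Local Open Scope classical_set_scope.
Variables (P : probability T R) (f : T -> I).
Hypothesis mf : forall i, measurable_fun [set: T] (fun x => f x == i).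

Definition fin_weight (i : I) : R := fine (\int[P]_x ((f x == i)%:R : R)%:E)%E.

Lemma measurable_indic_eq i : measurable_fun [set: T] (fun x => ((f x == i)%:R : R)%:E).
Proof.
apply/measurable_EFinP.
rewrite [X in measurable_fun _ X](_ : _ = fun x => if f x == i then 1 else 0 : R).
  by apply: measurable_fun_ifT => //; exact: mf.
by apply/funext => x; case: (f x == i).
Qed.

Lemma fin_weightE i : (\int[P]_x ((f x == i)%:R : R)%:E)%E = (fin_weight i)%:E.
Proof.
have I0 : (0 <= \int[P]_x ((f x == i)%:R : R)%:E)%E.
  by apply: integral_ge0 => x _; rewrite lee_fin ler0n.
rewrite /fin_weight fineK// ge0_fin_numE//.
apply: (@le_lt_trans _ _ (\int[P]_x (cst 1%E) x)%E); last first.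
  by rewrite integral_cst//= probability_setT mule1 ltry.
apply: ge0_le_integral; [by []|by move=> x _; rewrite lee_fin ler0n|
  exact: measurable_indic_eq|exact: measurable_cst|].
by move=> x _; rewrite lee_fin; case: (f x == i).
Qed.

Lemma fin_weight_ge0 i : 0 <= fin_weight i.
Proof.
by rewrite -lee_fin -fin_weightE; apply: integral_ge0 => x _; rewrite lee_fin ler0n.
Qed.

Lemma fin_valued_sum (h : I -> R) x : h (f x) = \sum_i h i * (f x == i)%:R.
Proof.
rewrite (bigD1 (f x))//= eqxx mulr1 big1 ?addr0// => i ifx.
by rewrite eq_sym (negbTE ifx) mulr0.
Qed.

Lemma measurable_fin_valued (h : I -> R) : measurable_fun [set: T] (fun x => h (f x)).
Proof.
under eq_fun do rewrite fin_valued_sum.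
apply: measurable_sum => i; apply: measurable_funM => //.
exact/measurable_EFinP/measurable_indic_eq.
Qed.

Lemma integral_fin_valued (h : I -> R) : (forall i, 0 <= h i) ->
  (\int[P]_x (h (f x))%:E = (\sum_i fin_weight i * h i)%:E)%E.
Proof.
move=> h0; transitivity (\int[P]_x (\sum_(i <- index_enum I) (h i)%:E * ((f x == i)%:R : R)%:E))%E.
  by apply: eq_integral => x _; rewrite fin_valued_sum -sumEFin.
rewrite ge0_integral_sum//; last 2 first.
- by move=> i; apply: emeasurable_funM => //; exact: measurable_indic_eq.
- by move=> i x _; rewrite mule_ge0// lee_fin.
rewrite -sumEFin; apply: eq_bigr => i _.
rewrite ge0_integralZl_EFin; [|by []|by move=> x _; rewrite lee_fin ler0n|
  exact: measurable_indic_eq|exact: h0].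
by rewrite fin_weightE -EFinM mulrC.
Qed.

Lemma fin_weight_sum : \sum_i fin_weight i = 1.
Proof.
apply: EFin_inj; rewrite -[X in X%:E](_ : \sum_i fin_weight i * (fun=> 1) i = _).
  by rewrite -integral_fin_valued// integral_cst//= probability_setT mule1.
by apply: eq_bigr => i _; rewrite mulr1.
Qed.

End FiniteValued.

Section ArgMaxMeasurable.
Context {d : measure_display} {T : measurableType d} {R : realType} {A : finType} (a0 : A).
Local Open Scope classical_set_scope.

Lemma measurable_forallb {J : finType} (b : J -> T -> bool) :
  (forall j, measurable_fun [set: T] (b j)) ->
  measurable_fun [set: T] (fun x => [forall j, b j x]).
Proof.
move=> mb; have := measurable_big_andb (index_enum J) b mb.
by congr measurable_fun; apply/funext => x; rewrite big_andE.
Qed.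

(** [arg max] picks the first maximiser in the enumeration, so its preimages are built from finitely
    many comparisons. *)
Lemma measurable_arg_max (q : T -> A -> R) (a : A) :
  (forall a, measurable_fun [set: T] (q ^~ a)) ->
  measurable_fun [set: T] (fun x => [arg max_(b > a0) q x b]%O == a).
Proof.
move=> mq.
pose p x b := [forall j, q x j <= q x b].
have mp b : measurable_fun [set: T] (p ^~ b).
  by apply: (measurable_forallb (fun j x => q x j <= q x b)) => j; exact: measurable_fun_ler.
have e x : [arg max_(b > a0) q x b]%O = odflt a0 (ohead [seq b <- Finite.enum A | p x b]).
  by rewrite /Order.arg_max /extremum /pick; congr (odflt _ (ohead _)).
under eq_fun do rewrite e.
elim: (Finite.enum A) => [|b s IH] /=; first exact: measurable_cst.
have := @measurable_fun_ifT _ _ _ _ (fun=> b == a) _ _ (mp b) (measurable_cst _) IH.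
by congr measurable_fun; apply/funext => x; case: (p x b).
Qed.

End ArgMaxMeasurable.

Section GaussMeasure.
Context {R : realType} {I : finType}.
Local Open Scope classical_set_scope.
Local Notation G := (funSpace I (measurableTypeR R)).

Definition gammaM : probability G R :=
  sval (cid (iter_int_measure (@gauss_measures R I) (enum I) (fun _ => 0) (enum_uniq I))).

Lemma gammaME (f : G -> \bar R) : (forall y, 0 <= f y)%E -> measurable_fun [set: G] f ->
  gauss_int f = (\int[gammaM]_xi f xi)%E.
Proof. by move=> f0 mf; rewrite gauss_intE// /gammaM; case: cid => Pi /= ->. Qed.

Lemma gammaM_coord (phi : R -> \bar R) (k : I) (c : R) : (forall z, 0 <= phi z)%E ->
  measurable_fun [set: R] phi -> (\int[@normal_prob R 0 1]_z phi z)%E = c%:E ->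
  (\int[gammaM]_xi phi (xi k))%E = c%:E.
Proof.
move=> phi0 mphi phic; rewrite -gammaME//.
  rewrite gauss_intE//; last exact: (measurableT_comp mphi (measurable_coord k)).
  by apply: iter_int_coord => //; [exact: enum_uniq|rewrite mem_enum].
exact: (measurableT_comp mphi (measurable_coord k)).
Qed.

End GaussMeasure.

Section RegretRecursion.
Context {R : realType} {X A : finType} (a0 : A) {H : nat} (beta : R).
Hypothesis (H0 : (0 < H)%N) (beta0 : 0 < beta).
Local Notation K := (sa_index X A H).
Local Notation O := (outcome X).
Local Notation v := ((H ^ 2)%:R : R).
Local Notation lambda := (v / beta).
Local Notation theta := (fun _ : K => H%:R : R).
Local Notation G := (funSpace K (measurableTypeR R)).
Local Notation M := (funSpace K (funSpace O (measurableTypeR R))).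
Local Open Scope classical_set_scope.
Variable rho : X -> R.
Hypothesis rho0 : forall x, 0 <= rho x.
Implicit Types (l : data X A H).

Definition greedy l (xi : G) : policy X A H := rlsvi_policy a0 theta v lambda l xi.

Lemma measurable_greedy l pi : measurable_fun [set: G] (fun xi => greedy l xi == pi).
Proof.
have e (xi : G) : (greedy l xi == pi) = [forall tx : 'I_H * X,
    [arg max_(a > a0) qval a0 (gc beta l xi) (gw beta l) (tx.1, tx.2, a)]%O == pi tx].
  apply/eqP/forallP => [<- tx|h].
    rewrite /greedy /rlsvi_policy ffunE; apply/eqP; congr Order.arg_max.
    by apply/funext => a; rewrite Qrlsvi_qval.
  apply/ffunP => tx; rewrite /greedy /rlsvi_policy ffunE -(eqP (h tx)).
  by congr Order.arg_max; apply/funext => a; rewrite Qrlsvi_qval.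
suff : measurable_fun [set: G] (fun xi : G => [forall tx : 'I_H * X,
    [arg max_(a > a0) qval a0 (gc beta l xi) (gw beta l) (tx.1, tx.2, a)]%O == pi tx]).
  by congr measurable_fun; apply/funext => xi; rewrite e.
apply: (measurable_forallb (fun (tx : 'I_H * X) (xi : G) =>
   [arg max_(a > a0) qval a0 (gc beta l xi) (gw beta l) (tx.1, tx.2, a)]%O == pi tx)) => tx.
apply: measurable_arg_max => a; rewrite /qval /qstep.
have mgc k : measurable_fun [set: G] (fun xi : G => gc beta l xi k).
  by apply: measurable_funD => //; apply: measurable_funM => //; exact: measurable_coord.
apply: measurable_funD => //; apply: measurable_sum => o; apply: measurable_funM => //.
by apply: measurable_DP => [k|k o'] //; exact: measurable_cst.
Qed.

Definition pol_weight l (pi : policy X A H) : R := fin_weight gammaM (greedy l) pi.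

(** Real-valued form of [Wreg]: the noise of an episode acts only through the policy it selects, one
    of finitely many, so the Gaussian integral becomes a finite sum. *)
Fixpoint Wr (P : K -> O -> R) (m : nat) l : R :=
  if m is m'.+1 then
    \sum_pi pol_weight l pi *
      (\sum_x rho x * (Vstar a0 P x - Vpi P pi x) +
       \sum_x rho x * pathsum P pi H 0 x (fun l' => Wr P m' (l ++ l')))
  else 0.

Lemma Wr_ge0 (P : K -> O -> R) m l : (forall k o, 0 <= P k o) -> 0 <= Wr P m l.
Proof.
move=> P0; elim: m l => [//|m IH] l /=; apply: sumr_ge0 => pi _.
rewrite mulr_ge0 ?fin_weight_ge0//.
- exact: measurable_greedy.
- apply: addr_ge0; apply: sumr_ge0 => x _; rewrite mulr_ge0// ?subr_ge0 ?Vstar_ge//.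
  by apply: pathsum_ge0.
Qed.

Lemma bm_Wr m l : bm (fun P : M => Wr P m l).
Proof.
elim: m l => [|m IH] l /=; first exact: bm_cst.
apply: bm_sum => pi; apply: bm_scale; apply: bm_add; apply: bm_sum => x; apply: bm_scale.
  by apply: bm_sub; [exact: bm_Vstar|exact: bm_Vpi].
by apply: (bm_pathsum pi H 0 x (fun P l' => Wr P m (l ++ l'))).
Qed.

Lemma Wreg_Wr (P : K -> O -> R) m l : (forall k o, 0 <= P k o) ->
  Wreg a0 rho theta v lambda P m l = (Wr P m l)%:E.
Proof.
move=> P0; elim: m l => [//|m IH] l.
pose h (pi : policy X A H) : R := \sum_x rho x * (Vstar a0 P x - Vpi P pi x) +
       \sum_x rho x * pathsum P pi H 0 x (fun l' => Wr P m (l ++ l')).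
have h0 pi : 0 <= h pi.
  apply: addr_ge0; apply: sumr_ge0 => x _; rewrite mulr_ge0// ?subr_ge0 ?Vstar_ge//.
  by apply: pathsum_ge0 => // l'; exact: Wr_ge0.
transitivity (gauss_int (fun xi : K -> R => (h (greedy l xi))%:E)).
  rewrite /=; congr gauss_int; apply/funext => xi; rewrite -/(greedy l xi) EFinD; congr (_ + _)%E.
  rewrite -sumEFin; apply: eq_bigr => x _.
  rewrite -(sum_traj rho P _ x (fun l' => Wr P m (l ++ l'))) -sumEFin.
  by apply: eq_bigr => os _; rewrite IH -EFinM.
rewrite gammaME; last 2 first.
- by move=> xi; rewrite lee_fin.
- by apply/measurable_EFinP; apply: measurable_fin_valued => pi; exact: measurable_greedy.
by rewrite integral_fin_valued//; exact: measurable_greedy.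
Qed.

Lemma sum_pol_weight l : \sum_pi pol_weight l pi = 1.
Proof. by apply: fin_weight_sum; exact: measurable_greedy. Qed.

Lemma pol_weight_ge0 l pi : 0 <= pol_weight l pi.
Proof. by apply: fin_weight_ge0; exact: measurable_greedy. Qed.

Lemma gamma_greedy l (h : policy X A H -> R) : (forall pi, 0 <= h pi) ->
  (\int[gammaM]_xi (h (greedy l xi))%:E = (\sum_pi pol_weight l pi * h pi)%:E)%E.
Proof. by move=> h0; apply: integral_fin_valued => //; exact: measurable_greedy. Qed.

Lemma measurable_greedy_fun l (h : policy X A H -> R) :
  measurable_fun [set: G] (fun xi => h (greedy l xi)).
Proof. by apply: measurable_fin_valued => pi; exact: measurable_greedy. Qed.

Lemma BayesRegret_Er (x0 : O) (alpha : K -> O -> R) L : pos_params alpha ->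
  BayesRegret a0 rho alpha theta v lambda L = (Er x0 alpha (fun P => Wr P L [::]))%:E.
Proof.
move=> a_gt0.
have P0 (P : M) : legit P -> forall k o, 0 <= P k o.
  by move=> lP k o; have /andP[/forallP h _] := lP k; exact: (ltW (h o)).
rewrite -(prior_int_Er x0)//; last 2 first.
- exact: bm_Wr.
- by move=> P lP; apply: Wr_ge0; exact: P0.
rewrite /BayesRegret; apply: (prior_int_eq x0) => // P lP.
by rewrite Wreg_Wr//; exact: P0.
Qed.

End RegretRecursion.

(** * Regret of one episode and its summation *)

Section PerformanceDifference.
Context {R : realType} {X A : finType} (a0 : A) {H : nat}.
Local Notation K := (sa_index X A H).
Local Notation O := (outcome X).
Local Notation D := (data X A H).
Variables (c : K -> R) (w P : K -> O -> R) (pi : policy X A H) (g : K -> R) (bt : nat -> R).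
Hypothesis P0 : forall k o, 0 <= P k o.
Hypothesis P1 : forall k, \sum_o P k o = 1.
Hypothesis greedy_pi : forall i x a, qval a0 c w (i, x, a) <= qval a0 c w (i, x, pi (i, x)).
Hypothesis bellman_gap : forall k : K,
  qval a0 c w k - \sum_o P k o * (rew o + DP a0 c w (H - k.1.1.+1) k.1.1.+1 o.2) <=
  g k + bt k.1.1.

Definition levels (l : D) : seq nat := [seq val e.1.1.1 | e <- l].

(** [F] stands for the regret of the later episodes. Its hypothesis pays back [g] along the path, so
    these gaps cancel path by path, before any averaging; [bt] is charged once per period whatever
    the path, and leaves a sum independent of it. *)
Lemma perf_diff d t x (F : D -> R) C : (d + t = H)%N ->
  (forall l, levels l = iota t d -> F l <= C - \sum_(e <- l) g e.1) ->
  DP a0 c w d t x - Vpi_aux P pi d t x + pathsum P pi d t x F <=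
  C + \sum_(t <= s < t + d) bt s.
Proof.
elim: d t x F C => [|d IH] t x F C dt FC.
  rewrite /= subr0 add0r addn0 big_geq// addr0.
  by apply: le_trans (FC [::] erefl) _; rewrite big_nil subr0.
have tH : (t < H)%N by rewrite -dt addSn ltnS leq_addl.
pose i := Ordinal tH; pose k : K := (i, x, pi (i, x)).
have dE : (H - t.+1 = d)%N by rewrite -dt addSnnS addnK.
have DPle : DP a0 c w d.+1 t x <= qval a0 c w k.
  rewrite (DP_S a0 c w d t x i)//; apply: maxQ_le => a; exact: greedy_pi.
have IH' o : DP a0 c w d t.+1 o.2 - Vpi_aux P pi d t.+1 o.2 +
    pathsum P pi d t.+1 o.2 (fun l => F ((k, o) :: l)) <=
    C - g k + \sum_(t.+1 <= s < t.+1 + d) bt s.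
  apply: IH; first by rewrite addnS -addSn.
  move=> l lE; apply: le_trans (FC ((k, o) :: l) _) _; last by rewrite big_cons /= opprD addrA.
  by rewrite /levels /= -/(levels l) lE.
have gap := bellman_gap k; rewrite /= dE in gap.
rewrite (@big_ltn _ _ _ t (t + d.+1)); last by rewrite addnS ltnS leq_addr.
rewrite -(addSnnS t d).
set S := \sum_(t.+1 <= s < t.+1 + d) bt s in IH' *.
have -> : Vpi_aux P pi d.+1 t x = \sum_o P k o * (rew o + Vpi_aux P pi d t.+1 o.2).
  by rewrite /= insubT.
have -> : pathsum P pi d.+1 t x F =
    \sum_o P k o * pathsum P pi d t.+1 o.2 (fun l => F ((k, o) :: l)).
  by rewrite /= insubT.
have sumIH : \sum_o P k o * (DP a0 c w d t.+1 o.2 - Vpi_aux P pi d t.+1 o.2 +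
    pathsum P pi d t.+1 o.2 (fun l => F ((k, o) :: l))) <= C - g k + S.
  rewrite -[leRHS]mul1r -(P1 k) mulr_suml ler_sum// => o _.
  by rewrite ler_wpM2l.
have split3 : \sum_o P k o * (DP a0 c w d t.+1 o.2 - Vpi_aux P pi d t.+1 o.2 +
    pathsum P pi d t.+1 o.2 (fun l => F ((k, o) :: l))) =
  \sum_o P k o * (rew o + DP a0 c w d t.+1 o.2)
  - \sum_o P k o * (rew o + Vpi_aux P pi d t.+1 o.2)
  + \sum_o P k o * pathsum P pi d t.+1 o.2 (fun l => F ((k, o) :: l)).
  by rewrite -sumrB -big_split /=; apply: eq_bigr => o _; ring.
rewrite split3 in sumIH.
move: DPle gap sumIH.
set x1 := \sum_o _ * (_ + DP _ _ _ _ _ _); set x2 := \sum_o _ * (_ + Vpi_aux _ _ _ _ _).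
set x3 := \sum_o _ * pathsum _ _ _ _ _ _; set x4 := DP _ _ _ _ _ _; set x5 := qval _ _ _ _.
clear; lra.
Qed.

End PerformanceDifference.

Section Potential.
Context {R : realType} {X A : finType} {H : nat}.
Local Notation K := (sa_index X A H).
Local Notation D := (data X A H).
Variable gg : nat -> R.
Implicit Types l : D.

(** Total already charged by the data, a visit preceded by [j] visits to the same index being
    charged [gg j]. *)
Definition Pot l : R := \sum_(k : K) \sum_(0 <= j < nvisits l k) gg j.

(** The trace left by [e] complete episodes, each of which visits every period once. *)
Definition episodes (e : nat) l :=
  forall t : 'I_H, (\sum_(xa : X * A) nvisits l (t, xa.1, xa.2) = e)%N.

Lemma nvisits_cat l l' k : nvisits (l ++ l') k = (nvisits l k + nvisits l' k)%N.
Proof. by rewrite /nvisits count_cat. Qed.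

Lemma sum_nvisits_level l (t : 'I_H) :
  (\sum_(xa : X * A) nvisits l (t, xa.1, xa.2) = count_mem (val t) (levels l))%N.
Proof.
elim: l => [|[[[i y] a] o] l IH] /=; first by rewrite big1.
rewrite big_split /= IH; congr (_ + _)%N.
rewrite (bigD1 (y, a))//= big1 => [|[y' a'] ne].
  by rewrite addn0 !xpair_eqE !eqxx !andbT.
rewrite !xpair_eqE -andbA; move: ne; rewrite xpair_eqE eq_sym => ne.
by move: ne; rewrite (eq_sym y) (eq_sym a); case: (y' == y) (a' == a) => -[]//=; rewrite ?andbF.
Qed.

Lemma episodes_cat e l l' : episodes e l -> levels l' = iota 0 H -> episodes e.+1 (l ++ l').
Proof.
move=> el l'E t; under eq_bigr do rewrite nvisits_cat.
rewrite big_split /= el sum_nvisits_level l'E count_uniq_mem ?iota_uniq//.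
by rewrite mem_iota add0n ltn_ord addn1.
Qed.

Lemma sum_over_visits l (f : K -> R) : \sum_(e <- l) f e.1 = \sum_k (nvisits l k)%:R * f k.
Proof.
elim: l => [|[k' o] l IH]; first by rewrite big_nil big1// => k _; rewrite mul0r.
rewrite big_cons IH /=; under [RHS]eq_bigr do rewrite natrD mulrDl.
rewrite big_split /=; congr (_ + _).
rewrite (bigD1 k')//= eqxx mul1r big1 ?addr0// => k kk'.
by rewrite eq_sym (negbTE kk') mul0r.
Qed.

(** No index recurs in [l'], so counts frozen at its start price each visit exactly as updated
    counts would. *)
Lemma Pot_cat l l' : uniq (levels l') ->
  Pot (l ++ l') = Pot l + \sum_(e <- l') gg (nvisits l e.1).
Proof.
move=> ul'; have n1 k : (nvisits l' k <= 1)%N.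
  elim: l' ul' => [//|[k' o'] l' IH] /= /andP[kl' ul'].
  case: eqP => [kk'|_]; last by rewrite add0n; exact: IH.
  rewrite (_ : nvisits l' k = 0%N)//; apply/eqP; rewrite /nvisits -leqn0 leqNgt -has_count.
  apply: contra kl' => /hasP[e el /eqP ek]; apply/mapP; exists e => //.
  by rewrite ek -kk'.
rewrite (sum_over_visits l' (fun k => gg (nvisits l k))) /Pot -big_split /=.
apply: eq_bigr => k _; rewrite nvisits_cat.
case: (nvisits l' k) (n1 k) => [|[|//]] _; first by rewrite addn0 mul0r addr0.
by rewrite addn1 big_nat_recr //= mul1r.
Qed.

End Potential.

Section EpisodeBound.
Context {R : realType} {X A : finType} (a0 : A) {H : nat} (beta : R) (x0 : outcome X).
Hypothesis (H0 : (0 < H)%N) (beta0 : 0 < beta).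
Local Notation K := (sa_index X A H).
Local Notation O := (outcome X).
Local Notation D := (data X A H).
Variables (alpha : K -> O -> R) (u : nat -> R) (c : R).
Hypothesis (alpha0 : pos_params alpha) (alphab : forall k, \sum_o alpha k o = beta).
Hypothesis c0 : 0 <= c.
Implicit Types (l : D) (xi : K -> R).

(** Largest noise deviation, that of an unvisited index. *)
Definition sd0 : R := H%:R / Num.sqrt beta.

(* Values of the dynamic program are bounded below only through the most negative
   noise, hence the cut-off at [- c]. *)
Definition overshoot xi : R := \sum_k hinge c (- xi k).

(** Bias plus noise level at an index visited [j] times. The bias is the prior weight times the gap
    between [H] and the continuation value, which, overshoot apart, may be as low as
    [- (H - 1) * sd0 * c]. *)
Definition gain (j : nat) : R :=
  beta / (beta + j%:R) * (H%:R + (H%:R - 1) * sd0 * c) + H%:R / Num.sqrt (beta + j%:R) * u j.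

(** Every index enters, since the policy, hence the visited indices, depends on the same noise. *)
Definition noise l xi : R :=
  \sum_k noise_sd beta l k * hinge (u (nvisits l k)) (xi k) + H%:R ^+ 2 * sd0 * overshoot xi.

Lemma overshoot_ge0 xi : 0 <= overshoot xi.
Proof. by apply: sumr_ge0 => k _; exact: hinge_ge0. Qed.

Lemma hinge_ge (t z : R) : z <= t + hinge t z.
Proof. by rewrite /hinge -lerBlDl le_max lexx orbT. Qed.

Lemma noise_sd_le l k : noise_sd beta l k <= sd0.
Proof.
rewrite /noise_sd /sd0 ler_wpM2l ?ler0n// lef_pV2 ?posrE ?sqrtr_gt0 ?pcount_gt0//.
by rewrite ler_sqrt ?ler_wpDr// ltW// pcount_gt0.
Qed.

Lemma sd0_ge0 : 0 <= sd0.
Proof. by rewrite divr_ge0 ?ler0n// sqrtr_ge0. Qed.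

Lemma gc_ge l xi k : - (sd0 * (c + overshoot xi)) <= gc beta l xi k.
Proof.
have xk : - (c + overshoot xi) <= xi k.
  rewrite lerNl (le_trans (hinge_ge c _))// lerD2l /overshoot (bigD1 k)//= lerDl.
  by apply: sumr_ge0 => j _; exact: hinge_ge0.
have M0 : 0 <= c + overshoot xi by rewrite addr_ge0// overshoot_ge0.
have p1 : 0 <= (beta * H%:R + \sum_o (count (pred1 (k, o)) l)%:R * rew o) / pcount beta l k.
  apply: divr_ge0; last exact/ltW/pcount_gt0.
  apply: addr_ge0; first by rewrite mulr_ge0 ?ler0n ?ltW.
  by apply: sumr_ge0 => o _; rewrite mulr_ge0 ?ler0n.
have s0 := ltW (noise_sd_gt0 beta H0 beta0 l k).
have h1 := ler_wpM2l s0 xk; have h2 := ler_wpM2r M0 (noise_sd_le l k).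
rewrite mulrN in h1; rewrite /gc; lra.
Qed.

(** Observed counts contribute equally to RLSVI and to the posterior mean; the prior part and the
    noise remain. *)
Lemma bellman_gapE l xi (V : X -> R) k :
  qstep (gc beta l xi) (gw beta l) V k - \sum_o hatP alpha l k o * (rew o + V o.2) =
  (beta * H%:R - \sum_o alpha k o * (rew o + V o.2)) / pcount beta l k
  + noise_sd beta l k * xi k.
Proof.
have e o : hatP alpha l k o * (rew o + V o.2) =
   (alpha k o * (rew o + V o.2)) / pcount beta l k +
   ((count (pred1 (k, o)) l)%:R * rew o / pcount beta l k + gw beta l k o * V o.2).
  by rewrite /hatP sum_post alphab -/(pcount beta l k) /post /gw; ring.
under eq_bigr do rewrite e.
rewrite !big_split /= -!mulr_suml /qstep /gc; ring.
Qed.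

Lemma episode_bound l xi x (F : D -> R) C :
  (forall l', levels l' = iota 0 H -> F l' <= C - \sum_(e <- l') gain (nvisits l e.1)) ->
  Num.max (DP a0 (gc beta l xi) (gw beta l) H 0 x) (- (H%:R * sd0 * c))
  - Vpi (hatP alpha l) (greedy a0 beta l xi) x
  + pathsum (hatP alpha l) (greedy a0 beta l xi) H 0 x F <= C + noise l xi.
Proof.
move=> FC.
pose M := c + overshoot xi.
have ov0 := overshoot_ge0 xi.
have s00 := sd0_ge0.
have b0 : 0 <= sd0 * M by rewrite mulr_ge0// addr_ge0.
have low d t y : - (d%:R * (sd0 * M)) <= DP a0 (gc beta l xi) (gw beta l) d t y.
  by apply: DP_ge => // [k|k o|k]; [exact: gc_ge|exact: gw_ge0|exact: sum_gw_le1].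
have H1 : 1 <= H%:R :> R by rewrite ler1n.
pose bt (s : nat) : R := \sum_(k : K | val k.1.1 == s)
    noise_sd beta l k * hinge (u (nvisits l k)) (xi k) + (H%:R - 1) * sd0 * overshoot xi.
have gap (k : K) : qval a0 (gc beta l xi) (gw beta l) k -
   \sum_o hatP alpha l k o * (rew o + DP a0 (gc beta l xi) (gw beta l) (H - k.1.1.+1) k.1.1.+1 o.2)
   <= gain (nvisits l k) + bt k.1.1.
  rewrite /qval bellman_gapE.
  set V := DP a0 _ _ _ _; pose W := (H%:R - 1) * (sd0 * M).
  have VW y : - W <= V y.
    apply: le_trans (low _ _ _); rewrite lerN2 ler_wpM2r//.
    rewrite -[X in X - 1]/(H%:R) -(natrB _ H0) ler_nat.
    by rewrite leq_sub2l.
  have p0 := pcount_gt0 beta beta0 l k.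
  have sumV : - (beta * W) <= \sum_o alpha k o * (rew o + V o.2).
    rewrite -(alphab k) -mulrN mulr_suml ler_sum// => o _.
    rewrite ler_wpM2l ?(ltW (alpha0 k o))// (le_trans (VW o.2))// lerDr.
    by rewrite /rew ler0n.
  have bp : beta / pcount beta l k <= 1.
    by rewrite ler_pdivrMr// mul1r /pcount lerDl ler0n.
  have bp0 : 0 <= beta / pcount beta l k by rewrite divr_ge0 ?ltW.
  have step1 : (beta * H%:R - \sum_o alpha k o * (rew o + V o.2)) / pcount beta l k <=
      beta / pcount beta l k * (H%:R + W).
    rewrite [leRHS]mulrAC; apply: ler_wpM2r; first by rewrite invr_ge0 ltW.
    by rewrite mulrDr; move: sumV; clear; lra.
  have step2 : beta / pcount beta l k * (H%:R + W) <=
      beta / pcount beta l k * (H%:R + (H%:R - 1) * sd0 * c) + (H%:R - 1) * sd0 * overshoot xi.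
    rewrite /W /M [X in _ * X](_ : _ = (H%:R + (H%:R - 1) * sd0 * c) +
      (H%:R - 1) * sd0 * overshoot xi); last by ring.
    rewrite mulrDr lerD2l ler_piMl// !mulr_ge0// subr_ge0//.
  have sk0 := ltW (noise_sd_gt0 beta H0 beta0 l k).
  have step3 : noise_sd beta l k * xi k <= noise_sd beta l k * u (nvisits l k) +
      \sum_(k' : K | val k'.1.1 == k.1.1) noise_sd beta l k' * hinge (u (nvisits l k')) (xi k').
    apply: (@le_trans _ _ (noise_sd beta l k * (u (nvisits l k) + hinge (u (nvisits l k)) (xi k)))).
      by rewrite ler_wpM2l// hinge_ge.
    rewrite mulrDr lerD2l (bigD1 k)//= lerDl sumr_ge0// => k' _.
    by rewrite mulr_ge0 ?hinge_ge0// ltW// noise_sd_gt0.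
  rewrite /gain -/(pcount beta l k) -/(noise_sd beta l k) /bt.
  move: step1 step2 step3; clear; lra.
have pd := perf_diff a0 (gc beta l xi) (gw beta l) (hatP alpha l) (greedy a0 beta l xi)
  (fun k => gain (nvisits l k)) bt (fun k o => ltW (hatP_gt0 x0 alpha l k o alpha0))
  (fun k => sum_hatP x0 alpha l k alpha0) (rlsvi_greedy a0 beta H0 beta0 l xi) gap H 0 x F C.
have {pd} := pd (addn0 _) FC; rewrite add0n => pd.
have sbt : \sum_(0 <= s < H) bt s = \sum_k noise_sd beta l k * hinge (u (nvisits l k)) (xi k)
   + H%:R * ((H%:R - 1) * sd0 * overshoot xi).
  rewrite big_split /= sumr_const_nat subn0 mulr_natl; congr (_ + _).
  by rewrite big_mkord [RHS](partition_big (fun k : K => k.1.1) predT).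
(* In units of [sd0 * overshoot xi], the cut-off costs [H] and the periods cost [H * (H - 1)],
   whence the factor [H ^+ 2] in [noise]. *)
have mx : Num.max (DP a0 (gc beta l xi) (gw beta l) H 0 x) (- (H%:R * sd0 * c)) <=
   DP a0 (gc beta l xi) (gw beta l) H 0 x + H%:R * sd0 * overshoot xi.
  rewrite ge_max; apply/andP; split; first by rewrite lerDl !mulr_ge0// ler0n.
  by have := low H 0 x; rewrite /M; lra.
rewrite sbt in pd; rewrite /noise /Vpi.
move: pd mx; clear; lra.
Qed.

End EpisodeBound.

(** * Expected excess of the noise *)

Section NoiseExpectation.
Context {R : realType}.
Local Open Scope classical_set_scope.
Local Notation N01 := (@normal_prob R 0 1).

Definition hinge_mean (t : R) : R := (\int[N01]_z hinge t z)%R.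

Lemma hinge_meanE t : (\int[N01]_z (hinge t z)%:E = (hinge_mean t)%:E)%E.
Proof.
rewrite /hinge_mean /Rintegral fineK//.
by apply: integrable_fin_num => //; exact: hinge_integrable.
Qed.

Lemma hinge_mean_ge0 t : 0 <= hinge_mean t.
Proof.
by rewrite -lee_fin -hinge_meanE; apply: integral_ge0 => z _; rewrite lee_fin hinge_ge0.
Qed.

Context {I : finType}.
Local Notation G := (funSpace I (measurableTypeR R)).

Lemma gamma_hinge (t : R) (k : I) : (\int[gammaM]_(xi in [set: G]) (hinge t (xi k))%:E = (hinge_mean t)%:E)%E.
Proof.
apply: (gammaM_coord (fun z => (hinge t z)%:E)).
- by move=> z; rewrite lee_fin hinge_ge0.
- by apply/measurable_EFinP; exact: measurable_hinge.
- exact: hinge_meanE.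
Qed.

Lemma gamma_hinge_opp (t : R) (k : I) :
  (\int[gammaM]_(xi in [set: G]) (hinge t (- xi k))%:E = (hinge_mean t)%:E)%E.
Proof.
have m1 : measurable_fun [set: R] (fun z => (hinge t z)%:E).
  by apply/measurable_EFinP; exact: measurable_hinge.
have h0 z : (0 <= (hinge t z)%:E)%E by rewrite lee_fin hinge_ge0.
apply: (gammaM_coord (fun z => (hinge t (- z))%:E)) => //.
- apply: (measurableT_comp m1); apply: continuous_measurable_fun; exact: opp_continuous.
- by rewrite -hinge_meanE; exact: (gauss_opp _ h0 m1).
Qed.

End NoiseExpectation.

Section RegretInduction.
Context {R : realType} {X A : finType} (a0 : A) {H : nat} (beta : R) (x0 : outcome X).
Hypothesis (H0 : (0 < H)%N) (beta0 : 0 < beta).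
Local Notation K := (sa_index X A H).
Local Notation O := (outcome X).
Local Notation D := (data X A H).
Local Notation G := (funSpace K (measurableTypeR R)).
Local Notation M := (funSpace K (funSpace O (measurableTypeR R))).
Local Open Scope classical_set_scope.
Variables (alpha : K -> O -> R) (rho : X -> R) (u : nat -> R) (c : R).
Hypothesis (alpha0 : pos_params alpha) (alphab : forall k, \sum_o alpha k o = beta).
Hypothesis (rho0 : forall x, 0 <= rho x) (rho1 : \sum_x rho x = 1).
Hypothesis c0 : 0 <= c.
Implicit Types (l : D).
Local Notation sd0 := (@sd0 R H beta).
Local Notation noise := (noise beta u c).
Local Notation gain := (gain (H:=H) beta u c).
Local Notation Wr := (Wr a0 beta rho).

Definition noise_mean l : R :=
  \sum_k noise_sd beta l k * hinge_mean (u (nvisits l k)) +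
  H%:R ^+ 2 * sd0 * (#|{: K}|%:R * hinge_mean c).

Lemma measurable_hinge_coord t (k : K) : measurable_fun [set: G] (fun xi : G => hinge t (xi k)).
Proof. exact: (measurableT_comp (measurable_hinge t) (measurable_coord k)). Qed.

Lemma measurable_hinge_coordN t (k : K) : measurable_fun [set: G] (fun xi : G => hinge t (- xi k)).
Proof.
apply: (measurableT_comp (measurable_hinge t)); apply: measurableT_comp => //.
exact: measurable_coord.
Qed.

Lemma measurable_noise l : measurable_fun [set: G] (fun xi : G => noise l xi).
Proof.
apply: measurable_funD.
  by apply: measurable_sum => k; apply: measurable_funM => //; exact: measurable_hinge_coord.
apply: measurable_funM => //; apply: measurable_sum => k; exact: measurable_hinge_coordN.
Qed.

Lemma noise_ge0 l xi : 0 <= noise l xi.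
Proof.
apply: addr_ge0.
  apply: sumr_ge0 => k _; rewrite mulr_ge0 ?hinge_ge0// ltW//; exact: noise_sd_gt0.
rewrite !mulr_ge0 ?exprn_ge0 ?ler0n ?sqrtr_ge0 ?invr_ge0 ?sqrtr_ge0//.
exact: overshoot_ge0.
Qed.

Lemma integral_noise l : (\int[gammaM]_(xi in [set: G]) (noise l xi)%:E = (noise_mean l)%:E)%E.
Proof.
have sd_ge0 : 0 <= H%:R ^+ 2 * sd0 by rewrite mulr_ge0 ?exprn_ge0 ?ler0n ?sd0_ge0.
pose f1 (k : K) (xi : G) : \bar R := ((noise_sd beta l k)%:E * (hinge (u (nvisits l k)) (xi k))%:E)%E.
pose f2 (k : K) (xi : G) : \bar R := (hinge c (- xi k))%:E.
have f10 k xi : (0 <= f1 k xi)%E.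
  by rewrite mule_ge0// lee_fin ?hinge_ge0// ltW//; exact: noise_sd_gt0.
have f20 k xi : (0 <= f2 k xi)%E by rewrite lee_fin hinge_ge0.
have mf1 k : measurable_fun [set: G] (f1 k).
  by apply: emeasurable_funM => //; apply/measurable_EFinP; exact: measurable_hinge_coord.
have mf2 k : measurable_fun [set: G] (f2 k).
  by apply/measurable_EFinP; exact: measurable_hinge_coordN.
have s10 xi : (0 <= \sum_(k <- index_enum K) f1 k xi)%E by apply: sume_ge0.
have s20 xi : (0 <= \sum_(k <- index_enum K) f2 k xi)%E by apply: sume_ge0.
have ms1 : measurable_fun [set: G] (fun xi => \sum_(k <- index_enum K) f1 k xi)%E.
  exact: emeasurable_sum.
have ms2 : measurable_fun [set: G] (fun xi => \sum_(k <- index_enum K) f2 k xi)%E.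
  exact: emeasurable_sum.
transitivity (\int[gammaM]_(xi in [set: G]) (\sum_(k <- index_enum K) f1 k xi +
    (H%:R ^+ 2 * sd0)%:E * \sum_(k <- index_enum K) f2 k xi))%E.
  apply: eq_integral => xi _; rewrite /noise EFinD EFinM /overshoot -!sumEFin.
  by congr (_ + _)%E; apply: eq_bigr => k _; rewrite EFinM.
rewrite ge0_integralD; [|by []|by move=> xi _|exact: ms1| |]; last 2 first.
- by move=> xi _; rewrite mule_ge0.
- by apply: emeasurable_funM => //; exact: measurable_cst.
rewrite ge0_integralZl_EFin; [|by []|by move=> xi _|exact: ms2|exact: sd_ge0].
rewrite ge0_integral_sum; [|by []|exact: mf1|by move=> k xi _].
rewrite ge0_integral_sum; [|by []|exact: mf2|by move=> k xi _].
rewrite /noise_mean EFinD [in RHS]EFinM; congr (_ + _ * _)%E.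
  rewrite -sumEFin; apply: eq_bigr => k _.
  rewrite /f1 ge0_integralZl_EFin; last 4 first.
  - by [].
  - by move=> xi _; rewrite lee_fin hinge_ge0.
  - by apply/measurable_EFinP; exact: measurable_hinge_coord.
  - by apply/ltW; exact: noise_sd_gt0.
  by rewrite gamma_hinge EFinM.
rewrite (eq_bigr (fun=> (hinge_mean c)%:E)) => [|k _]; last exact: gamma_hinge_opp.
by rewrite sumEFin; congr EFin; rewrite sumr_const mulr_natl.
Qed.

Variables (L : nat) (eps Cmax : R).
Hypothesis eps0 : 0 <= eps.
Hypothesis noise_eps : forall l e, episodes e l -> (e < L)%N -> noise_mean l <= eps.
Hypothesis Pot_le : forall l e, episodes e l -> (e <= L)%N -> Pot gain l <= Cmax.

Lemma legit_ge0 (P : M) k o : legit P -> 0 <= P k o.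
Proof. by move=> lP; have /andP[/forallP h _] := lP k; exact: (ltW (h o)). Qed.

(** The potential spent so far is deducted from the budget [Cmax]: an episode moves its gains into
    the potential and costs only [eps] besides. Optimism trades the posterior mean of [Vstar] for
    the truncated RLSVI value, to which [episode_bound] applies for each noise. *)
Lemma regret_induction m e l : episodes e l -> (e + m = L)%N ->
  Er x0 (post alpha l) (fun P => Wr P m l) <= m%:R * eps + Cmax - Pot gain l.
Proof.
elim: m e l => [|m IH] e l el em.
  rewrite /= Er_cst mul0r add0r subr_ge0; apply: (Pot_le _ e) => //.
  by rewrite -em addn0.
pose EV x := Er x0 (post alpha l) (fun P : M => Vstar a0 P x).
pose F l' := Er x0 (post alpha (l ++ l')) (fun P : M => Wr P m (l ++ l')).
pose hat := hatP alpha l.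
pose h pi := \sum_x rho x * (EV x - Vpi hat pi x) + \sum_x rho x * pathsum hat pi H 0 x F.
have pl := post_gt0 alpha l alpha0.
have bW l' : bm (fun P : M => Wr P m l') by exact: bm_Wr.
have hatP0 k o : 0 <= hat k o by apply: ltW; exact: (hatP_gt0 x0).
have F0 l' : 0 <= F l'.
  rewrite -(Er_cst x0 (post alpha (l ++ l')) 0); apply: Er_le => //; first exact: bm_cst.
  by move=> P lP; apply: Wr_ge0 => // k o; exact: legit_ge0.
have EVV x pi : 0 <= EV x - Vpi hat pi x.
  rewrite subr_ge0 /hat -(Er_Vpi x0)//; apply: Er_le; [exact: bm_Vpi|exact: bm_Vstar|].
  by move=> P _; exact: Vstar_ge.
have EV0 x : 0 <= EV x.
  rewrite -(Er_cst x0 (post alpha l) 0); apply: Er_le; [exact: bm_cst|exact: bm_Vstar|].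
  move=> P lP; apply: le_trans (Vstar_ge a0 P (pi_default X a0 H) x).
  have P1 k : \sum_o P k o = 1 by have /andP[_ /eqP] := lP k.
  by have /andP[] := Vpi_itv a0 P (pi_default X a0 H) x (fun k o => legit_ge0 P k o lP) P1.
have h0 pi : 0 <= h pi.
  by apply: addr_ge0; apply: sumr_ge0 => x _; rewrite mulr_ge0//; exact: pathsum_ge0.
have ErW : Er x0 (post alpha l) (fun P : M => Wr P m.+1 l) = \sum_pi pol_weight a0 beta l pi * h pi.
  have b1 x pi : bm (fun P : M => Vstar a0 P x - Vpi P pi x).
    by apply: bm_sub; [exact: bm_Vstar|exact: bm_Vpi].
  have b2 x pi : bm (fun P : M => pathsum P pi H 0 x (fun l' => Wr P m (l ++ l'))).
    by apply: (bm_pathsum pi H 0 x (fun P l' => Wr P m (l ++ l'))).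
  have b3 pi : bm (fun P : M => \sum_x rho x * (Vstar a0 P x - Vpi P pi x)).
    by apply: bm_sum => x; exact: bm_scale.
  have b4 pi : bm (fun P : M => \sum_x rho x * pathsum P pi H 0 x (fun l' => Wr P m (l ++ l'))).
    by apply: bm_sum => x; exact: bm_scale.
  rewrite /= Er_sum; last by move=> pi; apply: bm_scale; exact: bm_add.
  apply: eq_bigr => pi _; rewrite Er_scale; last exact: bm_add.
  congr (_ * _); rewrite Er_add//; congr (_ + _).
    rewrite Er_sum; last by move=> x; exact: bm_scale.
    apply: eq_bigr => x _; rewrite Er_scale// Er_sub; [|exact: bm_Vstar|exact: bm_Vpi].
    by rewrite Er_Vpi.
  rewrite Er_sum; last by move=> x; exact: bm_scale.
  apply: eq_bigr => x _; rewrite Er_scale//; congr (_ * _).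
  exact: (Er_pathsum x0 alpha l pi H 0 x (fun P l' => Wr P m (l ++ l')) alpha0 (fun l' => bW _)).
set C := m%:R * eps + Cmax - Pot gain l.
have eL : (e < L)%N by rewrite -em addnS ltnS leq_addr.
have FC l' : levels l' = iota 0 H -> F l' <= C - \sum_(e <- l') gain (nvisits l e.1).
  move=> l'E; apply: le_trans (IH e.+1 (l ++ l') _ _) _; first exact: episodes_cat.
    by rewrite addSnnS.
  by rewrite Pot_cat ?l'E ?iota_uniq// /C; lra.
pose B := H%:R * sd0 * c.
have B0 : 0 <= B by rewrite !mulr_ge0 ?ler0n ?invr_ge0 ?sqrtr_ge0.
pose Mx x (xi : G) : R := Num.max (DP a0 (gc beta l xi) (gw beta l) H 0 x) (- B) + B.
have Mx0 x xi : 0 <= Mx x xi by rewrite /Mx -lerBlDr sub0r le_max lexx orbT.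
have mMx x : measurable_fun [set: G] (Mx x).
  apply: measurable_funD => //; apply: measurable_maxr => //.
  apply: measurable_DP => [k|k o]; last exact: measurable_cst.
  apply: measurable_funD => //; apply: measurable_funM => //; exact: measurable_coord.
have opt x : ((EV x + B)%:E <= \int[gammaM]_(xi in [set: G]) (Mx x xi)%:E)%E.
  apply: (@le_trans _ _ (Er x0 (post alpha l) (fun P : M => DP a0 (mean_rew P) P H 0 x) + B)%:E).
    rewrite lee_fin lerD2r; apply: Er_le; [exact: bm_Vstar|exact: bm_DP|].
    by move=> P lP; apply: Vstar_le_DP => k o; exact: legit_ge0.
  apply: le_trans (optimism a0 beta x0 H0 beta0 alpha l B alpha0 alphab B0 x) _.
  rewrite gammaME//; last by apply/measurable_EFinP; exact: mMx.
  by move=> xi; rewrite lee_fin; exact: Mx0.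
pose c1 := \sum_x rho x * (EV x + B) + C.
have C0 : 0 <= C.
  rewrite /C -addrA addr_ge0// ?mulr_ge0 ?ler0n// subr_ge0; apply: (Pot_le _ e) => //.
  exact: ltnW.
have c10 : 0 <= c1.
  by rewrite addr_ge0// sumr_ge0// => x _; rewrite mulr_ge0// addr_ge0.
(* [episode_bound] averaged over [rho] and rearranged, with the shift by [B], into an inequality
   between nonnegative functions of the noise, to be integrated. *)
have pw (xi : G) : h (greedy a0 beta l xi) + \sum_x rho x * Mx x xi <= c1 + noise l xi.
  have eb x := episode_bound a0 beta x0 H0 beta0 alpha u c alpha0 alphab c0 l xi x F C FC.
  have sb : \sum_x rho x * (Num.max (DP a0 (gc beta l xi) (gw beta l) H 0 x) (- B)
     - Vpi hat (greedy a0 beta l xi) x + pathsum hat (greedy a0 beta l xi) H 0 x F) <= C + noise l xi.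
    rewrite -[leRHS]mul1r -rho1 mulr_suml ler_sum// => x _.
    by rewrite ler_wpM2l//; exact: eb.
  have E : h (greedy a0 beta l xi) + \sum_x rho x * Mx x xi - \sum_x rho x * (EV x + B) =
    \sum_x rho x * (Num.max (DP a0 (gc beta l xi) (gw beta l) H 0 x) (- B)
     - Vpi hat (greedy a0 beta l xi) x + pathsum hat (greedy a0 beta l xi) H 0 x F).
    rewrite /h /Mx -!big_split -sumrB /=; apply: eq_bigr => x _.
    set t1 := Num.max _ _; ring.
  rewrite -E in sb; rewrite /c1; lra.
have mh : measurable_fun [set: G] (fun xi => (h (greedy a0 beta l xi))%:E).
  by apply/measurable_EFinP; exact: measurable_greedy_fun.
have mrM x : measurable_fun [set: G] (fun xi => (rho x)%:E * (Mx x xi)%:E)%E.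
  by apply: emeasurable_funM => //; apply/measurable_EFinP.
have rM0 x xi : (0 <= (rho x)%:E * (Mx x xi)%:E)%E by rewrite mule_ge0// lee_fin.
have msM : measurable_fun [set: G] (fun xi => \sum_(x <- index_enum X) (rho x)%:E * (Mx x xi)%:E)%E.
  exact: emeasurable_sum.
have sM0 xi : (0 <= \sum_(x <- index_enum X) (rho x)%:E * (Mx x xi)%:E)%E by apply: sume_ge0.
have mn : measurable_fun [set: G] (fun xi => (noise l xi)%:E).
  by apply/measurable_EFinP; exact: measurable_noise.
have I1 : (\int[gammaM]_(xi in [set: G]) ((h (greedy a0 beta l xi))%:E +
     \sum_(x <- index_enum X) (rho x)%:E * (Mx x xi)%:E) <=
   \int[gammaM]_(xi in [set: G]) (c1%:E + (noise l xi)%:E))%E.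
  apply: ge0_le_integral; [by []| | | |].
  - by move=> xi _; rewrite adde_ge0// lee_fin.
  - exact: emeasurable_funD.
  - by apply: emeasurable_funD => //; exact: measurable_cst.
  - move=> xi _; have := pw xi; rewrite -lee_fin; congr (_ <= _)%E.
    by rewrite EFinD -sumEFin.
have R1 : (\int[gammaM]_(xi in [set: G]) (c1%:E + (noise l xi)%:E) = (c1 + noise_mean l)%:E)%E.
  rewrite ge0_integralD; [|by []|by move=> xi _; rewrite lee_fin|exact: measurable_cst
    |by move=> xi _; rewrite lee_fin noise_ge0|exact: mn].
  have i1 : (\int[gammaM]_(xi in [set: G]) (cst c1%:E xi) = c1%:E)%E.
    by rewrite integral_cst//= probability_setT mule1.
  exact: (f_equal2 (fun x y => (x + y)%E) i1 (integral_noise l)).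
have L1 : ((\sum_pi pol_weight a0 beta l pi * h pi + \sum_x rho x * (EV x + B))%:E <=
   \int[gammaM]_(xi in [set: G]) ((h (greedy a0 beta l xi))%:E +
     \sum_(x <- index_enum X) (rho x)%:E * (Mx x xi)%:E))%E.
  rewrite ge0_integralD; [|by []|by move=> xi _; rewrite lee_fin|exact: mh
    |by move=> xi _|exact: msM].
  rewrite gamma_greedy// EFinD leeD2l//.
  rewrite ge0_integral_sum; [|by []|exact: mrM|by move=> x xi _].
  rewrite -sumEFin; apply: lee_sum => x _; rewrite EFinM.
  rewrite ge0_integralZl_EFin; [|by []|by move=> xi _; rewrite lee_fin| |exact: rho0]; last first.
    by apply/measurable_EFinP; exact: mMx.
  by apply: lee_wpmul2l; [rewrite lee_fin|exact: opt].
have := le_trans L1 I1; rewrite R1 lee_fin ErW => fin.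
have ne := noise_eps l e el eL.
rewrite -natr1 mulrDl mul1r; move: fin ne; rewrite /c1 /C; lra.
Qed.

Lemma regret_le : Er x0 alpha (fun P => Wr P L [::]) <= L%:R * eps + Cmax.
Proof.
have e0 : episodes 0 ([::] : D) by move=> t; rewrite big1.
have := regret_induction L 0%N [::] e0 (add0n _).
rewrite post_nil /Pot [X in _ - X]big1 ?subr0// => k _.
by rewrite big_geq.
Qed.

End RegretInduction.

(** * Numerical inequalities *)

Section NumericConstants.
Context {R : realType}.
Implicit Types x y : R.

Lemma le_of_derive (f df : R -> R) : (forall x, is_derive x 1 f (df x)) ->
  (forall x, 0 <= x -> 0 <= df x) -> forall x, 0 <= x -> f 0 <= f x.
Proof.
move=> fdf df0 x x0.
have cf : {within `[0%R, x], continuous f}%classic.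
  apply: derivable_within_continuous => y _; by have [] := fdf y.
have [c /itvP c0x fE] := MVT_segment x0 (fun y _ => fdf y) cf.
by rewrite -subr_ge0 fE mulr_ge0 ?subr_ge0// df0// c0x.
Qed.

Lemma sin_le_id x : 0 <= x -> sin x <= x.
Proof.
move=> x0; have d y : is_derive y 1 (fun y => y - sin y) (1 - cos y).
  by apply: is_deriveB.
have := le_of_derive _ _ d _ _ x0; rewrite sin0 subr0 subr_ge0; apply => y _.
by rewrite subr_ge0 cos_le1.
Qed.

Lemma sin_sqr_le x : 0 <= x <= 1 -> sin x ^+ 2 <= x ^+ 2.
Proof.
move=> /andP[x0 x1]; rewrite ler_pXn2r ?nnegrE ?sin_le_id//.
by apply: sin_ge0_pi; rewrite x0 (le_trans x1)// (le_trans _ (pi_ge2 R))// ler1n.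
Qed.

Lemma cos_double x : cos (2 * x) = 2 * cos x ^+ 2 - 1.
Proof. by rewrite mulr_natl cos_mulr2n mulr_natl. Qed.

Lemma cos_double_ge (l l' : R) x : 0 <= l -> l' <= 2 * l ^+ 2 - 1 ->
  l <= cos x -> l' <= cos (2 * x).
Proof.
move=> l0 l'l lx; rewrite cos_double (le_trans l'l)// lerD2r ler_pM2l//.
by rewrite ler_pXn2r ?nnegrE// (le_trans l0).
Qed.

(** [cos] is positive at 1.565, half of 3.13: at x = 1.565/32 the bound 1 - 2 x^2 is below the
    cosine of 2x, and four doublings through 2 c^2 - 1 lead to 1.565, with lower bounds rounded as
    in [n0] to [n4]. *)
Lemma pi_ge313 : 313 / 100 <= pi :> R.
Proof.
have n1 : (980 + 909 / 1000) / 1000 <= 2 * ((995 + 216 / 1000) / 1000) ^+ 2 - 1 :> R by clear; lra.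
have n2 : (924 + 364 / 1000) / 1000 <= 2 * ((980 + 909 / 1000) / 1000) ^+ 2 - 1 :> R by clear; lra.
have n3 : (708 + 897 / 1000) / 1000 <= 2 * ((924 + 364 / 1000) / 1000) ^+ 2 - 1 :> R by clear; lra.
have n4 : 1 / 1000 <= 2 * ((708 + 897 / 1000) / 1000) ^+ 2 - 1 :> R by clear; lra.
have p1 : 0 <= (995 + 216 / 1000) / 1000 :> R by clear; lra.
have p2 : 0 <= (980 + 909 / 1000) / 1000 :> R by clear; lra.
have p3 : 0 <= (924 + 364 / 1000) / 1000 :> R by clear; lra.
have p4 : 0 <= (708 + 897 / 1000) / 1000 :> R by clear; lra.
have w0 : 0 <= ((1 + 565 / 1000) / 32 : R) <= 1 by clear; lra.
have n0 : (995 + 216 / 1000) / 1000 <= 1 - 2 * ((1 + 565 / 1000) / 32) ^+ 2 :> R by clear; lra.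
pose y : R := (1 + 565 / 1000).
have c0 : (995 + 216 / 1000) / 1000 <= cos (2 * (y / 32)).
  apply: (le_trans n0); have := sin_sqr_le _ w0; rewrite sin2cos2 cos_double -/y.
  move: (cos _ ^+ 2) ((y / 32) ^+ 2) => a b; clear; lra.
have := cos_double_ge _ _ _ p4 n4 (cos_double_ge _ _ _ p3 n3
  (cos_double_ge _ _ _ p2 n2 (cos_double_ge _ _ _ p1 n1 c0))).
have -> : 2 * (2 * (2 * (2 * (2 * (y / 32))))) = y by field.
have y01 : 0 <= y <= 2 by rewrite /y; clear; lra.
have y3 : y = 313 / 100 / 2 by rewrite /y; field.
clear -y01 y3 => cy; rewrite leNgt; apply/negP => pi_lt.
have p2 : 2 <= pi :> R by exact: pi_ge2.
have m1 : (pi : R) / 2 \in `[0, pi]%R by rewrite in_itv /=; apply/andP; split; lra.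
have m2 : y \in `[0, (pi : R)]%R by rewrite in_itv /=; apply/andP; split; lra.
have := ltr_cos m2 m1; rewrite cos_pihalf.
have c0 : 0 < cos y by move: cy; clear; lra.
rewrite c0 => /esym h; move: h pi_lt y3; clear; lra.
Qed.

(** [(1 + y) - expR (2 * y) * (1 - y)] vanishes at 0, and its derivative is nonnegative because
    [expR (2 * z) * (1 - 2 * z) <= 1]. *)
Lemma expR_le_pade y : 0 <= y -> y < 1 -> expR (2 * y) <= (1 + y) / (1 - y).
Proof.
move=> y0 y1; rewrite ler_pdivlMr ?subr_gt0//.
have e2 (z : R) : expR (2 * z) = expR z * expR z by rewrite -expRD; congr expR; ring.
have d (z : R) : is_derive z 1 (fun z : R => (1 + z) - expR z * expR z * (1 - z))
    (1 - (2 * (expR z * expR z) * (1 - z) - expR z * expR z)).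
  apply: is_derive_eq; rewrite /GRing.scale /=; ring.
have := le_of_derive _ _ d _ _ y0; rewrite expR0 addr0 subr0 !mulr1 subrr subr_ge0 e2; apply => z z0.
rewrite -e2.
have h := expR_ge1Dx (- (2 * z)).
rewrite expRN in h; have e0 := expR_gt0 (2 * z).
have : expR (2 * z) * (1 - 2 * z) <= 1.
  by rewrite mulrC -ler_pdivlMr// div1r; lra.
lra.
Qed.

Lemma ln_ge_pade x : 1 <= x -> 2 * (x - 1) / (x + 1) <= ln x.
Proof.
move=> x1; have x0 : 0 < x by lra.
pose y := (x - 1) / (x + 1).
have y0 : 0 <= y by rewrite divr_ge0//; lra.
have y1 : y < 1 by rewrite ltr_pdivrMr; lra.
have h := expR_le_pade _ y0 y1.
have yx : (1 + y) / (1 - y) = x by rewrite /y; field; apply/andP; split; lra.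
rewrite yx in h; rewrite -mulrA -/y -(expRK (2 * y)) ler_ln ?posrE ?expR_gt0//.
Qed.

Lemma ln2_ge : (69 + 19 / 100) / 100 <= ln 2 :> R.
Proof.
(* [ln_ge_pade] has an error of third order in [x - 1], so 2 is split into ratios close to 1. *)
have -> : ln 2 = ln (10 / 9) + ln (9 / 8) + ln (8 / 7) + ln (7 / 6) + ln (6 / 5) :> R.
  rewrite -!lnM ?posrE; try by lra.
  by congr ln; field.
have h (a b : R) : 1 <= a -> b * (a + 1) <= 2 * (a - 1) -> b <= ln a.
  move=> a1 ba; apply: le_trans (ln_ge_pade _ a1); rewrite ler_pdivlMr//; lra.
have h1 : 2 / 19 <= ln (10 / 9) :> R by apply: h; clear; lra.
have h2 : 2 / 17 <= ln (9 / 8) :> R by apply: h; clear; lra.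
have h3 : 2 / 15 <= ln (8 / 7) :> R by apply: h; clear; lra.
have h4 : 2 / 13 <= ln (7 / 6) :> R by apply: h; clear; lra.
have h5 : 2 / 11 <= ln (6 / 5) :> R by apply: h; clear; lra.
clear h; lra.
Qed.

Definition s2pi : R := Num.sqrt (2 * pi).

Lemma s2pi_gt0 : 0 < s2pi.
Proof. by rewrite sqrtr_gt0 mulr_gt0// pi_gt0. Qed.

(** Squaring removes the root and gives 64 times a number close to 1, within reach of [ln2_ge] and
    [pi_ge313]. The value 2.165 is just above what [theta_ineq] requires at [N = 2]. *)
Lemma ln_const_ge : 433 / 200 <= ln (2 * (7 / 4) * s2pi).
Proof.
have s0 := s2pi_gt0.
have e : 2 * ln (2 * (7 / 4) * s2pi) = ln (64 * ((49 / 128) * pi)).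
  rewrite mulr_natl -lnXn; last by rewrite !mulr_gt0.
  by congr ln; rewrite !exprMn sqr_sqrtr ?mulr_ge0 ?pi_ge0//; field.
have p := pi_ge313.
have e2 : ln (64 * ((49 / 128) * pi)) = 6 * ln 2 + ln ((49 / 128) * pi) :> R.
  rewrite lnM ?posrE ?mulr_gt0 ?pi_gt0//.
  by congr (_ + _); rewrite mulr_natl -lnXn//; congr ln; ring.
have l2 := ln2_ge.
have l3 : 179 / 1000 <= ln ((49 / 128) * pi) :> R.
  apply: (@le_trans _ _ (ln (49 / 128 * (313 / 100)))).
    have a1 : 1 <= 49 / 128 * (313 / 100) :> R by clear; lra.
    have a2 : 0 < 49 / 128 * (313 / 100) + 1 :> R by clear; lra.
    by apply: le_trans (@ln_ge_pade (49 / 128 * (313 / 100)) a1); rewrite ler_pdivlMr//; clear; lra.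
  have q0 : 0 < 49 / 128 :> R by clear; lra.
  have q1 : 0 < 313 / 100 :> R by clear; lra.
  by rewrite ler_ln ?posrE; [rewrite ler_pM2l|exact: mulr_gt0|apply: mulr_gt0 => //; exact: pi_gt0].
move: e e2 l2 l3; set x1 := ln _; set x2 := ln _; set x3 := ln 2; set x4 := ln _; clear; lra.
Qed.

Lemma le_sqrt (a b : R) : 0 <= a -> a ^+ 2 <= b -> a <= Num.sqrt b.
Proof.
move=> a0 ab; rewrite -(ger0_norm a0) -sqrtr_sqr ler_sqrt//.
exact: le_trans (sqr_ge0 a) ab.
Qed.

(* Exponential tilting parameter; the floor 7/4 is needed for small [N] only, and
   makes [theta_ineq] just true at [N = 2]. *)
Definition theta_of (U : R) : R := Num.max U (7 / 4).

(** For the base level [b = U - 2 / theta], completing the square with [U ^+ 2 = 2 * ln N] turns the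
    tilting condition [theta ^+ 2 / 2 - theta * b + ln N <= ln (2 * theta * s2pi)] into this one.
    Its left side equals 2 once [U] exceeds 7/4. *)
Lemma theta_ineq (N : nat) : (1 < N)%N ->
  (theta_of (Num.sqrt (2 * ln N%:R)) - Num.sqrt (2 * ln N%:R)) ^+ 2 / 2 + 2 <=
  ln (2 * theta_of (Num.sqrt (2 * ln N%:R)) * s2pi).
Proof.
move=> N1; have lN : ln 2 <= ln N%:R :> R by rewrite ler_ln ?posrE ?ltr0n ?ler_nat// ltnW.
have c := ln_const_ge; have l2 := ln2_ge.
(* A rounded lower bound for [sqrt (2 ln 2)], the value at [N = 2]. *)
have U0 : (117 + 63 / 100) / 100 <= Num.sqrt (2 * ln N%:R) :> R.
  apply: le_sqrt; first by clear; lra.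
  move: l2 lN; clear; lra.
move: (Num.sqrt _) U0 => U U0; rewrite /theta_of; case: (leP U (7 / 4)) => U1.
  have : (7 / 4 - U) ^+ 2 <= ((57 + 37 / 100) / 100) ^+ 2.
    rewrite ler_pXn2r ?nnegrE//; move: U0 U1; clear; lra.
  move: c; set w := ln _; move: ((_ - U) ^+ 2) => t; clear; lra.
rewrite subrr expr0n/= mul0r add0r.
have : ln (2 * (7 / 4) * s2pi) <= ln (2 * U * s2pi).
  have s0 := s2pi_gt0.
  have U2 : 0 < U by move: U1; clear; lra.
  rewrite ler_ln ?posrE ?mulr_gt0// ler_pM2r// ler_pM2l//; exact: ltW.
move: c; clear; lra.
Qed.

End NumericConstants.

(** * Sums over visit counts *)

Section VisitSums.
Context {R : realType} (beta : R).
Hypothesis beta2 : 2 <= beta.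

Lemma ln_le_subr1 (x : R) : 0 < x -> ln x <= x - 1.
Proof.
move=> x0; have h : -1 < x - 1 by lra.
by have := le_ln1Dx h; rewrite addrC subrK.
Qed.

(** Telescoping, since [1 / (2 + S) <= ln ((2 + S) / (1 + S))]; the hypothesis [2 <= beta] matches
    the summand. *)
Lemma sum_inv_le (S : nat) : \sum_(0 <= j < S) (beta + j%:R)^-1 <= ln (1 + S%:R).
Proof.
elim: S => [|S IH]; first by rewrite big_geq// addr0 ln1.
rewrite big_nat_recr//= (le_trans (lerD IH (lexx _)))//.
have s0 : 0 <= S%:R :> R by exact: ler0n.
have p1 : 0 < 1 + S%:R :> R by move: s0; clear; lra.
have p2 : 0 < 2 + S%:R :> R by move: s0; clear; lra.
have -> : 1 + S.+1%:R = 2 + S%:R :> R by rewrite -natr1; ring.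
have h : ln ((1 + S%:R) / (2 + S%:R)) <= - (2 + S%:R)^-1 :> R.
  apply: le_trans (ln_le_subr1 _ _) _; first by rewrite divr_gt0.
  by rewrite le_eqVlt; apply/orP; left; apply/eqP; field; rewrite gt_eqF.
rewrite ln_div ?posrE// in h.
have h2 : (beta + S%:R)^-1 <= (2 + S%:R)^-1.
  by rewrite lef_pV2 ?posrE ?lerD2r//; move: beta2 s0; clear; lra.
move: h h2; clear; lra.
Qed.

(** Telescoping, since [1 / sqrt (S + 1) <= 2 * (sqrt (S + 1) - sqrt S)]. *)
Lemma sum_inv_sqrt (S : nat) : \sum_(0 <= j < S) (Num.sqrt (beta + j%:R))^-1 <= 2 * Num.sqrt S%:R.
Proof.
elim: S => [|S IH]; first by rewrite big_geq// mulr_ge0// sqrtr_ge0.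
rewrite big_nat_recr//= (le_trans (lerD IH (lexx _)))//.
have s0 : 0 <= S%:R :> R by exact: ler0n.
set a := Num.sqrt S.+1%:R; set c := Num.sqrt S%:R.
have a0 : 0 < a by rewrite sqrtr_gt0 ltr0n.
have c0 : 0 <= c by exact: sqrtr_ge0.
have ac : a ^+ 2 = c ^+ 2 + 1 by rewrite !sqr_sqrtr ?ler0n// natr1.
have h2 : (Num.sqrt (beta + S%:R))^-1 <= a^-1.
  rewrite lef_pV2 ?posrE//; last by rewrite sqrtr_gt0; move: beta2 s0; clear; lra.
  by rewrite ler_sqrt; [rewrite -natr1|]; move: beta2 s0; clear; lra.
have h3 : a^-1 <= 2 * (a - c).
  rewrite -(ler_pM2l a0) divff ?gt_eqF//.
  have : 0 <= (a - c) ^+ 2 by exact: sqr_ge0.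
  move: ac; clear; nra.
move: h2 h3; clear; lra.
Qed.

(** Raises the noise level at rarely visited indices; it vanishes once [j + 1] reaches [z], to be
    taken as the average number of visits. *)
Definition lnp (z : R) (j : nat) : R := Num.max 0 (ln (z / j.+1%:R)).

Lemma lnp_ge0 z j : 0 <= lnp z j.
Proof. by rewrite /lnp le_max lexx. Qed.

(** Antiderivative in [s] of [ln (z / s) / sqrt s], largest at [s = z], where it equals
    [4 sqrt z]. *)
Definition log_primitive (z : R) (s : nat) : R :=
  2 * Num.sqrt s%:R * ln (z / s%:R) + 4 * Num.sqrt s%:R.

Lemma log_primitive_le z s : 0 < z -> s%:R <= z -> log_primitive z s <= 4 * Num.sqrt z.
Proof.
move=> z0; case: s => [|s] sz.
  by rewrite /log_primitive sqrtr0 !mulr0 mul0r addr0 mulr_ge0// sqrtr_ge0.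
rewrite /log_primitive.
have s0 : 0 < s.+1%:R :> R by exact: ltr0n.
set c := Num.sqrt s.+1%:R.
have c0 : 0 < c by rewrite sqrtr_gt0.
have d0 : 0 < Num.sqrt z by rewrite sqrtr_gt0.
have e : ln (z / s.+1%:R) = 2 * ln (Num.sqrt z / c).
  rewrite mulr_natl -lnXn ?divr_gt0//; congr ln.
  by rewrite expr_div_n !sqr_sqrtr// ltW.
have h := ln_le_subr1 (Num.sqrt z / c) (divr_gt0 d0 c0).
have {}h := ler_wpM2l (ltW c0) h.
have e2 : c * (Num.sqrt z / c - 1) = Num.sqrt z - c by field; rewrite gt_eqF.
rewrite e2 in h; rewrite e.
move: h; set w := ln _; clear; lra.
Qed.

Lemma log_primitive_step z s : 0 < z -> s.+1%:R <= z ->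
  ln (z / s.+1%:R) / Num.sqrt s.+1%:R <= log_primitive z s.+1 - log_primitive z s.
Proof.
move=> z0 sz.
have s0 : 0 < s.+1%:R :> R by exact: ltr0n.
have w0 : 0 <= ln (z / s.+1%:R) by rewrite ln_ge0// ler_pdivlMr// mul1r.
rewrite /log_primitive; set a := Num.sqrt s.+1%:R.
have a0 : 0 < a by rewrite sqrtr_gt0.
case: s sz s0 w0 @a a0 => [|s] sz s0 w0 a a0.
  rewrite sqrtr0 !mulr0 mul0r addr0 subr0 /a sqrtr1 divr1.
  by move: w0; clear; lra.
have s1 : 0 < s.+1%:R :> R by exact: ltr0n.
set c := Num.sqrt s.+1%:R.
have c0 : 0 < c by rewrite sqrtr_gt0.
have ac : a ^+ 2 = c ^+ 2 + 1 by rewrite !sqr_sqrtr ?ler0n// natr1.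
have e : ln (z / s.+1%:R) = ln (z / s.+2%:R) + 2 * ln (a / c).
  rewrite mulr_natl -lnXn ?divr_gt0// -lnM ?posrE ?exprn_gt0 ?divr_gt0//; congr ln.
  rewrite expr_div_n !sqr_sqrtr ?ler0n//.
  by field; rewrite !gt_eqF.
have h := ln_le_subr1 (a / c) (divr_gt0 a0 c0).
have {}h := ler_wpM2l (ltW c0) h.
have e2 : c * (a / c - 1) = a - c by field; rewrite gt_eqF.
rewrite e2 in h; rewrite e.
have h3 : a^-1 <= 2 * (a - c).
  rewrite -(ler_pM2l a0) divff ?gt_eqF//.
  have : 0 <= (a - c) ^+ 2 by exact: sqr_ge0.
  move: ac; clear; nra.
have h4 := ler_wpM2l w0 h3.
move: h h4; set w := ln (z / _); set y := ln (a / c); clear; lra.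
Qed.

Lemma sum_lnp z (S : nat) : 0 < z ->
  \sum_(0 <= j < S) lnp z j / Num.sqrt (beta + j%:R) <= 4 * Num.sqrt z.
Proof.
move=> z0.
have le1 j : lnp z j / Num.sqrt (beta + j%:R) <= lnp z j / Num.sqrt j.+1%:R.
  have j0 : 0 <= j%:R :> R by exact: ler0n.
  rewrite ler_wpM2l ?lnp_ge0// lef_pV2 ?posrE ?sqrtr_gt0 ?ltr0n//; last first.
    by move: beta2 j0; clear; lra.
  by rewrite ler_sqrt; [rewrite -natr1|]; move: beta2 j0; clear; lra.
apply: le_trans (ler_sum _ (fun j _ => le1 j)) _.
have small T : T%:R <= z -> \sum_(0 <= j < T) lnp z j / Num.sqrt j.+1%:R <= log_primitive z T.
  elim: T => [|T IH] Tz.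
    by rewrite big_geq// /log_primitive sqrtr0 !mulr0 mul0r addr0.
  rewrite big_nat_recr//=.
  have Tz' : T%:R <= z by apply: le_trans Tz; rewrite ler_nat.
  have st := log_primitive_step z T z0 Tz.
  rewrite /lnp max_r; last by rewrite ln_ge0// ler_pdivlMr ?ltr0n// mul1r.
  have := IH Tz'; rewrite -/(lnp _ _).
  move: st; set w := ln _ / _; set q := \sum_(0 <= j < T) _; clear; lra.
elim: S => [|S IH]; first by rewrite big_geq// mulr_ge0// sqrtr_ge0.
have [Sz|Sz] := leP S.+1%:R z.
  by apply: le_trans (small _ Sz) _; exact: log_primitive_le.
rewrite big_nat_recr//= [X in _ + X](_ : _ = 0) ?addr0//.
rewrite /lnp max_l ?mul0r//; apply: ln_le0.
by rewrite ler_pdivrMr ?ltr0n// mul1r ltW.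
Qed.

End VisitSums.

Lemma sum_cstR {R : realType} {J : finType} (c : R) : \sum_(j : J) c = #|J|%:R * c.
Proof. by rewrite mulr_natl; exact: sumr_const. Qed.

(** [ln] is replaced by its tangent at [1 + z]; the linear terms sum to at most 0, as the [S j] are
    at most [z] on average. *)
Lemma sum_bias {R : realType} (beta : R) {J : finType} (S : J -> nat) (z : R) :
  2 <= beta -> 0 < z -> \sum_j (S j)%:R <= #|J|%:R * z ->
  \sum_j \sum_(0 <= i < S j) beta / (beta + i%:R) <= beta * #|J|%:R * ln (1 + z).
Proof.
move=> beta2 z0 SN.
have b0 : 0 < beta by move: beta2; clear; lra.
have z1 : 0 < 1 + z by move: z0; clear; lra.
have one j : \sum_(0 <= i < S j) beta / (beta + i%:R) <=
    beta * (ln (1 + z) + ((S j)%:R - z) / (1 + z)).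
  rewrite -mulr_sumr ler_pM2l//; apply: le_trans (sum_inv_le beta beta2 _) _.
  have s0 : 0 <= (S j)%:R :> R by exact: ler0n.
  have s1 : 0 < 1 + (S j)%:R :> R by move: s0; clear; lra.
  have := ln_le_subr1 _ (divr_gt0 s1 z1); rewrite ln_div ?posrE//.
  have -> : (1 + (S j)%:R) / (1 + z) - 1 = ((S j)%:R - z) / (1 + z).
    by field; rewrite gt_eqF.
  by clear; lra.
apply: le_trans (ler_sum _ (fun j _ => one j)) _.
rewrite -mulr_sumr -mulrA ler_pM2l// big_split /= -mulr_suml sumrB !sum_cstR gerDl.
by apply: mulr_le0_ge0; [rewrite subr_le0|rewrite invr_ge0 ltW].
Qed.

(** With [q = sqrt z], the inequality [2 sqrt S <= q + S / q] is linear in the number of visits,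
    while the logarithmic part costs at most [2 q / th] per index, however many visits. *)
Lemma sum_noise {R : realType} (beta : R) {J : finType} (S : J -> nat) (z b th : R) :
  2 <= beta -> 0 < z -> \sum_j (S j)%:R <= #|J|%:R * z -> 0 <= b -> 0 < th ->
  \sum_j \sum_(0 <= i < S j) (Num.sqrt (beta + i%:R))^-1 * (b + lnp z i / (2 * th)) <=
  2 * (#|J|%:R * Num.sqrt z) * (b + th^-1).
Proof.
move=> beta2 z0 SN b0 th0.
set q := Num.sqrt z; have q0 : 0 < q by rewrite sqrtr_gt0.
have qq : q ^+ 2 = z by rewrite sqr_sqrtr// ltW.
have one j : \sum_(0 <= i < S j) (Num.sqrt (beta + i%:R))^-1 * (b + lnp z i / (2 * th)) <=
    b * (q + (S j)%:R / q) + (2 * q) / th.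
  rewrite (eq_bigr (fun i => b * (Num.sqrt (beta + i%:R))^-1 +
     (2 * th)^-1 * (lnp z i / Num.sqrt (beta + i%:R)))) => [|i _]; last by ring.
  rewrite big_split /= -!mulr_sumr; apply: lerD.
    rewrite ler_wpM2l//; apply: le_trans (sum_inv_sqrt beta beta2 _) _.
    have s0 : 0 <= (S j)%:R :> R by exact: ler0n.
    have ss : Num.sqrt (S j)%:R ^+ 2 = (S j)%:R :> R by rewrite sqr_sqrtr.
    rewrite -(ler_pM2l q0) mulrDr [q * (_ / q)]mulrC divfK ?gt_eqF//.
    have : 0 <= (Num.sqrt (S j)%:R - q) ^+ 2 by exact: sqr_ge0.
    by move: ss; clear; nra.
  have i0 : 0 <= (2 * th)^-1 by rewrite invr_ge0 mulr_ge0// ltW.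
  have := ler_wpM2l i0 (sum_lnp beta beta2 z (S j) z0).
  by have -> : (2 * th)^-1 * (4 * Num.sqrt z) = 2 * q / th by rewrite -/q; field; rewrite gt_eqF.
apply: le_trans (ler_sum _ (fun j _ => one j)) _.
rewrite big_split /= -mulr_sumr big_split /= -mulr_suml !sum_cstR.
have h : (\sum_j (S j)%:R) / q <= #|J|%:R * q.
  by rewrite ler_pdivrMr// -mulrA -expr2 qq.
have h2 := ler_wpM2l b0 h.
rewrite mulrDr.
have -> : 2 * (#|J|%:R * q) * (b + th^-1) =
   b * (#|J|%:R * q) + b * (#|J|%:R * q) + #|J|%:R * (2 * q / th) by ring.
by rewrite lerD2r lerD2l.
Qed.

Section HingeBounds.
Context {R : realType}.

Lemma expR_le_of_ln (a x : R) : 0 < x -> a <= ln x -> expR a <= x.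
Proof.
move=> x0 ax; apply: (@le_trans _ _ (expR (ln x))); first by rewrite ler_expR.
by rewrite lnK ?posrE.
Qed.

Lemma hinge_mean_le (t v : R) : 0 < t ->
  hinge_mean v <= s2pi^-1 * expR (t ^+ 2 / 2 - t * v) / t ^+ 2.
Proof.
move=> t0; have := gauss_hinge_le t v t0; rewrite hinge_meanE lee_fin.
by rewrite /normal_peak expr1n mul1r -mulr_natl.
Qed.

Lemma s2pi_ge2 : 2 <= (s2pi : R).
Proof. by apply: le_sqrt => //; have := pi_ge2 R; lra. Qed.

(** Tilting by the level itself minimises the exponent; [s2pi] and [2 * lp] are both at least 2,
    whence the 4. *)
Lemma hinge_mean_sqrt_le (lp : R) : 1 <= lp ->
  hinge_mean (Num.sqrt (2 * lp)) <= expR (- lp) / 4.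
Proof.
move=> lp1; have lp0 : 0 < 2 * lp by move: lp1; clear; lra.
have c0 : 0 < Num.sqrt (2 * lp) by rewrite sqrtr_gt0.
have cc : Num.sqrt (2 * lp) ^+ 2 = 2 * lp by rewrite sqr_sqrtr// ltW.
apply: le_trans (hinge_mean_le _ (Num.sqrt (2 * lp)) c0) _.
rewrite -[in X in expR X]expr2 cc (_ : 2 * lp / 2 - 2 * lp = - lp); last by field.
have e0 := expR_gt0 (- lp).
have s0 : 0 < (s2pi : R) by exact: s2pi_gt0.
have s2 := s2pi_ge2.
have i1 : s2pi^-1 <= 2^-1 :> R by rewrite lef_pV2 ?posrE.
have i2 : (2 * lp)^-1 <= 2^-1 by rewrite lef_pV2 ?posrE//; move: lp1; clear; lra.
have i10 : 0 <= s2pi^-1 :> R by rewrite invr_ge0 ltW.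
have i20 : 0 <= (2 * lp)^-1 by rewrite invr_ge0 ltW.
have i3 := ler_pM i10 i20 i1 i2.
have := ler_wpM2l (ltW e0) i3.
have -> : expR (- lp) * (s2pi^-1 * (2 * lp)^-1) = s2pi^-1 * expR (- lp) / (2 * lp) by ring.
by have -> : expR (- lp) * (2^-1 * 2^-1) = expR (- lp) / 4 by field.
Qed.

(** Tilting by [th] turns the term [lnp z j / (2 * th)] of the level into the factor
    [sqrt ((j + 1) / z)], whose growth in [j] is offset by the noise deviation
    [H / sqrt (beta + j)]. *)
Lemma hinge_mean_level_le (N z th b : R) (j : nat) : 0 < N -> 0 < z -> 0 < th ->
  th ^+ 2 / 2 - th * b + ln N <= ln (2 * th * s2pi) ->
  hinge_mean (b + lnp z j / (2 * th)) <= 2 / (th * N) * (Num.sqrt j.+1%:R / Num.sqrt z).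
Proof.
move=> N0 z0 th0 bN; have s0 : 0 < (s2pi : R) by exact: s2pi_gt0.
apply: le_trans (hinge_mean_le th _ th0) _.
have j0 : 0 < j.+1%:R :> R by exact: ltr0n.
have x0 : 0 < 2 * th * s2pi / N by rewrite divr_gt0// !mulr_gt0.
have y0 : 0 < Num.sqrt j.+1%:R / Num.sqrt z by rewrite divr_gt0// sqrtr_gt0.
have e1 : expR (th ^+ 2 / 2 - th * (b + lnp z j / (2 * th))) <=
    2 * th * s2pi / N * (Num.sqrt j.+1%:R / Num.sqrt z).
  apply: expR_le_of_ln; [exact: mulr_gt0|rewrite lnM ?posrE//].
  have -> : th ^+ 2 / 2 - th * (b + lnp z j / (2 * th)) =
     (th ^+ 2 / 2 - th * b) - lnp z j / 2 by field; rewrite gt_eqF.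
  apply: lerD.
    by rewrite ln_div ?posrE ?mulr_gt0//; move: bN; clear; lra.
  have -> : ln (Num.sqrt j.+1%:R / Num.sqrt z) = - (ln (z / j.+1%:R) / 2).
    have -> : z / j.+1%:R = (Num.sqrt j.+1%:R / Num.sqrt z) ^- 2.
      by rewrite expr_div_n !sqr_sqrtr ?ltW// invf_div.
    by rewrite lnV ?posrE ?exprn_gt0// lnXn// -mulr_natl; field.
  by rewrite lerN2 ler_pM2r// /lnp le_max lexx orbT.
have c0 : 0 <= s2pi^-1 / th ^+ 2 by rewrite divr_ge0 ?invr_ge0 ?exprn_ge0// ltW.
have := ler_wpM2l c0 e1.
have -> : s2pi^-1 / th ^+ 2 * expR (th ^+ 2 / 2 - th * (b + lnp z j / (2 * th))) =
  s2pi^-1 * expR (th ^+ 2 / 2 - th * (b + lnp z j / (2 * th))) / th ^+ 2 by ring.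
have -> // : s2pi^-1 / th ^+ 2 * (2 * th * s2pi / N * (Num.sqrt j.+1%:R / Num.sqrt z)) =
  2 / (th * N) * (Num.sqrt j.+1%:R / Num.sqrt z).
by field; rewrite !gt_eqF// ?sqrtr_gt0.
Qed.

End HingeBounds.

(** * The regret bounds *)

Section RegretBound.
Context {R : realType} {X A : finType} (a0 : A) {H : nat} (beta : R) (x0 : outcome X).
Local Notation K := (sa_index X A H).
Local Notation O := (outcome X).
Local Notation D := (data X A H).
Local Notation N := ((#|X| * #|A|)%:R : R).
Variables (alpha : K -> O -> R) (rho : X -> R) (L : nat).
Hypothesis (H0 : (0 < H)%N) (L0 : (0 < L)%N) (beta2 : 2 <= beta).
Hypothesis (alpha0 : pos_params alpha) (alphab : forall k, \sum_o alpha k o = beta).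
Hypothesis (rho0 : forall x, 0 <= rho x) (rho1 : \sum_x rho x = 1).

Let beta0 : 0 < beta. Proof. by apply: lt_le_trans beta2. Qed.

Lemma sum_levels (F : K -> R) : \sum_k F k = \sum_(t : 'I_H) \sum_(xa : X * A) F (t, xa.1, xa.2).
Proof.
rewrite pair_bigA /= (reindex (fun p : 'I_H * (X * A) => (p.1, p.2.1, p.2.2)))//.
exists (fun k : K => (k.1.1, (k.1.2, k.2))) => [[t [y a]] _|[[t y] a] _] //.
Qed.

Lemma Wr_le (P : K -> O -> R) m (l : D) : (forall k o, 0 <= P k o) -> (forall k, \sum_o P k o = 1) ->
  Wr a0 beta rho P m l <= m%:R * H%:R.
Proof.
move=> P0 P1; elim: m l => [|m IH] l /=; first by rewrite mul0r.
have -> : m.+1%:R * H%:R = \sum_pi pol_weight a0 beta l pi * (m.+1%:R * H%:R) :> R.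
  by rewrite -mulr_suml sum_pol_weight ?mul1r.
apply: ler_sum => pi _; rewrite ler_wpM2l ?pol_weight_ge0// -natr1 mulrDl mul1r addrC.
have avg (f : X -> R) (B : R) : (forall x, f x <= B) -> \sum_x rho x * f x <= B.
  by move=> fB; rewrite -[leRHS]mul1r -rho1 mulr_suml ler_sum// => x _; rewrite ler_wpM2l.
apply: lerD; apply: avg => x.
  rewrite -(pathsum_cst P pi H 0 x (m%:R * H%:R) P1).
  by apply: le_pathsum => // l'; exact: IH.
have /andP[v0 _] := Vpi_itv a0 P pi x P0 P1.
have sD := Vstar_le_DP a0 P x P0.
have /andP[_ dH] := DP_itv a0 P H 0 x P0 (fun k _ => P1 k).
by rewrite lerBlDr (le_trans sD)// (le_trans dH)// lerDl.
Qed.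

Lemma regret_le_HL : Er x0 alpha (fun P => Wr a0 beta rho P L [::]) <= H%:R * L%:R.
Proof.
rewrite mulrC -(Er_cst x0 alpha (L%:R * H%:R)); apply: Er_le.
- exact: bm_Wr.
- exact: bm_cst.
- move=> P lP; apply: Wr_le => [k o|k]; first exact: legit_ge0.
  by have /andP[_ /eqP] := lP k.
Qed.

End RegretBound.

Lemma level_scale (F : fieldType) (h s th N q r : F) :
  h / s * (2 / (th * N) * (r / q)) = h * (2 / (th * N)) / q * (r / s).
Proof. by ring. Qed.

Lemma level_total (F : fieldType) (h th N q : F) : N != 0 ->
  h * N * (h * (2 / (th * N)) / q) = h ^+ 2 * (2 / th) / q.
Proof. by move=> N0; rewrite invfM -[RHS]mulr1 -(divff N0); ring. Qed.

(** With [q = sqrt (L / N)], the expected excess at an index is at most [2 H / (th N q)] whatever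
    its count, so the [H N] indices cost [2 H^2 / (th q)] per episode, free of logarithms of [L]. In
    the factor 5/4, the 1 is the bias and the 1/4 the overshoot. *)
Lemma regret_le_explicit {R : realType} {X A : finType} (a0 : A) {H : nat} (beta : R)
    (x0 : outcome X) (alpha : sa_index X A H -> outcome X -> R) (rho : X -> R) (L : nat)
    (N := (#|X| * #|A|)%:R : R) (lp := logp (1 + N * H%:R * L%:R)) :
  (0 < H)%N -> (0 < L)%N -> 2 <= beta -> pos_params alpha ->
  (forall k, \sum_o alpha k o = beta) -> (forall x, 0 <= rho x) -> \sum_x rho x = 1 ->
  (1 < #|X| * #|A|)%N ->
  Er x0 alpha (fun P => Wr a0 beta rho P L [::]) <=
  5 / 4 * beta * H%:R ^+ 3 * N * Num.sqrt lp * logp (1 + L%:R / N) +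
  2 * H%:R ^+ 2 * (N * Num.sqrt (L%:R / N)) * Num.sqrt (2 * ln N).
Proof.
move=> H0 L0 beta2 alpha0 alphab rho0 rho1 N2.
have beta0 : 0 < beta by apply: lt_le_trans beta2.
pose K := sa_index X A H; pose D := data X A H.
set U := Num.sqrt (2 * ln N); set z := L%:R / N.
(* The deduction [2 / th] makes room for two terms [th^-1], one from the excesses and one from the
   logarithm in the levels: see [bth]. The choice of [c] bounds the mean overshoot, summed over all
   [H N] indices, by [1 / (4 L)]. *)
pose th := theta_of U; pose b := U - 2 / th; pose c := Num.sqrt (2 * lp).
pose u j := b + lnp z j / (2 * th).
have N0 : 0 < N by rewrite ltr0n ltnW.
have N1 : 1 <= N by rewrite ler1n ltnW.
have LR : 0 < L%:R :> R by rewrite ltr0n.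
have L1 : 1 <= L%:R :> R by rewrite ler1n.
have HR : 0 < H%:R :> R by rewrite ltr0n.
have H1 : 1 <= H%:R :> R by rewrite ler1n.
have z0 : 0 < z by rewrite divr_gt0.
have lp1 : 1 <= lp by rewrite /lp /logp le_max lexx.
have th74 : 7 / 4 <= th by rewrite /th /theta_of le_max lexx orbT.
have th0 : 0 < th by move: th74; clear; lra.
have U0 : (117 + 63 / 100) / 100 <= U.
  apply: le_sqrt; first by clear; lra.
  have lN : ln 2 <= ln N by rewrite ler_ln ?posrE// ler_nat.
  by have := @ln2_ge R; move: lN; clear; lra.
have b0 : 0 <= b.
  rewrite /b subr_ge0 ler_pdivrMr//.
  have := ler_pM _ _ U0 th74; move=> /(_ _ _)/(le_trans _); apply; clear; lra.
have UU : U ^+ 2 = 2 * ln N by rewrite sqr_sqrtr// mulr_ge0// ln_ge0.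
have thb : th * b = th * U - 2 by rewrite /b mulrBr mulrC (mulrC th (2 / th)) divfK// gt_eqF.
have bN : th ^+ 2 / 2 - th * b + ln N <= ln (2 * th * s2pi).
  have := @theta_ineq R _ N2; rewrite -/U -/th thb.
  have -> : (th - U) ^+ 2 = th ^+ 2 - 2 * (th * U) + U ^+ 2 by ring.
  by rewrite UU; clear; lra.
set q := Num.sqrt z; have q0 : 0 < q by rewrite sqrtr_gt0.
have qq : q ^+ 2 = z by rewrite sqr_sqrtr// ltW.
have LNq : L%:R = N * q ^+ 2 by rewrite qq mulrC divfK// gt_eqF.
have cardK : #|{: K}|%:R = H%:R * N :> R by rewrite !card_prod card_ord -mulnA natrM.
have sd0H : sd0 (H := H) beta <= H%:R.
  rewrite /sd0 ler_pdivrMr ?sqrtr_gt0// ler_peMr ?(ltW HR)//.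
  by apply: le_sqrt => //; move: beta2; clear; lra.
have sd00 : 0 <= sd0 (H := H) beta by exact: sd0_ge0.
pose eps : R := H%:R ^+ 2 * (2 / th) / q + H%:R ^+ 3 / (4 * L%:R).
have eps0 : 0 <= eps.
  by rewrite addr_ge0// !mulr_ge0 ?invr_ge0 ?mulr_ge0 ?exprn_ge0 ?ler0n// ltW.
have noise_eps (l : D) e : episodes e l -> (e < L)%N -> noise_mean beta u c l <= eps.
  move=> _ _; apply: lerD.
    apply: (@le_trans _ _ (\sum_(k : K) H%:R * (2 / (th * N)) / q)).
      apply: ler_sum => k _.
      have hm := hinge_mean_level_le N z th b (nvisits l k) N0 z0 th0 bN.
      have s0 := noise_sd_gt0 beta H0 beta0 l k.
      apply: le_trans (ler_wpM2l (ltW s0) hm) _.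
      have n0 : 0 <= (nvisits l k)%:R :> R by exact: ler0n.
      have pc : 0 < pcount beta l k by apply: pcount_gt0.
      (* The total pseudocount is at least the count plus 1, which offsets the growth of the excess
         as the level decreases. *)
      have r1 : Num.sqrt (nvisits l k).+1%:R / Num.sqrt (pcount beta l k) <= 1.
        rewrite ler_pdivrMr ?sqrtr_gt0 ?pcount_gt0// mul1r ler_sqrt ?(ltW pc)//.
        by rewrite /pcount -natr1 addrC lerD2r; move: beta2; clear; lra.
      have g0 : 0 <= H%:R * (2 / (th * N)) / q.
        by rewrite !mulr_ge0 ?invr_ge0 ?mulr_ge0// ltW.
      have := ler_wpM2l g0 r1; rewrite mulr1; apply: le_trans.
      rewrite /noise_sd -/q le_eqVlt; apply/orP; left; apply/eqP.
      exact: level_scale.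
    rewrite sum_cstR cardK le_eqVlt; apply/orP; left; apply/eqP.
    by apply: level_total; rewrite gt_eqF.
  have hm := hinge_mean_sqrt_le lp lp1.
  have w0 : 0 < 1 + N * H%:R * L%:R by rewrite ltr_pwDl// !mulr_ge0// ltW.
  have elp : expR (- lp) <= (1 + N * H%:R * L%:R)^-1.
    rewrite expRN lef_pV2 ?posrE ?expR_gt0// -[leLHS]lnK ?posrE// ler_expR.
    by rewrite /lp /logp le_max lexx orbT.
  have NHL0 : 0 < N * H%:R * L%:R by rewrite !mulr_gt0.
  have hmL : N * H%:R * hinge_mean c <= (4 * L%:R)^-1.
    have nh0 : 0 <= N * H%:R by rewrite mulr_ge0// ltW.
    have t1 : hinge_mean c <= (1 + N * H%:R * L%:R)^-1 / 4.
      by apply: (le_trans hm); rewrite ler_pM2r.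
    apply: le_trans (ler_wpM2l nh0 t1) _.
    rewrite mulrA invfM [leRHS]mulrC ler_pM2r//.
    by rewrite ler_pdivrMr// ler_pdivlMl//; move: NHL0; clear; lra.
  rewrite cardK.
  have := ler_pM _ _ sd0H hmL; rewrite sd00 => /(_ isT).
  have nn : 0 <= N * H%:R * hinge_mean c by rewrite !mulr_ge0 ?hinge_mean_ge0// ltW.
  rewrite nn => /(_ isT) /(ler_wpM2l (exprn_ge0 2 (ltW HR))).
  have -> : H%:R ^+ 2 * (sd0 (H := H) beta * (N * H%:R * hinge_mean c)) =
     H%:R ^+ 2 * sd0 (H := H) beta * (H%:R * N * hinge_mean c) by ring.
  by have -> : H%:R ^+ 2 * (H%:R / (4 * L%:R)) = H%:R ^+ 3 / (4 * L%:R) :> R by ring.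
pose A0 : R := H%:R + (H%:R - 1) * sd0 (H := H) beta * c.
have c0 : 0 <= c by exact: sqrtr_ge0.
have A00 : 0 <= A0.
  by rewrite /A0 addr_ge0 ?(ltW HR)// mulr_ge0// mulr_ge0// subr_ge0.
pose Cmax : R := H%:R * (A0 * (beta * N * ln (1 + z)) + H%:R * (2 * (N * q) * (b + th^-1))).
have cardXA : #|{: X * A}|%:R = N :> R by rewrite card_prod.
have Pot_le (l : D) e : episodes e l -> (e <= L)%N -> Pot (gain (H := H) beta u c) l <= Cmax.
  move=> el eL; rewrite /Pot sum_levels.
  have lev (t : 'I_H) : \sum_(xa : X * A) \sum_(0 <= j < nvisits l (t, xa.1, xa.2))
      gain (H := H) beta u c j <=
      A0 * (beta * N * ln (1 + z)) + H%:R * (2 * (N * q) * (b + th^-1)).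
    have SN : \sum_(xa : X * A) (nvisits l (t, xa.1, xa.2))%:R <= #|{: X * A}|%:R * z.
      rewrite -natr_sum el cardXA /z mulrCA divff ?gt_eqF// mulr1 ler_nat//.
    have h1 := sum_bias beta (fun xa : X * A => nvisits l (t, xa.1, xa.2)) z beta2 z0 SN.
    have h2 := sum_noise beta (fun xa : X * A => nvisits l (t, xa.1, xa.2)) z b th beta2 z0 SN b0 th0.
    rewrite cardXA in h1 h2.
    have h3 := lerD (ler_wpM2l A00 h1) (ler_wpM2l (ltW HR) h2).
    apply: le_trans h3; rewrite !mulr_sumr -big_split /= ler_sum// => xa _.
    rewrite !mulr_sumr -big_split /= ler_sum// => j _.
    by rewrite /gain -/A0 /u le_eqVlt; apply/orP; left; apply/eqP; ring.
  apply: le_trans (ler_sum _ (fun t _ => lev t)) _.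
  by rewrite sum_cstR card_ord.
have main := regret_le a0 beta x0 H0 beta0 alpha rho u c alpha0 alphab rho0 rho1 c0 L eps Cmax
  eps0 noise_eps Pot_le.
apply: (le_trans main).
set x := Num.sqrt lp; set y := logp (1 + z).
have x1 : 1 <= x by apply: le_sqrt => //; rewrite expr1n.
have y1 : 1 <= y by rewrite /y /logp le_max lexx.
have lny : ln (1 + z) <= y by rewrite /y /logp le_max lexx orbT.
(* [sd0 * c] equals [H * sqrt (2 / beta) * x], and [beta] is at least 2. *)
have sc : sd0 (H := H) beta * c <= H%:R * x.
  rewrite /sd0 /c sqrtrM// mulrA ler_wpM2r ?sqrtr_ge0//.
  rewrite mulrAC -mulrA ler_piMr ?(ltW HR)// ler_pdivrMr ?sqrtr_gt0// mul1r ler_sqrt//.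
  exact: ltW.
have A0x : A0 <= H%:R ^+ 2 * x.
  have h1 : 0 <= H%:R - 1 :> R by rewrite subr_ge0.
  have h2 := ler_wpM2l h1 sc.
  rewrite /A0 -mulrA; move: h2 x1 HR; set s := _ * c; clear; nra.
have Leps : L%:R * eps = 2 * H%:R ^+ 2 * (N * q) * th^-1 + H%:R ^+ 3 / 4.
  rewrite /eps mulrDr; congr (_ + _); last by field; rewrite gt_eqF.
  by rewrite LNq; field; rewrite !gt_eqF.
rewrite Leps /Cmax.
have ln0 : 0 <= ln (1 + z) by rewrite ln_ge0// lerDl ltW.
have t1 : A0 * (beta * N * ln (1 + z)) <= H%:R ^+ 2 * x * (beta * N * y).
  apply: ler_pM => //; first by rewrite !mulr_ge0// ltW.
  by rewrite ler_pM2l ?mulr_gt0.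
have t2 : H%:R * (A0 * (beta * N * ln (1 + z))) <= beta * H%:R ^+ 3 * N * x * y.
  apply: le_trans (ler_wpM2l (ltW HR) t1) _.
  by rewrite le_eqVlt; apply/orP; left; apply/eqP; ring.
have t3 : H%:R ^+ 3 <= beta * H%:R ^+ 3 * N * x * y.
  have -> : beta * H%:R ^+ 3 * N * x * y = H%:R ^+ 3 * (beta * N * x * y) by ring.
  have b1 : 1 <= beta by move: beta2; clear; lra.
  by rewrite ler_peMr ?exprn_ge0 ?(ltW HR)// !mulr_ege1.
have bth : b + th^-1 + th^-1 = U by rewrite /b; ring.
have t4 : 2 * H%:R ^+ 2 * (N * q) * th^-1 + H%:R * (H%:R * (2 * (N * q) * (b + th^-1))) =
   2 * H%:R ^+ 2 * (N * q) * U by rewrite -bth; ring.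
rewrite mulrDr; move: t2 t3 t4.
set a1 := H%:R * (A0 * _); set a2 := H%:R * (H%:R * _); set a3 := _ * th^-1.
set a4 := H%:R ^+ 3 / 4; set a5 := beta * H%:R ^+ 3 * N * x * y.
set a6 := _ * U.
have -> : 5 / 4 * beta * H%:R ^+ 3 * N * x * y = 5 / 4 * a5 by rewrite /a5; ring.
rewrite /a4; move: a1 a2 a3 a5 a6 (H%:R ^+ 3) => a1 a2 a3 a5 a6 a7.
lra.
Qed.

(** * Degenerate cases and the two bounds *)

Section SinglePolicy.
Context {R : realType} {X A : finType} (a0 : A) {H : nat} (beta : R).
Local Notation K := (sa_index X A H).
Local Notation O := (outcome X).
Variable rho : X -> R.

Lemma Vstar_const (P : K -> O -> R) (v : R) x : (forall pi, Vpi P pi x = v) -> Vstar a0 P x = v.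
Proof.
move=> Pv; rewrite /Vstar Pv; under eq_bigr do rewrite Pv.
by elim/big_rec: _ => // pi y _ ->; rewrite maxxx.
Qed.

(** With one action all policies coincide. This settles [|X| |A| = 1], where [ln N = 0] and the base
    level would be negative. *)
Lemma Wr_single (P : K -> O -> R) m l : (forall k, \sum_o P k o = 1) -> #|A| = 1%N ->
  Wr a0 beta rho P m l = 0.
Proof.
move=> P1 A1; elim: m l => [//|m IH] l /=; rewrite big1// => pi _.
rewrite [X in _ + X]big1 => [|x _].
  rewrite big1 ?addr0 ?mulr0// => x _.
  rewrite (Vstar_const _ (Vpi P pi x)) ?subrr ?mulr0// => pi'.
  congr Vpi; apply/ffunP => tx; apply/eqP.
  by have /fintype1P[a aE] : #|A| == 1%N by [apply/eqP]; rewrite (aE (pi tx)) (aE (pi' tx)).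
have -> : (fun l' => Wr a0 beta rho P m (l ++ l')) = fun=> 0 by apply/funext => l'.
by rewrite pathsum_cst// mulr0.
Qed.

End SinglePolicy.

(** At [H = 0] the parameter [v = H^2] vanishes and the formulas for RLSVI degenerate, but there is
    no index and every value is 0. *)
Lemma BayesRegret_horizon0 {R : realType} {X A : finType} (a0 : A)
    (rho : X -> R) (alpha : sa_index X A 0 -> outcome X -> R)
    (theta : sa_index X A 0 -> R) (v lambda : R) (L : nat) :
  BayesRegret a0 rho alpha theta v lambda L = 0%E.
Proof.
rewrite /BayesRegret.
have e0 : enum {: 'I_0 * X * A} = [::].
  by apply/eqP; rewrite -size_eq0 -cardE !card_prod card_ord.
rewrite e0 /=; elim: L [::] => [//|L IH] D /=.
rewrite /gauss_int e0 /= big1; last by case=> [[[]]].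
rewrite mul1e [X in (_ + X)%E]big1 ?adde0.
  congr (_%:E); apply: big1 => x _; rewrite (@Vstar_const _ _ _ _ _ _ 0) => [|pi //].
  by rewrite /Vpi /= subrr mulr0.
by move=> x _; rewrite big1// => os _; rewrite IH mule0.
Qed.

(** Read [q] as [sqrt (L / n)]. If [q <= 4 sqrt beta h], the trivial bound [h L = h n q ^+ 2] is
    small enough. Otherwise [beta h] is below [sqrt beta q / 4], so the term in [h ^+ 3] is at most
    5/16 of [T]; with the noise term, at most [2 T], the sum stays below [4 T]. *)
Lemma bound_large_horizon {R : realType} (beta h n q x y U E : R) :
  2 <= beta -> 1 <= h -> 1 <= n -> 0 <= q -> 1 <= x -> 1 <= y -> 0 <= U -> U <= Num.sqrt 2 * x ->
  E <= h * (n * q ^+ 2) ->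
  E <= 5 / 4 * beta * h ^+ 3 * n * x * y + 2 * h ^+ 2 * (n * q) * U ->
  E <= 4 * h ^+ 2 * (Num.sqrt beta * (n * q) * x) * y.
Proof.
move=> beta2 h1 n1 q0 x1 y1 U0 Ux EHL Eexp.
have beta0 : 0 <= beta by move: beta2; clear; lra.
have h0 : 0 <= h by move: h1; clear; lra.
have n0 : 0 <= n by move: n1; clear; lra.
have x0 : 0 <= x by move: x1; clear; lra.
have y0 : 0 <= y by move: y1; clear; lra.
set s := Num.sqrt beta; have s0 : 0 <= s by exact: sqrtr_ge0.
have ss : s ^+ 2 = beta by rewrite sqr_sqrtr.
have s2 : Num.sqrt 2 <= s by rewrite ler_wsqrtr.
have Us : U <= s * x by apply: (le_trans Ux); rewrite ler_wpM2r.
have xy1 : 1 <= x * y by rewrite mulr_ege1.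
have [qs|qs] := lerP q (4 * s * h).
  apply: (le_trans EHL).
  have m0 : 0 <= h * n * q by rewrite !mulr_ge0.
  have := ler_wpM2l m0 qs.
  have m1 : 0 <= 4 * h ^+ 2 * s * n * q by rewrite !mulr_ge0// exprn_ge0.
  have := ler_wpM2l m1 xy1.
  have -> : h * n * q * q = h * (n * q ^+ 2) by ring.
  have -> : h * n * q * (4 * s * h) = 4 * h ^+ 2 * s * n * q by ring.
  have -> : 4 * h ^+ 2 * s * n * q * (x * y) = 4 * h ^+ 2 * (s * (n * q) * x) * y by ring.
  by clear; lra.
apply: (le_trans Eexp).
set T := h ^+ 2 * (s * (n * q) * x) * y.
have T1 : 5 / 4 * beta * h ^+ 3 * n * x * y <= 5 / 16 * T.
  have m0 : 0 <= 5 / 16 * (s * h ^+ 2 * n * x * y) by rewrite !mulr_ge0// exprn_ge0.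
  have := ler_wpM2l m0 (ltW qs); rewrite -ss.
  have -> : 5 / 16 * (s * h ^+ 2 * n * x * y) * (4 * s * h) = 5 / 4 * s ^+ 2 * h ^+ 3 * n * x * y.
    by field.
  by have -> : 5 / 16 * (s * h ^+ 2 * n * x * y) * q = 5 / 16 * T by rewrite /T; ring.
have T2 : 2 * h ^+ 2 * (n * q) * U <= 2 * T.
  have m0 : 0 <= 2 * h ^+ 2 * (n * q) by rewrite !mulr_ge0// exprn_ge0.
  apply: le_trans (ler_wpM2l m0 Us) _.
  have m1 : 0 <= 2 * h ^+ 2 * (n * q) * (s * x) by rewrite !mulr_ge0// exprn_ge0.
  have := ler_wpM2l m1 y1; rewrite mulr1.
  by have -> : 2 * h ^+ 2 * (n * q) * (s * x) * y = 2 * T by rewrite /T; ring.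
have T0 : 0 <= T by rewrite /T !mulr_ge0// exprn_ge0.
have -> : 4 * h ^+ 2 * (s * (n * q) * x) * y = 4 * T by rewrite /T; ring.
by move: T0 T1 T2; clear; lra.
Qed.

Theorem mainTheorem1 (R : realType) (X A : finType) (a0 : A) (H : nat)
    (rho : X -> R) (beta : R) (alpha : sa_index X A H -> outcome X -> R)
    (L : nat) :
  (forall x, 0 <= rho x) -> \sum_(x : X) rho x = 1 ->
  2 <= beta ->
  (forall k o, 0 < alpha k o) ->
  (forall k, \sum_(o : outcome X) alpha k o = beta) ->
  let v : R := (H ^ 2)%:R in
  let lambda : R := v / beta in
  let theta : sa_index X A H -> R := fun _ => H%:R in
  let nXA : R := (#|X| * #|A|)%:R in
  (BayesRegret a0 rho alpha theta v lambda L
     <= (4 * (H ^ 2)%:R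
         * Num.sqrt (beta * nXA * L%:R * logp (1 + nXA * H%:R * L%:R))
         * logp (1 + L%:R / nXA))%:E)%E
  /\
  (BayesRegret a0 rho alpha theta v lambda L
     <= (4 * beta * (H ^ 3)%:R * nXA
           * Num.sqrt (logp (1 + nXA * H%:R * L%:R))
           * logp (1 + L%:R / nXA)
         + 2 * (H ^ 2)%:R * Num.sqrt (2 * nXA * L%:R * ln nXA))%:E)%E.
Proof.
move=> rho0 rho1 beta2 alpha0 alphab v lambda theta nXA.
(* [rho] sums to 1, so there is a state. *)
have [xX _] : {x : X | true}.
  apply/sigW; case: (pickP [pred x : X | true]) => [x _|X0]; first by exists x.
  by move: rho1; rewrite big_pred0 => [/eqP|x]; [rewrite eq_sym oner_eq0|have := X0 x].
pose x0 : outcome X := (true, xX).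
have beta0 : 0 < beta by apply: lt_le_trans beta2.
have N0 : (0 < #|X| * #|A|)%N by rewrite muln_gt0; apply/andP; split; apply/card_gt0P; [exists xX|exists a0].
have nXA0 : 0 <= nXA by exact: ler0n.
have nXA1 : 1 <= nXA by rewrite /nXA ler1n.
have logp1 (w : R) : 1 <= logp w by rewrite /logp le_max lexx.
have logp0 (w : R) : 0 <= logp w by apply: le_trans (logp1 w).
have B1 : 0 <= 4 * (H ^ 2)%:R * Num.sqrt (beta * nXA * L%:R * logp (1 + nXA * H%:R * L%:R))
         * logp (1 + L%:R / nXA) by rewrite !mulr_ge0.
have B2 : 0 <= 4 * beta * (H ^ 3)%:R * nXA * Num.sqrt (logp (1 + nXA * H%:R * L%:R))
           * logp (1 + L%:R / nXA) + 2 * (H ^ 2)%:R * Num.sqrt (2 * nXA * L%:R * ln nXA).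
  by rewrite addr_ge0// !mulr_ge0// ltW.
have [H0|H0] := posnP H; first by subst H; rewrite BayesRegret_horizon0 !lee_fin.
rewrite /v /lambda /theta (BayesRegret_Er a0 beta H0 beta0 rho rho0 x0)// !lee_fin.
have [L0|L0] := posnP L.
  by rewrite (Er_eq _ _ _ (fun=> 0)) ?Er_cst// => P _; rewrite L0.
have [N2|N1] := ltnP 1 (#|X| * #|A|); last first.
  rewrite (Er_eq _ _ _ (fun=> 0)) ?Er_cst// => P lP.
  apply: Wr_single => [k|]; first by have /andP[_ /eqP] := lP k.
  apply/eqP; move: N0 N1; rewrite muln_gt0 => /andP[X0 A0].
  by rewrite eqn_leq A0 andbT; apply: leq_trans; rewrite leq_pmull.
have HL := regret_le_HL a0 beta x0 alpha rho L H0 beta2 rho0 rho1.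
have Exp := regret_le_explicit a0 beta x0 alpha rho L H0 L0 beta2 alpha0 alphab rho0 rho1 N2.
have LR : 0 < L%:R :> R by rewrite ltr0n.
have H1 : 1 <= H%:R :> R by rewrite ler1n.
move: HL Exp; set E := Er _ _ _; rewrite -/nXA.
set lp := logp (1 + nXA * H%:R * L%:R); set y := logp (1 + L%:R / nXA).
(* Root of the average number of visits; [nXA * L = (nXA * q) ^+ 2] then clears the square roots of
   both bounds. *)
set q := Num.sqrt (L%:R / nXA); have q0 : 0 <= q by exact: sqrtr_ge0.
have nn : nXA != 0 by rewrite gt_eqF// (lt_le_trans ltr01).
have qq : q ^+ 2 = L%:R / nXA by rewrite sqr_sqrtr// divr_ge0.
have LE : L%:R = nXA * q ^+ 2 by rewrite qq mulrC divfK.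
have nL : nXA * L%:R = (nXA * q) ^+ 2 by rewrite LE; ring.
have nq0 : 0 <= nXA * q by rewrite mulr_ge0.
set x := Num.sqrt lp; set U := Num.sqrt (2 * ln nXA) => HL Exp.
have x1 : 1 <= x by apply: le_sqrt => //; rewrite expr1n; exact: logp1.
have lnN : ln nXA <= lp.
  rewrite /lp /logp le_max; apply/orP; right.
  rewrite ler_ln ?posrE ?(lt_le_trans ltr01)// ?lerDl ?mulr_ge0//.
  have L1 : 1 <= L%:R :> R by rewrite ler1n.
  have := ler_wpM2l nXA0 (mulr_ege1 H1 L1); rewrite mulr1 mulrA; clear; lra.
split.
  have -> : Num.sqrt (beta * nXA * L%:R * lp) = Num.sqrt beta * (nXA * q) * x.
    by rewrite -(mulrA beta) nL sqrtrM ?mulr_ge0 ?exprn_ge0// ?ltW// sqrtrM ?ltW// sqrtr_sqr ger0_norm.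
  rewrite natrX; apply: (bound_large_horizon _ _ _ _ _ _ U) => //.
  - exact: logp1.
  - exact: sqrtr_ge0.
  - by rewrite -sqrtrM// ler_wsqrtr// ler_pM2l.
  - by rewrite -LE.
apply: (le_trans Exp); rewrite !natrX.
have -> : Num.sqrt (2 * nXA * L%:R * ln nXA) = nXA * q * U.
  rewrite (_ : 2 * nXA * L%:R * ln nXA = (nXA * q) ^+ 2 * (2 * ln nXA)); last by rewrite -nL; ring.
  by rewrite sqrtrM ?exprn_ge0// sqrtr_sqr ger0_norm.
rewrite (mulrA _ (nXA * q) U) lerD2r.
have -> : 5 / 4 * beta * H%:R ^+ 3 * nXA * x * y = 5 / 4 * (beta * H%:R ^+ 3 * nXA * x * y) by ring.
have -> : 4 * beta * H%:R ^+ 3 * nXA * x * y = 4 * (beta * H%:R ^+ 3 * nXA * x * y) by ring.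
have y0 : 0 <= y by exact: logp0.
have : 0 <= beta * H%:R ^+ 3 * nXA * x * y.
  by rewrite !mulr_ge0 ?exprn_ge0 ?sqrtr_ge0 ?(ltW beta0).
by set w := _ * y; clear; lra.
Qed.
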